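(* Let $\mathcal{N}$ be a near octagon of order $(2,10)$ containing a subgeometry isomorphic to the Hall-Janko near octagon $\mathsf{HJ}$ that is isometrically embedded in $\mathcal{N}$. Then $\mathcal{N}$ is isomorphic to the $G_2(4)$ near octagon $\mathcal{G}$.
   Context: A partial linear space has order $(s,t)$ if every line has exactly $s+1$ points and every point is on exactly $t+1$ lines. Distances are measured in the collinearity graph. A near $2d$-gon is a partial linear space whose collinearity graph is connected of diameter $d$ and such that for every point $x$ and every line $L$ there is a unique point on $L$ nearest to $x$; a near octagon is a near $8$-gon. A subgeometry is isometrically embedded if distances between its points measured in it and in the ambient geometry coincide. The Hall-Janko near octagon $\mathsf{HJ}$ has as points the $315$ central involutions of $J_2$ and as lines the triples $\{x,y,xy\}$ with $x,y$ distinct commuting central involutions (it is the unique regular near octagon with parameters $(2,4;0,3)$). The $G_2(4)$ near octagon $\mathcal{G}$ is defined as follows: let $G=G_2(4){:}2$ and let $C$ be its conjugacy class $2A$ of $4095$ central involutions; the points of $\mathcal{G}$ are the elements of $C$ and the lines are the $15015$ triples $\{x,y,xy\}$ where $x,y\in C$ are distinct commuting involutions with $[G:N_G(\langle x,y\rangle)]\in\{1365,13650\}$. It is a near octagon of order $(2,10)$. *)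

(* Defs.v *)
From HB Require Import structures.
From mathcomp Require Import all_boot all_order all_algebra all_fingroup.
From mathcomp Require Import all_solvable all_field.
From mathcomp Require Import classical_sets functions cardinality.

Set Implicit Arguments.
Unset Strict Implicit.
Unset Printing Implicit Defensive.

Import GRing.Theory.

Local Open Scope card_scope.

Record geometry := Geometry {
  points : Type;
  lines : Type;
  incident : points -> lines -> Prop
}.

Definition partial_linear_space (S : geometry) : Prop :=
  forall (x y : points S) (L M : lines S), x <> y ->
    incident x L -> incident y L -> incident x M -> incident y M -> L = M.

Definition has_order (S : geometry) (s t : nat) : Prop :=
  (forall L : lines S, ([set x : points S | incident x L] #= `I_s.+1)%classic)
  /\ (forall x : points S,
        ([set L : lines S | incident x L] #= `I_t.+1)%classic).

Definition collinear (S : geometry) (x y : points S) : Prop :=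
  x <> y /\ exists L : lines S, incident x L /\ incident y L.

Fixpoint walk (S : geometry) (n : nat) (x y : points S) : Prop :=
  if n is m.+1 then exists z : points S, collinear x z /\ walk m z y
  else x = y.

(* The distance as a relation, since it need not be finite in general:
   [dist x y n] means d(x, y) = n, and no [n] qualifies when there is no path
   from [x] to [y]. *)
Definition dist (S : geometry) (x y : points S) (n : nat) : Prop :=
  walk n x y /\ forall m, walk m x y -> n <= m.

Definition connected (S : geometry) : Prop :=
  forall x y : points S, exists n, walk n x y.

Definition has_diameter (S : geometry) (d : nat) : Prop :=
  (forall (x y : points S) n, dist x y n -> n <= d)
  /\ exists x y : points S, dist x y d.

Definition nearest (S : geometry) (x : points S) (L : lines S)
    (y : points S) : Prop :=
  incident y L /\
  exists n, dist x y n /\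
    forall (z : points S) m, incident z L -> dist x z m -> n <= m.

Definition near_2gon (d : nat) (S : geometry) : Prop :=
  [/\ partial_linear_space S, connected S, has_diameter S d
    & forall (x : points S) (L : lines S), exists! y : points S, nearest x L y].

Definition near_octagon (S : geometry) : Prop := near_2gon 4 S.

Definition isomorphic (S T : geometry) : Prop :=
  exists (f : points S -> points T) (g : lines S -> lines T),
    [/\ bijective f, bijective g
      & forall x L, incident x L <-> incident (f x) (g L)].

Definition subgeometry (S : geometry) (A : points S -> Prop)
    (B : lines S -> Prop) : geometry :=
  @Geometry {x : points S | A x} {L : lines S | B L}
    (fun x L => incident (sval x) (sval L)).

Definition isometrically_embedded (S : geometry) (A : points S -> Prop)
    (B : lines S -> Prop) : Prop :=
  forall (x y : points (subgeometry A B)) (n : nat),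
    dist x y n <-> dist (sval x) (sval y) n.

Definition set_geometry (T : finType) (P : {set T}) (B : {set {set T}}) :
    geometry :=
  @Geometry {x : T | x \in P} {l : {set T} | l \in B}
    (fun x l => sval x \in sval l).

Section Involutions.

Local Open Scope group_scope.

Variables (gT : finGroupType) (G : {group gT}).

(* An involution is central if it lies in the centre of a Sylow 2-subgroup. *)
Definition central_involutions : {set gT} :=
  [set x in G | (#[x] == 2) && [exists S in 'Syl_2(G), x \in 'Z(S)]].

Definition involution_lines (P : {set gT} -> bool) : {set {set gT}} :=
  [set [set x; y; x * y] | x in central_involutions, y in central_involutions
     & [&& x != y, x * y == y * x & P [set x; y]]].

End Involutions.

(* J_2 in its primitive rank 3 action (subdegrees 1, 36, 63) on the 100
   vertices of the Hall-Janko graph, by the standard generators of the ATLAS of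
   Finite Group Representations, of orders 2 and 3 with product of order 7. *)

(* The cycle (c_1 c_2 ... c_k) on {1, ..., 100}; [s * t] applies [s] first. *)
Definition cycle100 (c : seq nat) : 'S_100 :=
  (\prod_(i <- behead c)
     tperm (inord (head 0 c).-1 : 'I_100) (inord i.-1 : 'I_100))%g.

Definition perm_of_cycles (cs : seq (seq nat)) : 'S_100 :=
  (\prod_(c <- cs) cycle100 c)%g.

Definition J2_a : 'S_100 := perm_of_cycles [::
  [:: 1; 84]; [:: 2; 20]; [:: 3; 48]; [:: 4; 56]; [:: 5; 82]; [:: 6; 67];
  [:: 7; 55]; [:: 8; 41]; [:: 9; 35]; [:: 10; 40]; [:: 11; 78]; [:: 12; 100];
  [:: 13; 49]; [:: 14; 37]; [:: 15; 94]; [:: 16; 76]; [:: 17; 19];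
  [:: 18; 44]; [:: 21; 34]; [:: 22; 85]; [:: 23; 92]; [:: 24; 57];
  [:: 25; 75]; [:: 26; 28]; [:: 27; 64]; [:: 29; 90]; [:: 30; 97];
  [:: 31; 38]; [:: 32; 68]; [:: 33; 69]; [:: 36; 53]; [:: 39; 61];
  [:: 42; 73]; [:: 43; 91]; [:: 45; 86]; [:: 46; 81]; [:: 47; 89];
  [:: 50; 93]; [:: 51; 96]; [:: 52; 72]; [:: 54; 74]; [:: 58; 99];
  [:: 59; 95]; [:: 60; 63]; [:: 62; 83]; [:: 65; 70]; [:: 66; 88];
  [:: 71; 87]; [:: 77; 98]; [:: 79; 80]].

Definition J2_b : 'S_100 := perm_of_cycles [::
  [:: 1; 80; 22]; [:: 2; 9; 11]; [:: 3; 53; 87]; [:: 4; 23; 78];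
  [:: 5; 51; 18]; [:: 6; 37; 24]; [:: 8; 27; 60]; [:: 10; 62; 47];
  [:: 12; 65; 31]; [:: 13; 64; 19]; [:: 14; 61; 52]; [:: 15; 98; 25];
  [:: 16; 73; 32]; [:: 17; 39; 33]; [:: 20; 97; 58]; [:: 21; 96; 67];
  [:: 26; 93; 99]; [:: 28; 57; 35]; [:: 29; 71; 55]; [:: 30; 69; 45];
  [:: 34; 86; 82]; [:: 38; 59; 94]; [:: 40; 43; 91]; [:: 42; 68; 44];
  [:: 46; 85; 89]; [:: 48; 76; 90]; [:: 49; 92; 77]; [:: 50; 66; 88];
  [:: 54; 95; 56]; [:: 63; 74; 72]; [:: 70; 81; 75]; [:: 79; 100; 83]].

Definition J2 : {group 'S_100} := <<[set J2_a; J2_b]>>%G.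

Definition HJ : geometry :=
  set_geometry (central_involutions J2) (involution_lines J2 xpredT).

Section SplitOctonions.

Local Open Scope ring_scope.

Variable F : finFieldType.

(* Zorn's vector matrices: (a, u, v, b) stands for the matrix with rows (a, u)
   and (v, b), whose addition is componentwise. *)
Definition octonion : Type := (F * 'rV[F]_3 * 'rV[F]_3 * F)%type.

HB.instance Definition _ := Finite.on octonion.
HB.instance Definition _ := GRing.Zmodule.on octonion.

Definition dot (u v : 'rV[F]_3) : F := \sum_i u 0 i * v 0 i.

(* Indices are added modulo 3. *)
Definition cross (u v : 'rV[F]_3) : 'rV[F]_3 :=
  \row_(i < 3) (u 0 (i + 1) * v 0 (i + 2%:R) - u 0 (i + 2%:R) * v 0 (i + 1)).

Definition octonion_mul (x y : octonion) : octonion :=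
  let: (a, u, v, b) := x in
  let: (c, p, q, d) := y in
  (a * c + dot u q,
   a *: p + d *: u - cross v q,
   c *: v + b *: q + cross u p,
   b * d + dot v p).

(* Additive and multiplicative, but not required to be F-linear. *)
Definition octonion_aut_set : {set {perm octonion}} :=
  [set s : {perm octonion} | [forall x : octonion, forall y : octonion,
     (s (x + y) == s x + s y)
     && (s (octonion_mul x y) == octonion_mul (s x) (s y))]].

Lemma octonion_aut_group_set : group_set octonion_aut_set.
Proof.
apply/group_setP; split=> [|s t].
  by rewrite inE; apply/forallP=> x; apply/forallP=> y; rewrite !perm1 !eqxx.
rewrite !inE => /forallP sP /forallP tP.
apply/forallP=> x; apply/forallP=> y; rewrite !permM.
have /forallP/(_ y)/andP[/eqP-> /eqP->] := sP x.
by have /forallP/(_ (s y))/andP[/eqP-> /eqP->] := tP (s x); rewrite !eqxx.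
Qed.

Definition octonion_aut : {group {perm octonion}} :=
  Group octonion_aut_group_set.

End SplitOctonions.

Definition F4 : finFieldType :=
  s2val (@pPrimePowerField 2 2 (isT : prime 2) (isT : 0 < 2)).

(* G_2(4) is the group of F4-linear automorphisms of the split octonion algebra
   over F4. A ring automorphism maps the centre F4 of that algebra to itself,
   so the ring automorphisms form the extension G_2(4):2 of G_2(4) by the field
   automorphism. *)
Definition G24_2 : {group {perm octonion F4}} := octonion_aut F4.

(* The central involutions of G_2(4):2 are its class 2A: that class has odd
   size 4095, and the other classes of involutions have even size. *)
Definition G24_near_octagon : geometry :=
  set_geometry (central_involutions G24_2)
    (involution_lines G24_2 (fun A =>
       #|G24_2 : 'N_G24_2(<<A>>)|%g \in [:: 1365; 13650])).

(* Main.v *)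
From Stdlib Require Import PArith FMapPositive.
From HB Require Import structures.
From mathcomp Require Import all_boot all_order all_algebra all_fingroup all_solvable all_field.
From mathcomp Require Import zify ring boolp.
Require Import Defs.
Set Implicit Arguments.
Unset Strict Implicit.
Unset Printing Implicit Defensive.

(** For a point y of N let v_y be the function u |-> d(y, u) on the 315 points of
    the embedded copy H of HJ. On each line of H one value of v_y is smaller by
    one than the two others, and a search shows that a point outside H which is
    collinear with a point i of H has one of twelve functions v_y: two of them
    (type B) have 10 points of H at distance 2, the other ten (type C) have 26.
    Near polygon arguments and the count of 22 neighbours show that each of the
    twelve occurs exactly once at every i, that the thirteen labels at i and at
    the neighbouring i determine all collinearities, and hence that H and its
    neighbours exhaust N. So N has 315 * 13 = 4095 points, labelled by pairs
    (i, k), and its collinearity graph is determined.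

    On the other side the class 2A of G_2(4):2 consists of the maps 1 + n_ab with
    n_ab(v) = B(v, a) b + B(v, b) a, where a and b span a totally null plane with
    a b = b a = 0. An explicit subgroup J_2 of G_2(4) has the orbits of a root
    element and of twelve of its neighbours indexed by the same labels, with the
    same neighbours, so that the labels define a collinearity preserving map from
    N onto the class 2A; both graphs are regular of degree 22, so this is an
    isomorphism. *)

(** * Tables for the Hall-Janko near octagon *)

(** A label makes sense only in a frame. A word [w] in the two generators carries 1 to [wapp w 1];
    words with the same end differ by an element of the stabiliser of 1 in J_2, which may permute
    the twelve functions. Hence [lab w k y] mentions the word, and changes of frame are explicit
    checks. Comparing values at the 315 points only limits the labels that a neighbour can carry;
    existence has other sources. Geodesics of length 2 give neighbours with forced labels, which
    spreads the occurrence, or double occurrence, of one type C label to all ten. At a point of H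
    there are 22 - 10 = 12 outer neighbours: ten labels occurring twice would need 20, so each
    occurs once, and two places remain for type B. Points with no neighbour in H are excluded next
    to type B points by a second search, next to type C points only after 22 labelled neighbours
    have been exhibited. On the group side no group order is computed: centrality comes from a Sylow
    subgroup acting on a set of odd size, the indices 1365 and 13650 from a double count of
    commuting pairs. *)

Lemma Pos_eqP : Equality.axiom Pos.eqb.
Proof. by move=> x y; apply: (iffP idP) => /Pos.eqb_eq. Qed.
HB.instance Definition _ := hasDecEq.Build positive Pos_eqP.

Notation trie := PositiveMap.t.

Definition get (A : Type) (x0 : A) (t : trie A) (i : positive) : A :=
  if PositiveMap.find i t is Some x then x else x0.

Definition trie_of (A : Type) (s : seq (positive * A)) : trie A :=
  foldr (fun p t => PositiveMap.add p.1 p.2 t) (PositiveMap.empty A) s.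

Definition pos_seq (n : nat) : seq positive := [seq Pos.of_succ_nat i | i <- iota 0 n].

Definition pts : seq positive := Eval vm_compute in pos_seq 315.
Definition dom100 : seq positive := Eval vm_compute in pos_seq 100.

Definition arr_trie (l : seq positive) : trie positive := trie_of (zip dom100 l).
Definition acomp (l m : seq positive) : seq positive :=
  let t := arr_trie m in [seq get 1%positive t i | i <- l].

Definition arr_a : seq positive := [:: 84; 20; 48; 56; 82; 67; 55; 41; 35; 
  40; 78; 100; 49; 37; 94; 76; 19; 44; 17; 2; 34; 85; 92; 57; 75; 28; 64; 26; 
  90; 97; 38; 68; 69; 21; 9; 53; 14; 31; 61; 10; 8; 73; 91; 18; 86; 81; 89; 3; 
  13; 93; 96; 72; 36; 74; 7; 4; 24; 99; 95; 63; 39; 83; 60; 27; 70; 88; 6; 32; 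
  33; 65; 87; 52; 42; 54; 25; 16; 98; 11; 80; 79; 46; 5; 62; 1; 22; 45; 71; 66; 
  47; 29; 43; 23; 50; 15; 59; 51; 30; 77; 58; 12]%positive.
Definition arr_b : seq positive := [:: 80; 9; 53; 23; 51; 37; 7; 27; 11; 62; 
  2; 65; 64; 61; 98; 73; 39; 5; 13; 97; 96; 1; 78; 6; 15; 93; 60; 57; 71; 69; 
  12; 16; 17; 86; 28; 36; 24; 59; 33; 43; 41; 68; 91; 42; 30; 85; 10; 76; 92; 
  66; 18; 14; 87; 95; 29; 54; 35; 20; 94; 8; 52; 47; 74; 19; 31; 88; 21; 44; 
  45; 81; 55; 63; 32; 72; 70; 90; 49; 4; 100; 22; 75; 34; 79; 84; 89; 82; 3; 
  50; 46; 48; 40; 77; 99; 38; 56; 67; 58; 25; 26; 83]%positive.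

Definition arr_b' := Eval vm_compute in acomp arr_b arr_b.
Definition aconj (c : bool) (l : seq positive) : seq positive :=
  if c then acomp (acomp arr_b' l) arr_b else acomp (acomp arr_a l) arr_a.

(** The sixth power of a b a b^-1 is an involution; [central_J2] shows that its class consists of
    the central ones. *)
Definition arr_z : seq positive := Eval vm_compute in
  let g := acomp (acomp (acomp arr_a arr_b) arr_a) arr_b' in
  let g2 := acomp g g in acomp (acomp g2 g2) g2.

(* Breadth first enumeration of the orbit of [x], each element but the first
   with the index of its parent and the generator leading to it. *)
Section Orbit.
Variables (A : Type) (eqA : A -> A -> bool) (step : seq (A -> A)).

Fixpoint orbit_rec (fuel : nat) (queue acc : seq (A * (positive * nat)))
    (k : positive) : seq (A * (positive * nat)) :=
  if fuel is n.+1 then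
    if queue is x :: queue' then
      let add := fix add (i : nat) (st : seq (A -> A)) (q acc : seq (A * (positive * nat))) :=
        if st is f :: st' then
          let y := f x.1 in
          if has (fun z => eqA y z.1) acc then add i.+1 st' q acc
          else add i.+1 st' (rcons q (y, (k, i))) ((y, (k, i)) :: acc)
        else (q, acc) in
      let r := add 0 step queue' acc in
      orbit_rec n r.1 r.2 (Pos.succ k)
    else rev acc
  else rev acc.
End Orbit.

(* The 315 central involutions of J_2 as lists of images; from now on the points of HJ
   are numbered from 1 in this order, and 1 is the involution [arr_z]. *)
Definition hj_orbit := Eval vm_compute in
  orbit_rec (@eqseq positive) [:: aconj false; aconj true] 1000
    [:: (arr_z, (1%positive, 0))] [:: (arr_z, (1%positive, 0))] 1%positive.

Definition hj_arr : seq (seq positive) := Eval vm_compute in map fst hj_orbit.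
Definition gtab (c : bool) : trie positive := 
  let f := fun l => Pos.of_succ_nat (index (aconj c l) hj_arr) in
  trie_of (zip pts (map f hj_arr)).
Definition gtab_a := Eval vm_compute in gtab false.
Definition gtab_b := Eval vm_compute in gtab true.
Definition gen (c : bool) (u : positive) : positive :=
  get 1%positive (if c then gtab_b else gtab_a) u.

(** The head of the word acts last, so that a child in the orbit tree gets its word from its parent
    by prefixing one letter. *)
Fixpoint wapp (w : seq bool) (u : positive) : positive :=
  if w is c :: w' then gen c (wapp w' u) else u.
Definition words : trie (seq bool) := Eval vm_compute in
  foldl (fun t p => PositiveMap.add p.1
     (if p.1 is 1%positive then [::] else (0 < p.2.2.2) :: get [::] t p.2.2.1) t)
   (PositiveMap.empty _) (zip pts hj_orbit).
Definition tw (u : positive) : seq bool := get [::] words u.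

Definition hj_tries : seq (trie positive) := Eval vm_compute in map arr_trie hj_arr.
Definition acommute (s t : trie positive) : bool :=
  all (fun i => Pos.eqb (get 1 t (get 1 s i)) (get 1 s (get 1 t i)))%positive dom100.
Definition adj_list (s : trie positive) (u : positive) : seq positive :=
  [seq v.1 | v <- zip pts hj_tries & ~~ Pos.eqb v.1 u && acommute s v.2].
Definition adj : trie (seq positive) := Eval vm_compute in
  trie_of (zip pts [seq adj_list p.2 p.1 | p <- zip pts hj_tries]).
Definition adjs (u : positive) : seq positive := get [::] adj u.

Definition triple (A : Type) : Type := (A * A * A)%type.
Definition hj_lines : seq (triple positive) := Eval vm_compute in
  flatten [seq [seq (u, p.1, p.2) | p <- [seq (v, w) | v <- adjs u, w <- adjs u] &
    [&& Pos.ltb u p.1, Pos.ltb p.1 p.2 & p.2 \in adjs p.1]] | u <- pts].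
Definition in_pts (u : positive) : bool := Pos.leb u 315.
(** Mutual collinearity is the right test: in a near polygon three mutually collinear points lie on
    one line ([third_uniq]), so the distances from any point to them satisfy [pat]. *)
Definition hline (l : triple positive) : bool :=
  [&& in_pts l.1.1, in_pts l.1.2, in_pts l.2,
      l.1.2 \in adjs l.1.1, l.2 \in adjs l.1.1 & l.2 \in adjs l.1.2].
Fixpoint levels (n : nat) (k : nat) (fr : seq positive) (t : trie nat) : trie nat :=
  if n is n'.+1 then
    let t' := foldl (fun t u => PositiveMap.add u k t) t fr in
    let nxt := [seq v <- pts | ~~ PositiveMap.mem v t' && has (fun u => u \in fr) (adjs v)] in
    levels n' k.+1 nxt t'
  else t.
Definition lev_trie : trie nat := Eval vm_compute in levels 5 0 [:: 1%positive] (PositiveMap.empty _).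
Definition lev (u : positive) : nat := get 9 lev_trie u.

Definition cline : Type := (triple positive * seq (triple nat))%type.

Section Solver.
Variable through : trie (seq cline).

Definition dget (st : trie (seq nat)) u : seq nat := get [::] st u.

Definition revise1 (st : trie (seq nat)) u (d : seq nat) (ch : seq positive) :=
  if size d == size (dget st u) then (st, ch) else (PositiveMap.add u d st, u :: ch).

(** Arc consistency for one line: a value survives if it belongs to a permitted triple whose entries
    are all still available; [None] signals a contradiction. *)
Definition revise (st : trie (seq nat)) (ch : seq positive) (l : cline) :=
  let: (i, j, k) := l.1 in
  let al := [seq t <- l.2 | [&& t.1.1 \in dget st i, t.1.2 \in dget st j & t.2 \in dget st k]] in
  let r1 := revise1 st i [seq x <- dget st i | x \in map (fun t => t.1.1) al] ch in
  let r2 := revise1 r1.1 j [seq x <- dget r1.1 j | x \in map (fun t => t.1.2) al] r1.2 in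
  let r3 := revise1 r2.1 k [seq x <- dget r2.1 k | x \in map (fun t => t.2) al] r2.2 in
  if nilp al then None else Some r3.

Fixpoint pass (ls : seq cline) (st : trie (seq nat)) (ch : seq positive) :=
  if ls is l :: ls' then
    if revise st ch l is Some r then pass ls' r.1 r.2 else None
  else Some (st, ch).

Fixpoint propagate (fuel : nat) (ls : seq cline) (st : trie (seq nat)) :=
  if fuel is n.+1 then
    if ls is [::] then Some st else
    if pass ls st [::] is Some r then
      propagate n (flatten [seq get [::] through u | u <- undup r.2]) r.1
    else None
  else Some st.

Definition branch_point (us : seq positive) (st : trie (seq nat)) : option positive :=
  if [seq u <- us | size (dget st u) == 2] is u :: _ then Some u
  else ohead [seq u <- us | 1 < size (dget st u)].

(** When the fuel is used up the current domains are returned as a candidate, so a small bound can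
    only add candidates, never lose a solution. *)
Fixpoint solve (fuel : nat) (us : seq positive) (ls : seq cline) (st : trie (seq nat)) : seq (trie (seq nat)) :=
  if fuel is n.+1 then
    if propagate 100 ls st is Some st' then
      if branch_point us st' is Some u then
        flatten [seq solve n us (get [::] through u) (PositiveMap.add u [:: x] st') | x <- dget st' u]
      else [:: st']
    else [::]
  else [:: st].
End Solver.

Definition lines_through : trie (seq (triple positive)) := Eval vm_compute in
 trie_of [seq (u, [seq l <- hj_lines | [|| l.1.1 == u, l.1.2 == u | l.2 == u]]) | u <- pts].
Definition by_lev := Eval vm_compute in flatten [seq [seq u <- pts | lev u == k] | k <- iota 0 5].
Definition tag_lines (allowed : triple positive -> seq (triple nat)) (ls : seq (triple positive)) : seq cline :=
  [seq (l, allowed l) | l <- ls].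
Definition solve_lines (allowed : triple positive -> seq (triple nat)) (st : trie (seq nat)) :=
  solve (PositiveMap.map (tag_lines allowed) lines_through) 80 by_lev (tag_lines allowed hj_lines) st.

Definition pat (a b c : nat) : bool :=
  [|| (b == a.+1) && (c == a.+1), (a == b.+1) && (c == b.+1) | (a == c.+1) && (b == c.+1)].
Definition pat_triples (v : seq nat) : seq (triple nat) :=
  [seq t <- [seq (p.1, p.2, c) | p <- [seq (a, b) | a <- v, b <- v], c <- v] | pat t.1.1 t.1.2 t.2].

Definition allowed1 : seq (triple nat) := Eval vm_compute in pat_triples [:: 1; 2; 3; 4].
(** For a point outside H collinear with 1, the triangle inequality keeps each value within 1 of
    [lev u]; the value 0 is absent because the point is outside H. *)
Definition init1 : trie (seq nat) := Eval vm_compute in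
  trie_of [seq (u, [seq x <- [:: 1; 2; 3; 4] |
     if u == 1%positive then x == 1 else (x <= (lev u).+1) && (lev u <= x.+1)]) | u <- pts].
Definition sol1 := Eval vm_compute in solve_lines (fun=> allowed1) init1.
Definition labs : seq (trie nat) := Eval vm_compute in
  lev_trie :: [seq trie_of [seq (u, head 9 (dget t u)) | u <- pts] | t <- sol1].
(* [label_dist 0] is the distance to the point 1 of HJ; [label_dist k] with
   [0 < k < 13] are the possible distance functions of a point collinear with 1. *)
Definition label_dist (k : nat) (u : positive) : nat := get 9 (nth lev_trie labs k) u.
Definition typeB (k : nat) : bool := (k == 6) || (k == 12).
Definition typeC (k : nat) : bool := [&& 0 < k, k < 13 & ~~ typeB k].
(** A point of H lies on 5 lines of H and 11 lines of N. The labels [k] and [k + 6] sit on the two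
    outer points of one of the six remaining lines; in particular the two type B labels share a
    line. *)
Definition partner (k : nat) : nat := nth 0 [:: 0; 7; 8; 9; 10; 11; 12; 1; 2; 3; 4; 5; 6] k.

Definition triples234 : seq (triple nat) := Eval vm_compute in pat_triples [:: 2; 3; 4].
(** Constraints on a point without neighbours in H that is joined to a point with values [b]. The
    third point of the joining line, with values [q], has no neighbour in H either, so both triples
    avoid the value 1. *)
Definition allowed2_at (b : triple nat) : seq (triple nat) :=
  [seq t <- triples234 | has (fun q => [&& pat b.1.1 t.1.1 q.1.1, pat b.1.2 t.1.2 q.1.2 & pat b.2 t.2 q.2]) triples234].
Definition allowed2 (k : nat) (l : triple positive) : seq (triple nat) :=
  allowed2_at (label_dist k l.1.1, label_dist k l.1.2, label_dist k l.2).
Definition init2 (k : nat) : trie (seq nat) :=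
  trie_of [seq (u, [seq x <- [:: 2; 3; 4] | has (pat (label_dist k u) x) [:: 2; 3; 4]]) | u <- pts].

(** Distances from two collinear points to any third point differ by at most 1. Here one point has
    label [k] at 1, the other label [l] at [j]. *)
Definition compat (k : nat) (j : positive) (l : nat) : bool :=
  all (fun u => let x := label_dist k (wapp (tw j) u) in let y := label_dist l u in (x <= y.+1) && (y <= x.+1)) pts.
Definition ctab (k : nat) (j : positive) : seq nat := [seq l <- iota 1 12 | compat k j l].

Definition near (k : nat) : seq (positive * seq nat) := [seq (j, ctab k j) | j <- pts & label_dist k j == 2].
Definition near_table : seq (seq (positive * seq nat)) := Eval vm_compute in
  [seq near k | k <- iota 0 13].
Definition nears (k : nat) := nth [::] near_table k.
Definition labels_at (k : nat) (j : positive) : seq nat :=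
  flatten [seq p.2 | p <- nears k & p.1 == j].
Definition others (k : nat) : seq (positive * seq nat) := [seq p <- nears k | lev p.1 == 3].
Definition nextC (k : nat) (j : positive) : nat := head 0 (labels_at k j).
Definition labC (k : nat) (j : positive) : nat := head 0 [seq l <- labels_at k j | typeC l].

Definition winv (w : seq bool) : seq bool :=
  flatten [seq if c then [:: true; true] else [:: false] | c <- rev w].
Definition third1 (j : positive) : positive := head 1%positive [seq v <- adjs 1 | v \in adjs j].
Definition third_check (k : nat) (j' : positive) (l' : nat) (j : positive) (l : nat) : bool :=
  all (fun u => let x := wapp (tw j) u in pat (label_dist k x) (label_dist l' (wapp (winv (tw j')) x)) (label_dist l u)) pts.
(** Two type B labels can be compatible at [j]. The right one belongs to the third point of the line
    from the point labelled [k] to its type C neighbour at [third1 j]. *)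
Definition labB (k : nat) (j : positive) : nat :=
  let j' := third1 j in
  head 0 [seq l <- labels_at k j | typeB l && third_check k j' (labC k j') j l].

Definition near_labels (k : nat) : seq (positive * nat) :=
  if k is 0 then [seq (j, 0) | j <- adjs 1] ++ [seq (1%positive, l) | l <- iota 1 12]
  else (1%positive, 0) :: (1%positive, partner k) ::
    (if typeB k then flatten [seq [:: (p.1, labC k p.1); (p.1, labB k p.1)] | p <- nears k]
     else flatten [seq [seq (p.1, l) | l <- p.2] | p <- nears k]).
Definition near_label_table : seq (seq (positive * nat)) := Eval vm_compute in
  [seq near_labels k | k <- iota 0 13].
Definition nbl (k : nat) := nth [::] near_label_table k.

Fixpoint path_end (k : nat) (js : seq positive) : seq bool * nat :=
  if js is j :: js' then
    let r := path_end (nextC k j) js' in (tw j ++ r.1, r.2)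
  else ([::], k).
Fixpoint path_ok (k : nat) (js : seq positive) : bool :=
  if js is j :: js' then (j \in map fst (others k)) && path_ok (nextC k j) js' else true.
(** Change of frame: label [l] read along [w] and label [l'] read along [w'] describe the same
    function on H. *)
Definition relabel_ok (w : seq bool) (l : nat) (w' : seq bool) (l' : nat) : bool :=
  all (fun u => label_dist l' (wapp (winv w') (wapp w u)) == label_dist l u) pts.

(** Certificates verified by [paths_check]. Entry [k] leads by forced steps from label 1 back to the
    same point of HJ with label [k]; [paths_to1] leads from [k] to 1, and [paths_back] from label 1
    at a neighbour of the point 1 to some type C label at 1. The entries at 0, 6 and 12 are
    fillers. *)
Definition paths_from1 : seq (seq positive) := [:: [::]; [::]; [:: 11; 41; 53; 148];
  [:: 11; 41; 178; 7]; [:: 11; 40; 252; 148]; [:: 11; 122; 292; 178]; [::];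
  [:: 11; 38; 29; 41; 29]; [:: 11; 38; 178; 7]; [:: 11; 38; 53; 148];
  [:: 11; 123; 292; 178]; [:: 11; 44; 252; 148]; [::]]%positive.
Definition paths_to1 : seq (seq positive) := [:: [::]; [::]; [:: 3; 38; 53; 148];
  [:: 7; 29; 199; 3]; [:: 8; 98; 169; 78]; [:: 10; 98; 169; 78]; [::];
  [:: 2; 29; 38; 45; 38]; [:: 9; 29; 199; 3]; [:: 4; 38; 53; 148];
  [:: 5; 39; 142; 55]; [:: 6; 39; 142; 55]; [::]]%positive.
Definition paths_back : seq (positive * seq positive) := [:: (182, [:: 13; 41; 45]);
  (203, [:: 13; 41; 45]); (214, [:: 11; 38; 45]); (233, [:: 11; 38; 45]);
  (242, [:: 13; 41; 45]); (259, [:: 13; 41; 45]); (275, [:: 13; 41; 45]);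
  (305, [:: 11; 38; 45]); (306, [:: 11; 310; 187]); (307, [:: 11; 310; 187])]%positive.

Definition labelsC : seq nat := [seq k <- iota 0 13 | typeC k].
Definition labelsB : seq nat := [:: 6; 12].
(* [u0 k] is a point at distance 3 from a point labelled [k], of type B, all of
   whose neighbours at distance 2 from [u0 k] are of type C. *)
Definition u0_ok (k : nat) (u0 : positive) : bool :=
  [&& label_dist k u0 == 3, lev u0 == 4, label_dist (partner k) u0 != 2
    & all (fun p => let v := wapp (winv (tw p.1)) u0 in
             all (fun l => (label_dist l v != 2) || typeC l) p.2) (nears k)].
Definition u0 (k : nat) : positive := head 1%positive [seq u <- pts | u0_ok k u].

(** * Soundness of the constraint solver *)

Lemma get_add (A : Type) (x0 : A) t u x v :
  get x0 (PositiveMap.add u x t) v = if v == u then x else get x0 t v.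
Proof.
rewrite /get; case: eqP => [->|/eqP neq]; first by rewrite PositiveMap.gss.
by rewrite PositiveMap.gso //; apply/eqP.
Qed.

Lemma get_map (A B : Type) (f : A -> B) x0 y0 (t : trie A) u :
  f x0 = y0 -> get y0 (PositiveMap.map f t) u = f (get x0 t u).
Proof. by move=> fx0; rewrite /get /PositiveMap.map PositiveMap.gmapi; case: PositiveMap.find => //=. Qed.

Lemma get_trie_of (A : Type) (x0 : A) (f : positive -> A) (s : seq positive) u :
  u \in s -> get x0 (trie_of [seq (v, f v) | v <- s]) u = f u.
Proof.
elim: s => //= v s IHs; rewrite inE get_add; case: eqP => [-> //|_ /=].
exact: IHs.
Qed.

Lemma get_all (A : Type) (x0 : A) (P : pred A) t :
  P x0 -> all (fun p => P p.2) (PositiveMap.elements t) -> forall u, P (get x0 t u).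
Proof.
move=> Px0 Pt u; rewrite /get; case Dx: PositiveMap.find => [x|//].
have := PositiveMap.elements_correct _ _ Dx; elim: (PositiveMap.elements t) Pt => //= p s IHs.
by case/andP=> Pp /IHs Ps; case=> [Dp|/Ps] //; move: Pp; rewrite Dp.
Qed.

Section SolverSound.
Variables (through : trie (seq cline)) (f : positive -> nat).

Definition sat_line (l : cline) : bool :=
  [&& l.1.1.1 \in pts, l.1.1.2 \in pts, l.1.2 \in pts
    & (f l.1.1.1, f l.1.1.2, f l.1.2) \in l.2].
Definition dom_ok (st : trie (seq nat)) : Prop := forall u, u \in pts -> f u \in dget st u.

Hypothesis through_sat : forall u, all sat_line (get [::] through u).

Lemma dget_add st u d v : dget (PositiveMap.add u d st) v = if v == u then d else dget st v.
Proof. exact: get_add. Qed.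

Lemma revise1_inv st u d ch : dom_ok st -> f u \in d -> dom_ok (revise1 st u d ch).1.
Proof.
rewrite /revise1 => st_f fu; case: ifP => //= _ v v_pts.
by rewrite dget_add; case: eqP => [->|_] //; apply: st_f.
Qed.

Lemma revise_inv st ch l : dom_ok st -> sat_line l ->
  exists2 r, revise st ch l = Some r & dom_ok r.1.
Proof.
case: l => [[[i j] k] ts] st_f /and4P[/= i_pts j_pts k_pts sat]; rewrite /revise /=.
set al := [seq t <- ts | _].
have al_f: (f i, f j, f k) \in al by rewrite mem_filter /= !st_f.
rewrite ifF; last by case: al al_f.
eexists; first reflexivity; rewrite /=.
have fi: f i \in map (fun t => t.1.1) al by apply/mapP; exists (f i, f j, f k).
have fj: f j \in map (fun t => t.1.2) al by apply/mapP; exists (f i, f j, f k).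
have fk: f k \in map (fun t => t.2) al by apply/mapP; exists (f i, f j, f k).
set d1 := [seq x <- dget st i | _].
have inv1: dom_ok (revise1 st i d1 ch).1 by apply: revise1_inv => //; rewrite mem_filter fi st_f.
set d2 := [seq x <- _ | _].
have inv2: dom_ok (revise1 (revise1 st i d1 ch).1 j d2 (revise1 st i d1 ch).2).1.
  by apply: revise1_inv => //; rewrite mem_filter fj inv1.
by apply: revise1_inv => //; rewrite mem_filter fk inv2.
Qed.

Lemma pass_inv ls st ch : dom_ok st -> all sat_line ls ->
  exists2 r, pass ls st ch = Some r & dom_ok r.1.
Proof.
elim: ls st ch => [|l ls IHls] st ch st_f /=; first by exists (st, ch).
case/andP=> sat_l sat_ls; have [r -> r_f] := revise_inv ch st_f sat_l.
exact: IHls.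
Qed.

Lemma propagate_inv n ls st : dom_ok st -> all sat_line ls ->
  exists2 st', propagate through n ls st = Some st' & dom_ok st'.
Proof.
elim: n ls st => [|n IHn] ls st st_f sat_ls /=; first by exists st.
case: ls sat_ls => [|l ls] sat_ls; first by exists st.
have [r -> r_f] := pass_inv [::] st_f sat_ls; apply: IHn => //.
by apply/allP=> l' /flatten_mapP[u _]; apply/allP.
Qed.

Arguments propagate : simpl never.

(** Pruning removes only values that [f] does not take, and at a branching the branch of the value
    [f u] is followed. *)
Lemma solve_inv n us ls st : dom_ok st -> all sat_line ls ->
  exists2 st', List.In st' (solve through n us ls st) & dom_ok st'.
Proof.
elim: n ls st => [|n IHn] ls st st_f sat_ls /=; first by exists st; [left|].
have [st' -> st'_f] := propagate_inv 100 st_f sat_ls.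
case Du: branch_point => [u|]; last by exists st'; [left|].
(* A branch point outside [pts] carries no condition, so its first value will do; the domain is
   nonempty by the choice of a branch point. *)
case: (boolP (u \in pts)) => [u_pts|u_npts]; last first.
  have: dget st' u != [::].
    move: Du; rewrite /branch_point; case Ds: [seq _ <- us | _] => [|v s].
      case Ds2: [seq _ <- us | _] => [|v s] //= [<-].
      have: v \in v :: s by rewrite mem_head.
      by rewrite -Ds2 mem_filter; case: dget.
    case=> <-; have: v \in v :: s by rewrite mem_head.
    by rewrite -Ds mem_filter; case: dget.
  case Dd: dget => [//|x d] _ /=.
  have [|st2 st2_in st2_f] := IHn (get [::] through u) (PositiveMap.add u [:: x] st') _ (through_sat u).
    by move=> v v_pts; rewrite dget_add; case: eqP v_pts u_npts => [->->|_ ? _] //; apply: st'_f.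
  by exists st2 => //; apply/List.in_app_iff; left.
have [|st2 st2_in st2_f] := IHn (get [::] through u) (PositiveMap.add u [:: f u] st') _ (through_sat u).
  by move=> v v_pts; rewrite dget_add; case: eqP => [->|_]; rewrite ?mem_head ?st'_f.
exists st2 => //; have := st'_f u u_pts; elim: (dget st' u) => //= x d IHd.
rewrite inE => /predU1P[<-|/IHd]; first by apply/List.in_app_iff; left.
by move=> ?; apply/List.in_app_iff; right.
Qed.
End SolverSound.

Lemma mem_pts u : (u \in pts) = in_pts u.
Proof.
rewrite (_ : pts = pos_seq 315); last by vm_cast_no_check (erefl pts).
apply/mapP/idP => [[i] |].
  by rewrite mem_iota /in_pts => /= i_lt ->; apply/Pos.leb_spec0; lia.
move/Pos.leb_spec0 => u_le; exists (Pos.to_nat u).-1; last by lia.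
by rewrite mem_iota; lia.
Qed.

Lemma hj_lines_hline : all hline hj_lines.
Proof. by vm_cast_no_check (erefl true). Qed.

Lemma lines_through_hline u : all hline (get [::] lines_through u).
Proof.
have all_lines: all (fun p => all hline p.2) (PositiveMap.elements lines_through).
  by vm_cast_no_check (erefl true).
exact: (get_all (isT : all hline [::]) all_lines).
Qed.

Lemma solve_linesP (allowed : triple positive -> seq (triple nat)) st (f : positive -> nat) :
    dom_ok f st ->
    (forall l, hline l -> (f l.1.1, f l.1.2, f l.2) \in allowed l) ->
  exists2 st', List.In st' (solve_lines allowed st) & dom_ok f st'.
Proof.
move=> st_f sat; have sat_tag ls : all hline ls -> all (sat_line f) (tag_lines allowed ls).
  move=> hls; apply/allP=> _ /mapP[l l_ls ->]; have hl := allP hls l l_ls.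
  by rewrite /sat_line /= sat // !mem_pts; case/and4P: hl => -> -> ->.
apply: solve_inv => //; last exact: (sat_tag _ hj_lines_hline).
move=> u; rewrite (@get_map _ _ _ [::]) //; apply: sat_tag; exact: lines_through_hline.
Qed.

(** * Finite verifications on the tables of labels *)

Definition labs12 : seq nat := iota 1 12.
Definition labs13 : seq nat := iota 0 13.

Lemma gen_pts_check : all (fun u => [&& in_pts (gen false u), in_pts (gen true u),
  gen false (gen false u) == u & gen true (gen true (gen true u)) == u]) pts.
Proof. by vm_cast_no_check (erefl true). Qed.

Lemma tw1_check : all (fun u => wapp (tw u) 1 == u) pts.
Proof. by vm_cast_no_check (erefl true). Qed.

Lemma c_check : all (fun u => (label_dist 0 u == 0) == (u == 1%positive)) pts &&
  all (fun k => all (fun u => if u == 1%positive then label_dist k u == 1 else 1 < label_dist k u <= 4) pts) labs12.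
Proof. by vm_cast_no_check (erefl true). Qed.

Lemma sol1_check : all (fun st => has (fun k => all (fun u => dget st u == [:: label_dist k u]) pts) labs12)
  (solve_lines (fun=> allowed1) init1).
Proof. by vm_cast_no_check (erefl true). Qed.

Lemma sol2_check : all (fun k => nilp (solve_lines (allowed2 k) (init2 k))) labelsB.
Proof. by vm_cast_no_check (erefl true). Qed.

Lemma c_inj_check : all (fun k => all (fun k' => (k == k') || has (fun u => label_dist k u != label_dist k' u) pts) labs13) labs13.
Proof. by vm_cast_no_check (erefl true). Qed.

Lemma partner_check : all (fun k => [&& partner k \in labs12, partner k != k, typeC (partner k) == typeC k
  & all (fun u => pat (lev u) (label_dist k u) (label_dist (partner k) u)) pts]) labs12.
Proof. by vm_cast_no_check (erefl true). Qed.

Lemma near_check : all (fun k => near k == nears k) labs12.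
Proof. by vm_cast_no_check (erefl true). Qed.

Lemma labels_at_check : all (fun k => all (fun p => labels_at k p.1 == p.2) (nears k)) labs12.
Proof. by vm_cast_no_check (erefl true). Qed.

Lemma others_check : all (fun k => all (fun p => (p.2 == [:: nextC k p.1]) && typeC (nextC k p.1)) (others k)) labelsC.
Proof. by vm_cast_no_check (erefl true). Qed.

(** The point of HJ found here is at distance 3 from 1 and at distance 2 from both ends of the step:
    the configuration that [no_square] forbids. *)
Lemma double_check : all (fun k => all (fun p => let l := nextC k p.1 in
  has (fun u => let x := wapp (tw p.1) u in [&& lev x == 3, label_dist k x == 2 & label_dist l u == 2]) pts) (others k)) labelsC.
Proof. by vm_cast_no_check (erefl true). Qed.

Lemma paths_check :
  [&& all (fun k => let js := nth [::] paths_from1 k in let r := path_end 1 js in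
             path_ok 1 js && relabel_ok r.1 r.2 [::] k) labelsC,
      all (fun k => let js := nth [::] paths_to1 k in let r := path_end k js in
             path_ok k js && relabel_ok r.1 r.2 [::] 1) labelsC
    & all (fun j => has (fun p => let r := path_end 1 p.2 in
             [&& p.1 == j, path_ok 1 p.2 & has (relabel_ok (tw j ++ r.1) r.2 [::]) labelsC])
             paths_back) (adjs 1)].
Proof. by vm_cast_no_check (erefl true). Qed.

Lemma u0_check : all (fun k => (u0 k \in pts) && u0_ok k (u0 k)) labelsB.
Proof. by vm_cast_no_check (erefl true). Qed.

(** Distances 2 and 2 on a line put its third point at distance 1, so a line with these two labels
    has no third point far from H. *)
Lemma far_check : all (fun k => all (fun p => all (fun l =>
  has (fun u => (label_dist k (wapp (tw p.1) u) == 2) && (label_dist l u == 2)) pts) p.2) (nears k)) labelsB.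
Proof. by vm_cast_no_check (erefl true). Qed.

(** The points at distance 2 from a type B point are the ten neighbours of 1, and at each of them at
    most three labels are compatible: one of type C and a partner pair of type B. *)
Lemma nearB_check : all (fun k => [&& map fst (nears k) == adjs 1 &
  all (fun p => let j := p.1 in let g := labC k j in let b := labB k j in
    [&& all (fun l => l \in [:: g; b; partner b]) p.2, typeC g, typeB b, g \in labs12, b \in labs12,
     typeB (partner b), third1 j \in adjs 1, wapp (tw j) (wapp (winv (tw j)) 1) == 1%positive,
     adjs 1 != [::]
     & third_check k (third1 j) (labC k (third1 j)) j b]) (nears k)]) labelsB.
Proof. by vm_cast_no_check (erefl true). Qed.

(* For [j] adjacent to [1] and in a common quad with a point labelled [k]. *)
Definition quad_check (k : nat) (j : positive) (s : seq nat) : bool :=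
  let i := wapp (winv (tw j)) 1 in
  let j' := third1 j in let i' := wapp (winv (tw j')) j in
  if s is [::] then true else
  [&& size s == 2, labC k j \in s, typeC (labC k j),
   has (fun b => [&& b \in s, typeB b, i \in adjs 1 & relabel_ok (tw j ++ tw i) (labC b i) [::] k]) labelsB,
   partner (labC k j) \notin s &
   has (fun b => [&& (j', b) \in nbl k, typeB b, b \in labels_at k j', i' \in adjs 1 &
       relabel_ok (tw j' ++ tw i') (labC b i') (tw j) (partner (labC k j))]) labelsB].
Lemma nearC_check : all (fun k => all (fun p => (lev p.1 == 3) ||
   (lev p.1 == 1) && quad_check k p.1 p.2) (nears k)) labelsC.
Proof. by vm_cast_no_check (erefl true). Qed.

Lemma nbl_check : all (fun k => [&& nbl k == near_labels k, uniq (nbl k), size (nbl k) == 22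
    & all (fun p => (p.1 \in pts) && (p.2 \in labs13)) (nbl k)]) labs13.
Proof. by vm_cast_no_check (erefl true). Qed.

Lemma adj1_check : [&& all (fun u => (lev u == 1) == (u \in adjs 1)) pts, size (adjs 1) == 10, uniq (adjs 1)
  & all in_pts (adjs 1)].
Proof. by vm_cast_no_check (erefl true). Qed.

(** * Near octagons containing the Hall-Janko near octagon *)

Lemma pat_inj a b x y : pat a b x -> pat a b y -> x = y.
Proof. rewrite /pat; lia. Qed.

Lemma wapp_cat w1 w2 u : wapp (w1 ++ w2) u = wapp w1 (wapp w2 u).
Proof. by elim: w1 => //= b w1 ->. Qed.

Lemma wapp_pts w u : u \in pts -> wapp w u \in pts.
Proof.
move=> u_pts; elim: w => //= b w IHw; rewrite mem_pts.
by have /and4P[] := allP gen_pts_check _ IHw; case: b.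
Qed.

Lemma wappK w u : u \in pts -> wapp w (wapp (winv w) u) = u.
Proof.
elim: w u => //= b w IHw u u_pts.
rewrite /winv rev_cons map_rcons flatten_rcons wapp_cat -/(winv w).
have /and4P[_ _ /eqP aK /eqP bK] := allP gen_pts_check _ u_pts.
case: b => /=.
  rewrite IHw //; last by do 2 apply: (wapp_pts [:: true]).
by rewrite IHw //; apply: (wapp_pts [:: false]).
Qed.

Lemma winvK w u : u \in pts -> wapp (winv w) (wapp w u) = u.
Proof.
elim: w u => //= b w IHw u u_pts.
rewrite /winv rev_cons map_rcons flatten_rcons wapp_cat -/(winv w).
have /and4P[_ _ /eqP aK /eqP bK] := allP gen_pts_check _ (wapp_pts w u_pts).
by case: b => /=; rewrite ?aK ?bK IHw.
Qed.

Lemma tw1 u : u \in pts -> wapp (tw u) 1 = u.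
Proof. by move=> u_pts; apply/eqP/(allP tw1_check). Qed.

Lemma pts1 : 1%positive \in pts. Proof. by rewrite mem_pts. Qed.

Lemma adj1P u : u \in pts -> (lev u == 1) = (u \in adjs 1).
Proof. by move=> u_pts; have /and4P[/allP/(_ _ u_pts)/eqP] := adj1_check. Qed.

Lemma adj1_pts u : u \in adjs 1 -> u \in pts.
Proof. by rewrite mem_pts; have /and4P[_ _ _ /allP] := adj1_check; apply. Qed.

Lemma all_In (T : Type) (p : pred T) s x : all p s -> List.In x s -> p x.
Proof. by elim: s => //= y s IHs /andP[py /IHs ps] [<-|/ps]. Qed.

Lemma init1E : init1 = trie_of [seq (u, [seq x <- [:: 1; 2; 3; 4] |
     if u == 1%positive then x == 1 else (x <= (lev u).+1) && (lev u <= x.+1)]) | u <- pts].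
Proof. by vm_cast_no_check (erefl init1). Qed.

Lemma solve1P f : dom_ok f init1 ->
    (forall l, hline l -> (f l.1.1, f l.1.2, f l.2) \in allowed1) ->
  exists2 k, k \in labs12 & forall u, u \in pts -> f u = label_dist k u.
Proof.
move=> f_ok f_lines.
have [st st_sol st_f] := solve_linesP (allowed := fun=> allowed1) f_ok f_lines.
have := all_In sol1_check st_sol; clear st_sol; case/hasP=> k k12 /allP k_ok.
exists k; first exact: k12.
move=> u u_pts; have := k_ok u u_pts; have := st_f u u_pts.
by move=> fu /eqP Dk; move: fu; rewrite Dk inE => /eqP.
Qed.

Lemma solve2P k f : k \in labelsB -> dom_ok f (init2 k) ->
    (forall l, hline l -> (f l.1.1, f l.1.2, f l.2) \in allowed2 k l) -> False.
Proof.
move=> kB f_ok f_lines; have [st] := solve_linesP f_ok f_lines.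
have := allP sol2_check k kB; move: (solve_lines _ _) => s; clear.
by case: s.
Qed.

Section NearOctagon.

Variables (P : eqType) (d : P -> P -> nat) (third : P -> P -> P) (nb : P -> seq P).
Hypothesis d_eq0 : forall x y, (d x y == 0) = (x == y).
Hypothesis dC : forall x y, d x y = d y x.
Hypothesis d_tri : forall x y z, d x z <= d x y + d y z.
Hypothesis d_le4 : forall x y, d x y <= 4.
Hypothesis d_geo : forall x y n, d x y = n.+1 -> exists2 z, d x z = 1 & d z y = n.
Hypothesis thirdP : forall a b, d a b = 1 -> forall x, pat (d x a) (d x b) (d x (third a b)).
Hypothesis mem_nb : forall x y, (y \in nb x) = (d x y == 1).
Hypothesis nb_uniq : forall x, uniq (nb x).
Hypothesis nb_size : forall x, size (nb x) = 22.
Variable e : positive -> P.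
(** Isometry of the embedding, phrased with words: every pair of points of HJ has the form
    [wapp w 1], [wapp w u], at distance [lev u], so no group acting on N is needed to move the base
    point. *)
Hypothesis e_lev : forall w u, u \in pts -> d (e (wapp w 1)) (e (wapp w u)) = lev u.
Hypothesis e_adj : forall w i j, i \in pts -> j \in adjs i -> d (e (wapp w i)) (e (wapp w j)) = 1.

Lemma dxx x : d x x = 0.
Proof. by apply/eqP; rewrite d_eq0. Qed.

Lemma third_col a b : d a b = 1 -> d a (third a b) = 1 /\ d b (third a b) = 1.
Proof.
move=> ab; have := thirdP ab a; have := thirdP ab b.
by rewrite !dxx ab [d b a]dC ab /pat; lia.
Qed.

Lemma third_uniq a b z : d a b = 1 -> d a z = 1 -> d b z = 1 -> z = third a b.
Proof.
move=> ab az bz; have := thirdP ab z; rewrite [d z a]dC [d z b]dC az bz /pat => dz.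
by apply/eqP; rewrite -d_eq0; lia.
Qed.

Lemma pat_col a b z : d a b = 1 -> d a z = 1 -> d b z = 1 -> forall x, pat (d x a) (d x b) (d x z).
Proof. by move=> ab az bz x; rewrite (third_uniq ab az bz); apply: thirdP. Qed.

Lemma hline_pat w l x : hline l -> pat (d x (e (wapp w l.1.1))) (d x (e (wapp w l.1.2))) (d x (e (wapp w l.2))).
Proof.
by case/and5P; rewrite -!mem_pts => i_pts j_pts k_pts ij /andP[ik jk]; apply: pat_col; apply: e_adj.
Qed.

(* The word [w] moves the reference point 1 of HJ: [lab w k y] says that [y] has the
   label [k] at the point [wapp w 1]. *)
Definition lab w k y := forall u, u \in pts -> d y (e (wapp w u)) = label_dist k u.
Definition inH y := exists2 u, u \in pts & y = e u.

Lemma inH_wapp w y : inH y -> exists2 u, u \in pts & y = e (wapp w u).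
Proof.
by case=> u u_pts ->; exists (wapp (winv w) u); rewrite ?wapp_pts // wappK.
Qed.

Lemma lab0 w : lab w 0 (e (wapp w 1)).
Proof. by move=> u u_pts; rewrite e_lev. Qed.

Lemma c0_eq0 u : u \in pts -> (label_dist 0 u == 0) = (u == 1%positive).
Proof. by move=> u_pts; have /andP[/allP/(_ _ u_pts)/eqP] := c_check. Qed.

Lemma c_val k u : k \in labs12 -> u \in pts ->
  if u == 1%positive then label_dist k u = 1 else 1 < label_dist k u <= 4.
Proof.
move=> k12 u_pts; have /andP[_ /allP/(_ _ k12)/allP/(_ _ u_pts)] := c_check.
by case: ifP => // _ /eqP.
Qed.

Lemma lab0_eq w y : lab w 0 y -> y = e (wapp w 1).
Proof. by move/(_ _ pts1)/eqP; rewrite (eqP (_ : label_dist 0 1 == 0)) ?c0_eq0 ?pts1 // d_eq0 => /eqP. Qed.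

Lemma lab_inj w k k' y : k \in labs13 -> k' \in labs13 -> lab w k y -> lab w k' y -> k = k'.
Proof.
move=> k13 k'13 yk yk'; have /allP/(_ _ k13)/allP/(_ _ k'13)/orP[/eqP //|] := c_inj_check.
by case/hasP=> u u_pts; rewrite -yk // -yk' // eqxx.
Qed.

Lemma labs12_13 k : k \in labs12 -> k \in labs13.
Proof. by rewrite !mem_iota; lia. Qed.

Lemma lab_outer w k y u : k \in labs12 -> lab w k y -> u \in pts -> d y (e (wapp w u)) = 1 -> u = 1%positive.
Proof.
move=> k12 yk u_pts; rewrite yk //; have := c_val k12 u_pts; case: eqP => // _; lia.
Qed.

Lemma lab_notinH w k y : k \in labs12 -> lab w k y -> ~ inH y.
Proof.
move=> k12 yk /(inH_wapp w)[u u_pts Dy]; have := yk u u_pts; rewrite -Dy dxx.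
by have := c_val k12 u_pts; case: ifP => _; lia.
Qed.

Lemma lab_d1 w k y : k \in labs12 -> lab w k y -> d y (e (wapp w 1)) = 1.
Proof. by move=> k12 /(_ _ pts1)->; have := c_val k12 pts1. Qed.

(** An outer point is collinear with only one point of H, its values elsewhere being at least 2, and
    a point of H has only the label 0. This fixes [j], and [c_inj_check] then fixes the label. *)
Lemma labs_inj w j j' l l' y : j \in pts -> j' \in pts -> l \in labs13 -> l' \in labs13 ->
  lab (w ++ tw j) l y -> lab (w ++ tw j') l' y -> (j, l) = (j', l').
Proof.
move=> j_pts j'_pts l13 l'13 yl yl'.
suffices Djj: j = j' by rewrite Djj in yl *; rewrite (lab_inj l13 l'13 yl yl').
have l12 i : i \in labs13 -> i != 0 -> i \in labs12 by rewrite !mem_iota; lia.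
have frame i i' m : i \in pts -> i' \in pts -> m \in labs12 -> lab (w ++ tw i) m y ->
    d y (e (wapp w i')) = 1 -> i = i'.
  move=> i_pts i'_pts m12 ym dyi'; have := lab_outer m12 ym (wapp_pts (winv (tw i)) i'_pts).
  rewrite wapp_cat wappK // => /(_ dyi') Di'.
  by rewrite -(tw1 i_pts) -Di' wappK.
have [l0|/(l12 _ l13) l_12] := eqVneq l 0; have [l'0|/(l12 _ l'13) l'_12] := eqVneq l' 0.
- move: yl yl'; rewrite l0 l'0 => /lab0_eq Dy /lab0_eq Dy'.
  have := e_lev (w ++ tw j) (wapp_pts (winv (tw j)) j'_pts).
  rewrite !wapp_cat wappK // tw1 // -{1}(tw1 j_pts) -wapp_cat -Dy Dy' wapp_cat tw1 // dxx => /esym/eqP.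
  rewrite -[lev _]/(label_dist 0 _) c0_eq0 ?wapp_pts // => /eqP Dj'.
  by rewrite -(tw1 j_pts) -Dj' wappK.
- case: (lab_notinH l'_12 yl'); move: yl; rewrite l0 => /lab0_eq->.
  by exists (wapp (w ++ tw j) 1) => //; apply: wapp_pts pts1.
- case: (lab_notinH l_12 yl); move: yl'; rewrite l'0 => /lab0_eq->.
  by exists (wapp (w ++ tw j') 1) => //; apply: wapp_pts pts1.
apply: (frame _ _ l) => //; rewrite -(tw1 j'_pts) -wapp_cat; exact: lab_d1 yl'.
Qed.

Lemma relabel w w1 w2 l l' y : relabel_ok w1 l w2 l' -> lab (w ++ w1) l y -> lab (w ++ w2) l' y.
Proof.
move=> /allP ok yl u u_pts; have u'_pts := wapp_pts (winv w1) (wapp_pts w2 u_pts).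
have := yl _ u'_pts; rewrite !wapp_cat wappK ?wapp_pts // => ->.
by have /eqP <- := ok _ u'_pts; rewrite wappK ?wapp_pts // winvK.
Qed.

(** The distances from [y] to H solve the first constraint system, whose solutions are the twelve
    labels. *)
Lemma lab_exists w y : ~ inH y -> d y (e (wapp w 1)) = 1 -> exists2 k, k \in labs12 & lab w k y.
Proof.
move=> yH dy1; pose f u := d y (e (wapp w u)).
have f_gt0 u : u \in pts -> 0 < f u.
  move=> u_pts; rewrite lt0n d_eq0; apply/eqP=> Dy; apply: yH; exists (wapp w u) => //.
  exact: wapp_pts.
apply: (@solve1P f).
  move=> u u_pts; rewrite /dget init1E (get_trie_of _ (fun u => [seq x <- [:: 1; 2; 3; 4] |
     if u == 1%positive then x == 1 else (x <= (lev u).+1) && (lev u <= x.+1)])) //.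
  have f14: f u \in [:: 1; 2; 3; 4].
    have := f_gt0 u u_pts; have := d_le4 y (e (wapp w u)); rewrite -/(f u) !inE; lia.
  rewrite mem_filter f14 andbT; case: eqP => [->|_]; first exact/eqP.
  rewrite -(e_lev w u_pts) /f; apply/andP; split.
    by rewrite (leq_trans (d_tri _ (e (wapp w 1)) _)) // dy1.
  by rewrite (leq_trans (d_tri _ y _)) // dC dy1.
move=> l hl; have := hline_pat w y hl.
case/and5P: hl; rewrite -!mem_pts => i_pts j_pts k_pts _ _.
have := d_le4 y (e (wapp w l.1.1)); have := d_le4 y (e (wapp w l.1.2)).
have := d_le4 y (e (wapp w l.2)).
rewrite -!/(f _); have := f_gt0 _ i_pts; have := f_gt0 _ j_pts; have := f_gt0 _ k_pts.
move: (f _) (f _) (f _) => p q r; rewrite /pat.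
by case: r => [|[|[|[|[|//]]]]] //; case: q => [|[|[|[|[|//]]]]] //; case: p => [|[|[|[|[|//]]]]].
Qed.

Lemma partnerP k : k \in labs12 -> [/\ partner k \in labs12, partner k != k & typeC (partner k) = typeC k].
Proof. by move=> k12; have /and4P[? ? /eqP ? _] := allP partner_check _ k12; split. Qed.

Lemma lab_partner w k y : k \in labs12 -> lab w k y -> lab w (partner k) (third (e (wapp w 1)) y).
Proof.
move=> k12 yk u u_pts; have /and4P[_ _ _ /allP/(_ _ u_pts)] := allP partner_check _ k12.
have d1y : d (e (wapp w 1)) y = 1 by rewrite dC (lab_d1 k12 yk).
apply: pat_inj; have := thirdP d1y (e (wapp w u)).
by rewrite [d _ (e (wapp w 1))]dC e_lev // [d _ y]dC yk // [d _ (third _ _)]dC.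
Qed.

(** * Neighbours of a labelled point: forced labels and far points *)

Definition far w y := forall u, u \in pts -> 1 < d y (e (wapp w u)).

Lemma far_dec w y : ~ inH y -> far w y \/ exists2 u, u \in pts & d y (e (wapp w u)) = 1.
Proof.
move=> yH; have [/hasP[u u_pts /eqP d1]|] := boolP (has (fun u => d y (e (wapp w u)) == 1) pts).
  by right; exists u.
move/hasPn=> no1; left=> u u_pts; have := no1 u u_pts.
suffices: d y (e (wapp w u)) != 0 by lia.
rewrite d_eq0; apply/eqP=> Dy; apply: yH; exists (wapp w u) => //; exact: wapp_pts.
Qed.

Lemma nearsE k : k \in labs12 -> nears k = near k.
Proof. by move=> k12; apply/esym/eqP; apply: (allP near_check). Qed.

Lemma mem_nears k j s : k \in labs12 ->
  ((j, s) \in nears k) -> [/\ j \in pts, label_dist k j = 2, s = ctab k j & s = labels_at k j].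
Proof.
move=> k12 js; have /eqP /= Ds := allP (allP labels_at_check k k12) _ js.
move: js; rewrite nearsE // /near => /mapP[i]; rewrite mem_filter => /andP[/eqP cki i_pts] [Dj Ds'].
by rewrite Dj in Ds *; split.
Qed.

Lemma nears_intro k j : k \in labs12 -> j \in pts -> label_dist k j = 2 -> (j, labels_at k j) \in nears k.
Proof.
move=> k12 j_pts ckj; have js: (j, ctab k j) \in nears k.
  by rewrite nearsE //; apply/mapP; exists j; rewrite ?mem_filter ?ckj.
by have [_ _ _ <-] := mem_nears k12 js.
Qed.

(** A neighbour in H can only be the base point, by [lab_outer]. A neighbour outside H that is
    collinear with another point [j] of H puts [j] at distance 2 from [y], and its label there is
    compatible with [k]. *)
Lemma nb_cases w k y y' : k \in labs12 -> lab w k y -> d y y' = 1 ->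
  [\/ y' = e (wapp w 1), lab w (partner k) y' /\ y' = third (e (wapp w 1)) y,
      exists j l, [/\ (j, labels_at k j) \in nears k, l \in labels_at k j & lab (w ++ tw j) l y']
    | ~ inH y' /\ far w y'].
Proof.
move=> k12 yk yy'; have dy1 := lab_d1 k12 yk.
have [y'H|y'H] := pselect (inH y').
  have [u u_pts Dy'] := inH_wapp w y'H; constructor 1.
  by rewrite Dy' (lab_outer k12 yk u_pts) // -Dy'.
have [y'far|[j j_pts dy'j]] := far_dec w y'H; first by constructor 4.
have [Dj|/eqP j1] := eqVneq j 1%positive.
  have Dy' : y' = third (e (wapp w 1)) y.
    by apply: third_uniq; rewrite // dC // -Dj.
  by constructor 2; split=> //; rewrite Dy'; apply: lab_partner.
have ckj : label_dist k j = 2.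
  have := c_val k12 j_pts; rewrite -yk //; case: eqP => // _.
  by have := d_tri y y' (e (wapp w j)); rewrite yy' dy'j; lia.
have dy'j1 : d y' (e (wapp (w ++ tw j) 1)) = 1 by rewrite wapp_cat tw1.
have [l l12 y'l] := lab_exists y'H dy'j1.
constructor 3; exists j, l; split=> //; first exact: nears_intro.
have [_ _ -> _] := mem_nears k12 (nears_intro k12 j_pts ckj).
rewrite /ctab mem_filter l12 andbT; apply/allP=> u u_pts /=.
rewrite -(y'l u u_pts) wapp_cat -(yk _ (wapp_pts (tw j) u_pts)).
have := d_tri y y' (e (wapp w (wapp (tw j) u))).
have := d_tri y' y (e (wapp w (wapp (tw j) u))).
by rewrite [d y' y]dC yy'; lia.
Qed.

Lemma labelsB_12 k : k \in labelsB -> k \in labs12.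
Proof. by rewrite !inE => /orP[]/eqP->. Qed.

Lemma labelsC_12 k : k \in labelsC -> k \in labs12.
Proof. by rewrite mem_filter !mem_iota /typeC; lia. Qed.

Lemma typeC_labels k : k \in labs12 -> typeC k = (k \in labelsC).
Proof. by move=> k12; rewrite mem_filter [in RHS]mem_iota; move: k12; rewrite mem_iota; case: typeC => //=; lia. Qed.

Lemma labs12_BC k : k \in labs12 -> k \in labelsB \/ k \in labelsC.
Proof.
move=> k12; rewrite -typeC_labels // /typeC /typeB !inE; move: k12; rewrite mem_iota.
by case: (_ || _); [left | right; lia].
Qed.

(** The third point [z] of the line has no neighbour in H either: the base point and the partner
    contradict the pattern at the base point, an anchored point contradicts [far_check]. Then [y']
    and [z] together satisfy the second constraint system, which has no solution. *)
Lemma no_far w k y y' : k \in labelsB -> lab w k y -> d y y' = 1 -> ~ inH y' -> ~ far w y'.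
Proof.
move=> kB yk yy' y'H y'far; have k12 := labelsB_12 kB.
pose z := third y y'; have [yz y'z] := third_col yy'.
have pat_z x := thirdP yy' x.
have zfar: far w z.
  have [Dz|[zp _]|[j [l [js lj zl]]]|[]] // := nb_cases k12 yk yz.
  - by have := y'far _ pts1; rewrite -Dz y'z.
  - have [p12 _ _] := partnerP k12.
    have := pat_z (e (wapp w 1)); have := y'far _ pts1.
    rewrite ![d (e _) _]dC (lab_d1 k12 yk) (lab_d1 p12 zp) /pat; lia.
  have /hasP[u u_pts /andP[/eqP cku /eqP clu]] := allP (allP (allP far_check k kB) _ js) l lj.
  have := pat_z (e (wapp (w ++ tw j) u)).
  rewrite ![d (e _) _]dC (zl u u_pts) clu wapp_cat (yk _ (wapp_pts _ u_pts)) cku.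
  by have := y'far _ (wapp_pts (tw j) u_pts); rewrite /pat; lia.
have val x u : ~~ (1 < d x (e (wapp w u))) || (d x (e (wapp w u)) \in [:: 2; 3; 4]).
  by have := d_le4 x (e (wapp w u)); rewrite !inE; lia.
have y'val u (u_pts : u \in pts) : d y' (e (wapp w u)) \in [:: 2; 3; 4].
  by have := val y' u; rewrite y'far.
have zval u (u_pts : u \in pts) : d z (e (wapp w u)) \in [:: 2; 3; 4].
  by have := val z u; rewrite zfar.
have pat_u u (u_pts : u \in pts) : pat (label_dist k u) (d y' (e (wapp w u))) (d z (e (wapp w u))).
  by have := pat_z (e (wapp w u)); rewrite ![d (e _) _]dC yk.
apply: (@solve2P k (fun u => d y' (e (wapp w u))) kB).
  move=> u u_pts; rewrite /dget /init2 (get_trie_of _ (fun u => [seq x <- [:: 2; 3; 4] | has (pat (label_dist k u) x) [:: 2; 3; 4]])) //.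
  rewrite mem_filter y'val // andbT; apply/hasP; exists (d z (e (wapp w u))); first exact: zval.
  exact: pat_u.
move=> l hl; have hy' := hline_pat w y' hl; have hz := hline_pat w z hl.
case/and5P: hl; rewrite -!mem_pts => i_pts j_pts k_pts _ _.
have mem234 p q r : p \in [:: 2; 3; 4] -> q \in [:: 2; 3; 4] -> r \in [:: 2; 3; 4] ->
    pat p q r -> (p, q, r) \in triples234.
  by rewrite !inE => /or3P[]/eqP-> /or3P[]/eqP-> /or3P[]/eqP->.
rewrite /allowed2 /allowed2_at mem_filter mem234 ?y'val // andbT.
apply/hasP; exists (d z (e (wapp w l.1.1)), d z (e (wapp w l.1.2)), d z (e (wapp w l.2))).
  by rewrite mem234 ?zval.
by rewrite /= !pat_u.
Qed.

Lemma othersP k j : k \in labelsC -> j \in map fst (others k) ->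
  [/\ (j, labels_at k j) \in nears k, lev j = 3, labels_at k j = [:: nextC k j] & nextC k j \in labelsC].
Proof.
move=> kC /mapP[[i s] /=]; move=> is_o Dj; rewrite Dj; have k12 := labelsC_12 kC.
have /andP[/eqP /= Ds tC] := allP (allP others_check k kC) _ is_o.
move: is_o; rewrite mem_filter => /andP[/eqP levi isn].
have [i_pts cki Ds' Ds2] := mem_nears k12 isn; rewrite -Ds2 Ds; split=> //; first by rewrite -Ds.
rewrite -typeC_labels // .
have: nextC k i \in ctab k i by rewrite -Ds' Ds mem_head.
by rewrite mem_filter => /andP[].
Qed.

(** The middle point of a geodesic from [y] to [j] is anchored at [j], and only one label is
    compatible there. *)
Lemma step_lab w k y j : k \in labelsC -> lab w k y -> j \in map fst (others k) ->
  exists2 y', d y y' = 1 & lab (w ++ tw j) (nextC k j) y'.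
Proof.
move=> kC yk /(othersP kC)[js levj Dl _]; have k12 := labelsC_12 kC.
have [j_pts ckj _ _] := mem_nears k12 js.
have [y' yy' y'j] := d_geo (etrans (yk j j_pts) ckj).
exists y' => //; have [Dy'|[y'p _]|[i [l [is_ li y'l]]]|[_ y'far]] := nb_cases k12 yk yy'.
- by move: y'j; rewrite Dy' e_lev // levj.
- have [p12 _ _] := partnerP k12; have Dj := lab_outer p12 y'p j_pts y'j.
  by move: ckj; have := c_val k12 pts1; rewrite Dj /= => ->.
- have [i_pts _ _ _] := mem_nears k12 is_.
  have l12: l \in labs12.
    by move: li; have [_ _ -> _] := mem_nears k12 is_; rewrite mem_filter => /andP[].
  have j'_pts := wapp_pts (winv (tw i)) j_pts.
  have := lab_outer l12 y'l j'_pts; rewrite wapp_cat wappK // => /(_ y'j) Dj.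
  have Dij: i = j by rewrite -(tw1 i_pts) -Dj wappK.
  by move: li; rewrite Dij Dl inE => /eqP <-; rewrite -Dij.
by have := y'far _ j_pts; rewrite y'j.
Qed.

(* Near polygon argument: two points [y1], [y2] collinear with both [x0] and
   [w0] lie in a quad, whose points are at distance at most 2 from each other. *)
Lemma no_square x0 y1 y2 w0 p : d x0 y1 = 1 -> d x0 y2 = 1 -> d w0 y1 = 1 -> d w0 y2 = 1 ->
  d y1 y2 = 2 -> d x0 w0 = 2 -> d p y1 = 2 -> d p y2 = 2 -> d p w0 = 2 -> d p x0 != 3.
Proof.
move=> x1 x2 w1 w2 y12 xw p1 p2 pw; apply/eqP=> px.
have yw: d y1 w0 = 1 by rewrite dC.
have := thirdP yw; move: (third y1 w0) => v Tv; have pv := Tv p; have xv := Tv x0; have y2v := Tv y2.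
have dpv: d p v = 1 by move: pv; rewrite p1 pw /pat; lia.
have dxv: d x0 v = 2 by move: xv; rewrite x1 xw /pat; lia.
have dyv: d y2 v = 2 by move: y2v; rewrite [d y2 y1]dC y12 [d y2 w0]dC w2 /pat; lia.
have := thirdP x2; move: (third x0 y2) => s Ts; have vs := Ts v; have ps := Ts p.
have dvs: d v s = 1 by move: vs; rewrite [d v x0]dC dxv [d v y2]dC dyv /pat; lia.
by move: ps; rewrite px p2 /pat; have := d_tri p v s; rewrite dpv dvs; lia.
Qed.

(** If [y1] and [y2] were collinear, the third point of their line would be at distance 0 both from
    [w0] and from the base point, each being at distance 1 from the other two points. *)
Lemma same_lab_d w k y1 y2 w0 : k \in labs12 -> lab w k y1 -> lab w k y2 -> y1 <> y2 ->
  d w0 y1 = 1 -> d w0 y2 = 1 -> w0 <> e (wapp w 1) -> d y1 y2 = 2.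
Proof.
move=> k12 y1k y2k y12 w1 w2 wx.
have: d y1 y2 <= 2 by have := d_tri y1 w0 y2; rewrite [d y1 w0]dC w1 w2.
have: d y1 y2 != 0 by rewrite d_eq0; apply/eqP.
have: d y1 y2 != 1; last by lia.
apply/eqP=> dy; have dw := thirdP dy w0; have dx := thirdP dy (e (wapp w 1)).
case: wx; move: dw dx; rewrite w1 w2 ![d (e _) _]dC (lab_d1 k12 y1k) (lab_d1 k12 y2k) /pat => dw dx.
have /eqP: d w0 (third y1 y2) == 0 by lia.
have /eqP: d (third y1 y2) (e (wapp w 1)) == 0 by lia.
by move=> /eqP + /eqP; rewrite !d_eq0 => /eqP <- /eqP.
Qed.

(** * Spreading type C labels along paths *)

Definition occurs w k := exists y, lab w k y.
Definition twice w k := exists y1 y2, [/\ y1 <> y2, lab w k y1 & lab w k y2].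

(** If two points with the same label had the same successor [z1], these three and the base point
    would form a quadrangle, and the point of HJ from [double_check] would contradict
    [no_square]. *)
Lemma step_twice w k j : k \in labelsC -> j \in map fst (others k) -> twice w k ->
  twice (w ++ tw j) (nextC k j).
Proof.
move=> kC jo [y1 [y2 [y12 y1k y2k]]]; have k12 := labelsC_12 kC.
have [z1 yz1 z1l] := step_lab kC y1k jo; have [z2 yz2 z2l] := step_lab kC y2k jo.
exists z1, z2; split=> // Dz; rewrite -{z2 z2l}Dz in yz2.
have [js levj _ lC] := othersP kC jo; have [j_pts _ _ _] := mem_nears k12 js.
have l12 := labelsC_12 lC.
have /hasP[u u_pts /and3P[/eqP levu /eqP cku /eqP clu]]:
    has (fun u => let x := wapp (tw j) u in [&& lev x == 3, label_dist k x == 2 & label_dist (nextC k j) u == 2]) pts.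
  have := jo => /mapP[[i s] iso Dj]; rewrite Dj; exact: (allP (allP double_check k kC) _ iso).
have u'_pts := wapp_pts (tw j) u_pts.
have zx: d z1 (e (wapp w 1)) = 2.
  have := d_tri z1 y1 (e (wapp w 1)); rewrite [d z1 y1]dC yz1 (lab_d1 k12 y1k).
  have := d_tri (e (wapp w 1)) z1 (e (wapp w j)).
  rewrite e_lev // levj (_ : d z1 (e (wapp w j)) = 1) ?[d (e _) z1]dC; first lia.
  by have := lab_d1 l12 z1l; rewrite wapp_cat tw1.
have z1y1: d z1 y1 = 1 by rewrite dC.
have z1y2: d z1 y2 = 1 by rewrite dC.
have y12d: d y1 y2 = 2.
  apply: (same_lab_d k12 y1k y2k y12 z1y1 z1y2) => Dz.
  by move: zx; rewrite Dz dxx.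
have := @no_square (e (wapp w 1)) y1 y2 z1 (e (wapp (w ++ tw j) u)).
rewrite ![d (e (wapp w 1)) _]dC (lab_d1 k12 y1k) (lab_d1 k12 y2k) zx.
rewrite ![d (e (wapp (w ++ tw j) u)) _]dC (z1l u u_pts) clu wapp_cat (y1k _ u'_pts) (y2k _ u'_pts) cku.
by rewrite e_lev // levu => /(_ erefl erefl z1y1 z1y2 y12d erefl erefl erefl erefl)/eqP.
Qed.

Lemma path_ind (Q : seq bool -> nat -> Prop) :
    (forall w k j, k \in labelsC -> j \in map fst (others k) -> Q w k -> Q (w ++ tw j) (nextC k j)) ->
  forall js w k, k \in labelsC -> path_ok k js -> Q w k ->
    Q (w ++ (path_end k js).1) (path_end k js).2 /\ (path_end k js).2 \in labelsC.
Proof.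
move=> Qstep; elim=> [|j js IHjs] w k kC /=; first by rewrite cats0.
case/andP=> jo js_ok Qk; have [_ _ _ lC] := othersP kC jo.
by rewrite catA; apply: IHjs => //; apply: Qstep.
Qed.

Lemma occurs_step w k j : k \in labelsC -> j \in map fst (others k) -> occurs w k ->
  occurs (w ++ tw j) (nextC k j).
Proof. by move=> kC jo [y yk]; have [y' _ y'l] := step_lab kC yk jo; exists y'. Qed.

Lemma labelC1 : 1 \in labelsC. Proof. by []. Qed.

(** Any type C label leads to any other one at the same base point by passing through label 1. *)
Lemma all_labels (Q : seq bool -> nat -> Prop) w k k' :
    (forall w k j, k \in labelsC -> j \in map fst (others k) -> Q w k -> Q (w ++ tw j) (nextC k j)) ->
    (forall w1 l w2 l', relabel_ok w1 l w2 l' -> Q (w ++ w1) l -> Q (w ++ w2) l') ->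
  k \in labelsC -> k' \in labelsC -> Q w k -> Q w k'.
Proof.
move=> Qstep Qrel kC k'C Qk; have /and3P[/allP from1 /allP to1 _] := paths_check.
have /andP[ok1 rel1] := to1 k kC; have [Q1 _] := path_ind Qstep kC ok1 Qk.
have {}Q1 := Qrel _ _ _ _ rel1 Q1; rewrite cats0 in Q1.
have /andP[ok2 rel2] := from1 k' k'C; have [Q2 _] := path_ind Qstep labelC1 ok2 Q1.
by have := Qrel _ _ _ _ rel2 Q2; rewrite cats0.
Qed.

Lemma occurs_all w k k' : k \in labelsC -> k' \in labelsC -> occurs w k -> occurs w k'.
Proof.
apply: all_labels => [|w1 l w2 l' rel [y yl]]; first exact: occurs_step.
by exists y; apply: relabel yl.
Qed.

Lemma twice_all w k k' : k \in labelsC -> k' \in labelsC -> twice w k -> twice w k'.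
Proof.
apply: all_labels => [w' k1 j|w1 l w2 l' rel [y1 [y2 [y12 y1l y2l]]]]; first exact: step_twice.
by exists y1, y2; split=> //; [apply: relabel y1l | apply: relabel y2l].
Qed.

Lemma e_inj w u u' : u \in pts -> u' \in pts -> e (wapp w u) = e (wapp w u') -> u = u'.
Proof.
move=> u_pts u'_pts Du; have l := lab0 (w ++ tw u); have l' := lab0 (w ++ tw u').
rewrite wapp_cat tw1 // in l; rewrite wapp_cat tw1 // -Du in l'.
by case: (labs_inj u_pts u'_pts (isT : 0 \in labs13) (isT : 0 \in labs13) l l').
Qed.

Lemma labelsBP k : k \in labelsB -> k = 6 \/ k = 12.
Proof. by rewrite !inE => /orP[]/eqP->; [left | right]. Qed.

(** * Counting the neighbours of a point of H *)

Definition Hnb w := [seq e (wapp w u) | u <- adjs 1].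

Lemma Hnb_uniq w : uniq (Hnb w).
Proof.
have /and4P[_ _ uniq1 _] := adj1_check; rewrite map_inj_in_uniq // => u u' /adj1_pts u1 /adj1_pts u'1.
exact: e_inj.
Qed.

Lemma Hnb_size w : size (Hnb w) = 10.
Proof. by rewrite size_map; apply/eqP; have /and4P[] := adj1_check. Qed.

Lemma mem_Hnb w y : y \in nb (e (wapp w 1)) -> inH y -> y \in Hnb w.
Proof.
rewrite mem_nb => /eqP d1 /(inH_wapp w)[u u_pts Dy]; rewrite Dy map_f //.
by rewrite -adj1P // -(e_lev w u_pts) -Dy d1.
Qed.

Lemma Hnb_nb w : {subset Hnb w <= nb (e (wapp w 1))}.
Proof.
move=> _ /mapP[u u1 ->]; have u_pts := adj1_pts u1.
by rewrite mem_nb e_lev // adj1P.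
Qed.

Definition outer w y := exists2 k, k \in labs12 & lab w k y.

Lemma outer_cat_uniq w ys : uniq ys -> (forall y, y \in ys -> outer w y) ->
  uniq (Hnb w ++ ys) /\ {subset Hnb w ++ ys <= nb (e (wapp w 1))}.
Proof.
move=> ys_uniq ys_out; split.
  rewrite cat_uniq Hnb_uniq ys_uniq andbT; apply/hasPn=> y /ys_out[k k12 yk].
  apply/negP=> /mapP[u /adj1_pts u_pts Dy]; apply: (lab_notinH k12 yk).
  by exists (wapp w u); rewrite ?wapp_pts.
move=> y; rewrite mem_cat => /orP[/Hnb_nb //|/ys_out[k k12 yk]].
by rewrite mem_nb dC (lab_d1 k12 yk).
Qed.

Lemma outer_le12 w ys : uniq ys -> (forall y, y \in ys -> outer w y) -> size ys <= 12.
Proof.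
move=> ys_uniq /(outer_cat_uniq ys_uniq)[uniq2 sub2]; have := uniq_leq_size uniq2 sub2.
by rewrite size_cat Hnb_size nb_size; lia.
Qed.

Lemma outer_missing w ys : uniq ys -> (forall y, y \in ys -> outer w y) -> size ys < 12 ->
  exists2 y, y \notin ys & outer w y.
Proof.
move=> ys_uniq ys_out lt_ys; have [uniq2 sub2] := outer_cat_uniq ys_uniq ys_out.
have [/allP all_in|/allPn[y y_nb]] := boolP (all (fun y => y \in Hnb w ++ ys) (nb (e (wapp w 1)))).
  have := uniq_leq_size (nb_uniq _) all_in.
  by rewrite size_cat Hnb_size nb_size; lia.
rewrite mem_cat => /norP[yH y_ys]; exists y => //.
apply: lab_exists => [/(mem_Hnb y_nb)|]; first by rewrite (negPf yH).
by apply/eqP; rewrite dC -mem_nb.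
Qed.

Lemma pick_labels (S : seq nat) (P0 : P) (Q : nat -> P -> Prop) :
    (forall k, k \in S -> exists y, Q k y) ->
  exists g : nat -> P, forall k, k \in S -> Q k (g k).
Proof.
move=> exQ; have [k|g gP] := @choice _ _ (fun k y => k \in S -> Q k y); last by exists g.
by have [/exQ[y Qy]|kS] := boolP (k \in S); [exists y | exists P0].
Qed.

Lemma lab_map_uniq w S (g : nat -> P) : {subset S <= labs12} -> uniq S ->
  (forall k, k \in S -> lab w k (g k)) -> uniq (map g S).
Proof.
move=> S12 uS gl; rewrite map_inj_in_uniq // => k k' kS k'S Dg.
apply: (lab_inj (w := w) (y := g k)); try exact/labs12_13/S12; first exact: gl.
by rewrite Dg; apply: gl.
Qed.

(** If one type C label occurred twice at the base point, all ten would ([twice_all]), giving 20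
    outer neighbours where there is room for 12. *)
Lemma lab_uniqC w k y y' : k \in labelsC -> lab w k y -> lab w k y' -> y = y'.
Proof.
move=> kC yk y'k; apply: contrapT => yy'.
have tw_k: twice w k by exists y, y'.
have [k1 exk1|g1 g1P] := pick_labels (S := labelsC) y (Q := fun k y1 => lab w k y1 /\ exists2 y2, y1 <> y2 & lab w k y2).
  by have [y1 [y2 [? ? ?]]] := twice_all kC exk1 tw_k; exists y1; split=> //; exists y2.
have [k1 k1C|g2 g2P] := pick_labels (S := labelsC) y (Q := fun k y2 => g1 k <> y2 /\ lab w k y2).
  by have [_ [y2 ? ?]] := g1P k1 k1C; exists y2.
have u1 : uniq (map g1 labelsC).
  by apply: (@lab_map_uniq w) => [k1 /labelsC_12||k1 /g1P[]].
have u2 : uniq (map g2 labelsC).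
  by apply: (@lab_map_uniq w) => [k1 /labelsC_12||k1 /g2P[]].
have u12: uniq (map g1 labelsC ++ map g2 labelsC).
  rewrite cat_uniq u1 u2 andbT; apply/hasPn=> _ /mapP[k2 k2C ->]; apply/negP=> /mapP[k1 k1C Dg].
  have [_ l2] := g2P k2 k2C; have [l1 _] := g1P k1 k1C; rewrite Dg in l2.
  have Dk := lab_inj (labs12_13 (labelsC_12 k2C)) (labs12_13 (labelsC_12 k1C)) l2 l1.
  by have [] := g2P k1 k1C; rewrite -{2}Dk Dg.
suffices: size (map g1 labelsC ++ map g2 labelsC) <= 12 by [].
apply: (@outer_le12 w _ u12) => z; rewrite mem_cat => /orP[]/mapP[k1 k1C ->]; exists k1; rewrite ?labelsC_12 //.
  by have [] := g1P k1 k1C.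
by have [] := g2P k1 k1C.
Qed.

(** Some outer neighbour exists. If it is of type B, a geodesic from it to [u0 k0] starts with a
    neighbour that must be of type C, anchored at some [j] adjacent to the base point. There all
    type C labels occur, and [paths_back] returns one of them to the base point. *)
Lemma occurs_C w k : k \in labelsC -> occurs w k.
Proof.
move=> kC; have [y _ [k0 k0_12 yk0]] := @outer_missing w [::] isT (fun y => ltac:(by [])) isT.
have [k0B|k0C] := labs12_BC k0_12; last by apply: (occurs_all k0C) => //; exists y.
have /andP[u0_pts /and4P[/eqP c0 /eqP lev0 /eqP cp0 /allP nr0]] := allP u0_check k0 k0B.
have [y' yy' y'0] := d_geo (etrans (yk0 _ u0_pts) c0).
have [Dy'|[y'p _]|[j [l [js lj y'l]]]|[y'H y'far]] := nb_cases k0_12 yk0 yy'.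
- by move: y'0; rewrite Dy' e_lev // lev0.
- by case: cp0; rewrite -y'p.
- have [j_pts ck0j _ Ds] := mem_nears k0_12 js.
  have jl1 : j \in adjs 1.
    have /andP[/eqP <- _] := allP nearB_check k0 k0B; exact: (map_f fst js).
  have lC : l \in labelsC.
    have l12: l \in labs12.
      by move: lj; have [_ _ -> _] := mem_nears k0_12 js; rewrite mem_filter => /andP[].
    have := allP (nr0 _ js) l lj; rewrite -typeC_labels //= -(y'l _ (wapp_pts _ u0_pts)).
    by rewrite wapp_cat wappK // y'0.
  have occ1: occurs (w ++ tw j) 1 by apply: (occurs_all lC) => //; exists y'.
  have /and3P[_ _ /allP/(_ j jl1)/hasP[p _]] := paths_check.
  cbv zeta; case/and3P=> _ ok1 /hasP[k1 k1C rel1].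
  have [[z zl] _] := path_ind occurs_step labelC1 ok1 occ1.
  apply: (occurs_all k1C kC); exists z; rewrite -[w]cats0; apply: (relabel rel1).
  by rewrite catA.
by case: (no_far k0B yk0 yy' y'H y'far).
Qed.

Lemma pickC w : exists g : nat -> P, forall k, k \in labelsC -> lab w k (g k).
Proof. by apply: (pick_labels (e 1)) => k; apply: occurs_C. Qed.

(** For a type B label occurring twice, the two points, the partner of one of them and the ten type
    C points would be 13 outer neighbours. *)
Lemma lab_uniq w k y y' : k \in labs13 -> lab w k y -> lab w k y' -> y = y'.
Proof.
move=> k13 yk y'k; have [Dk|k_n0] := eqVneq k 0.
  by move: yk y'k; rewrite Dk => /lab0_eq-> /lab0_eq->.
have k12: k \in labs12 by move: k13 k_n0; rewrite !mem_iota; lia.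
have [kB|kC] := labs12_BC k12; last exact: lab_uniqC kC yk y'k.
apply: contrapT => yy'; have [g gl] := pickC w.
have [p12 pk tp] := partnerP k12; have zl := lab_partner k12 yk.
set z := third _ y in zl; have zy x : lab w k x -> z != x.
  move=> xk; apply/eqP=> Dz; rewrite Dz in zl.
  by move: pk; rewrite (lab_inj (labs12_13 p12) k13 zl xk) eqxx.
have kNC: k \notin labelsC by case/labelsBP: kB => ->.
have pNC: partner k \notin labelsC by case/labelsBP: kB => ->.
have out x k1 : k1 \in labs12 -> lab w k1 x -> outer w x by exists k1.
have gN x k1 : k1 \in labs12 -> k1 \notin labelsC -> lab w k1 x -> x \notin map g labelsC.
  move=> k1_12 k1NC xk1; apply/mapP=> -[k2 k2C Dx]; have := gl k2 k2C; rewrite -Dx => xk2.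
  by move: k1NC; rewrite (lab_inj (labs12_13 k1_12) (labs12_13 (labelsC_12 k2C)) xk1 xk2) k2C.
have uys: uniq ([:: z; y; y'] ++ map g labelsC).
  rewrite cat_uniq (@lab_map_uniq w) // => [|k1 /labelsC_12 //]; rewrite andbT; apply/andP; split.
    by rewrite /= !inE !negb_or !zy //= andbT; apply/eqP.
  apply/hasPn=> x x_g; apply/negP; rewrite !inE => /or3P[]/eqP Dx; move: x_g; rewrite Dx.
  - by rewrite (negPf (gN _ _ p12 pNC zl)).
  - by rewrite (negPf (gN _ _ k12 kNC yk)).
  by rewrite (negPf (gN _ _ k12 kNC y'k)).
suffices: size ([:: z; y; y'] ++ map g labelsC) <= 12 by [].
apply: (@outer_le12 w _ uys) => x; rewrite mem_cat => /orP[|/mapP[k1 k1C ->]].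
  rewrite !inE => /or3P[]/eqP->; first exact: out p12 zl.
    exact: out k12 yk.
  exact: out k12 y'k.
by apply: out (labelsC_12 k1C) _; apply: gl.
Qed.

(** The ten type C points leave an outer neighbour over, necessarily of type B; the third point on
    its line through the base point has the other type B label. *)
Lemma occurs_lab w k : k \in labs13 -> occurs w k.
Proof.
move=> k13; have [->|k_n0] := eqVneq k 0; first by exists (e (wapp w 1)); apply: lab0.
have k12: k \in labs12 by move: k13 k_n0; rewrite !mem_iota; lia.
have [kB|] := labs12_BC k12; last exact: occurs_C.
have [g gl] := pickC w.
have [||z z_g [k1 k1_12 zk1]] := @outer_missing w (map g labelsC) _ _ isT.
- by apply: (@lab_map_uniq w) => // k1 /labelsC_12.
- by move=> _ /mapP[k1 k1C ->]; exists k1; [apply: labelsC_12 | apply: gl].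
have [k1B|k1C] := labs12_BC k1_12; last first.
  by case/negP: z_g; apply/mapP; exists k1; last exact: lab_uniqC k1C zk1 (gl k1 k1C).
have [Dk|k_k1] := eqVneq k k1; first by exists z; rewrite Dk.
exists (third (e (wapp w 1)) z); rewrite (_ : k = partner k1); first exact: lab_partner.
by case/labelsBP: k1B k_k1 => ->; case/labelsBP: kB => ->.
Qed.

Lemma third_lab w k y j' l' y' j l : lab w k y -> lab (w ++ tw j') l' y' -> d y y' = 1 ->
  third_check k j' l' j l -> lab (w ++ tw j) l (third y y').
Proof.
move=> yk y'l' yy' /allP ok u u_pts; have x_pts := wapp_pts (tw j) u_pts.
have := ok u u_pts; cbv zeta; apply: pat_inj.
have Dy': d y' (e (wapp w (wapp (tw j) u))) = label_dist l' (wapp (winv (tw j')) (wapp (tw j) u)).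
  by rewrite -(y'l' _ (wapp_pts _ x_pts)) wapp_cat wappK.
by have := thirdP yy' (e (wapp (w ++ tw j) u)); rewrite ![d (e _) _]dC wapp_cat (yk _ x_pts) Dy'.
Qed.

(** * The 22 neighbours of an outer point *)

Lemma partnerB k : k \in labelsB -> partner k \in labelsB /\ partner (partner k) = k.
Proof. by case/labelsBP=> ->. Qed.

Lemma nearB_dist k w y : k \in labelsB -> lab w k y ->
  exists2 f : P -> positive * nat,
    forall z, d y z = 1 -> z != e (wapp w 1) -> z != third (e (wapp w 1)) y ->
      [/\ ((f z).1, labels_at k (f z).1) \in nears k, (f z).2 \in labels_at k (f z).1
        & lab (w ++ tw (f z).1) (f z).2 z] & True.
Proof.
move=> kB yk; have k12 := labelsB_12 kB.
have [z|f fP] := @choice _ _ (fun z (p : positive * nat) =>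
   d y z = 1 -> z != e (wapp w 1) -> z != third (e (wapp w 1)) y ->
   [/\ (p.1, labels_at k p.1) \in nears k, p.2 \in labels_at k p.1 & lab (w ++ tw p.1) p.2 z]);
  last by exists f.
have [[yz [z1 z2]]|no] := pselect (d y z = 1 /\ z != e (wapp w 1) /\ z != third (e (wapp w 1)) y); last first.
  by exists (1%positive, 0) => *; case: no.
have [/eqP|[_ /eqP]|[j [l [js lj zl]]]|[zH zfar]] := nb_cases k12 yk yz; rewrite ?(negPf z1) ?(negPf z2) //.
  by exists (j, l).
by case: (no_far kB yk yz zH zfar).
Qed.

Lemma nearB_labels k j l : k \in labelsB -> (j, labels_at k j) \in nears k -> l \in labels_at k j ->
  [/\ j \in adjs 1, typeC (labC k j), labB k j \in labelsB &
      l = labC k j \/ l = labB k j \/ l = partner (labB k j)].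
Proof.
move=> kB js lj; have /andP[/eqP Dfst ok] := allP nearB_check k kB.
have := allP ok _ js; cbv zeta => /andP[/allP sl /and5P[tC tB _ _ _]].
split=> //; first by rewrite -Dfst; apply: (map_f fst js).
  by rewrite !inE; move: tB; rewrite /typeB.
by have := sl l lj; rewrite !inE => /or3P[]/eqP; tauto.
Qed.

(** Besides the base point and the third point of their line, [y] has 20 neighbours, each anchored
    at one of ten points and of type B or C. The pair (anchor, type) determines the neighbour, so
    all 20 pairs occur, among them the type C one at [j]. *)
Lemma nb_B_C k w y j : k \in labelsB -> lab w k y -> (j, labels_at k j) \in nears k ->
  exists2 y', d y y' = 1 & lab (w ++ tw j) (labC k j) y'.
Proof.
move=> kB yk js; have k12 := labelsB_12 kB.
have [f fP _] := nearB_dist kB yk; have yx := lab_d1 k12 yk.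
have xy: d (e (wapp w 1)) y = 1 by rewrite dC.
have [xt yt] := third_col xy; set x := e (wapp w 1) in xt yt fP xy yx *; set t := third x y in xt yt fP *.
have xt_neq: x != t by rewrite -d_eq0 xt.
pose S := [seq z <- nb y | (z != x) && (z != t)].
have S_size: size S = 20.
  have: perm_eq (nb y) ([:: x; t] ++ S).
    rewrite -(perm_filterC (fun z => (z == x) || (z == t)) (nb y)); apply: perm_cat; last first.
      by rewrite (@eq_filter _ _ (fun z => (z != x) && (z != t))) // => z; rewrite /= negb_or.
    apply: uniq_perm; rewrite ?filter_uniq //= ?inE ?xt_neq // => z.
    rewrite mem_filter !inE; case: eqP => [->|_] /=; first by rewrite mem_nb yx.
    by case: eqP => [->|_] //=; rewrite mem_nb yt.
  by move/perm_size; rewrite nb_size size_cat /= => -[].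
have fS z : z \in S -> [/\ d y z = 1, ((f z).1, labels_at k (f z).1) \in nears k,
    (f z).2 \in labels_at k (f z).1 & lab (w ++ tw (f z).1) (f z).2 z].
  rewrite mem_filter mem_nb => /andP[/andP[zx zt] /eqP yz].
  by have [? ? ?] := fP z yz zx zt; split.
have lab13 z (zS : z \in S) : (f z).2 \in labs13.
  have [_ zs zl _] := fS z zS; have [_ _ Ds _] := mem_nears k12 zs; move: zl.
  by rewrite Ds mem_filter => /andP[_ /labs12_13].
pose code z := ((f z).1, typeC (f z).2).
have code_inj: {in S &, injective code}.
  move=> z z' zS z'S [Dj Dt]; have [yz zs zl zf] := fS z zS; have [yz' z's z'l z'f] := fS z' z'S.
  have same: (f z).2 = (f z').2 -> z = z'.
    by move=> Dl; apply: (lab_uniq (lab13 z zS) zf); rewrite Dj Dl.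
  have [_ tC bB zl3] := nearB_labels kB zs zl; have [_ _ _ z'l3] := nearB_labels kB z's z'l.
  rewrite -Dj in z'l3; have [pB pK] := partnerB bB.
  have NC b : b \in labelsB -> typeC b = false by case/labelsBP=> ->.
  (* Partner labels at the same anchor would give a line through this anchor with distances 2, 1, 1
     from [y], which [pat] excludes. *)
  have opp b : b \in labelsB -> (f z).2 = b -> (f z').2 = partner b -> z = z'.
    move=> bB' Db Dpb; have b12 := labelsB_12 bB'; rewrite Db in zf; rewrite Dpb -Dj in z'f.
    have Dz' := lab_uniq (labs12_13 (labelsB_12 (partnerB bB').1)) z'f (lab_partner b12 zf).
    have [zj_pts ckj _ _] := mem_nears k12 zs.
    have dz := lab_d1 b12 zf; rewrite wapp_cat tw1 // dC in dz.
    have := thirdP dz y; rewrite (yk _ zj_pts) ckj yz.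
    by move: Dz'; rewrite wapp_cat tw1 // => <-; rewrite yz'.
  case: zl3 => [Dl|[Dl|Dl]]; case: z'l3 => [Dl'|[Dl'|Dl']]; try by apply: same; rewrite Dl Dl'.
  - by move: Dt; rewrite Dl Dl' tC NC.
  - by move: Dt; rewrite Dl Dl' tC NC.
  - by move: Dt; rewrite Dl Dl' tC NC.
  - exact: opp Dl Dl'.
  - by move: Dt; rewrite Dl Dl' tC NC.
  by apply: opp Dl _; rewrite ?pK.
pose T := [seq (i, t) | i <- adjs 1, t <- [:: true; false]].
have sST : {subset map code S <= T}.
  move=> _ /mapP[z zS ->]; have [_ zs zl _] := fS z zS; have [j1 _ _ _] := nearB_labels kB zs zl.
  by apply/allpairsP; exists (code z); split=> //; rewrite !inE; case: (code z).2.
have size_T : size T = 20.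
  by rewrite size_allpairs; have /and4P[_ /eqP-> _ _] := adj1_check.
have code_uniq : uniq (map code S) by rewrite map_inj_in_uniq ?filter_uniq.
have [|_ DT] := uniq_min_size code_uniq sST; first by rewrite size_map S_size size_T.
have j1 : j \in adjs 1.
  by have /andP[/eqP <- _] := allP nearB_check k kB; apply: (map_f fst js).
have: (j, true) \in T by apply/allpairsP; exists (j, true).
rewrite -DT => /mapP[z zS [Dj Dt]]; have [yz zs zl zf] := fS z zS; exists z => //.
have [_ _ bB] := nearB_labels kB zs zl; have [pB _] := partnerB bB.
rewrite -Dj in zf bB pB *; case=> [<- //|[]] Dl; move: Dt; rewrite Dl.
  by case/labelsBP: bB => ->.
by case/labelsBP: pB => ->.
Qed.

Lemma nb_B_B k w y j : k \in labelsB -> lab w k y -> (j, labels_at k j) \in nears k ->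
  exists2 y', d y y' = 1 & lab (w ++ tw j) (labB k j) y'.
Proof.
move=> kB yk js; have k12 := labelsB_12 kB; have /andP[/eqP Dfst ok] := allP nearB_check k kB.
have := allP ok _ js; cbv zeta => /and5P[_ _ _ _ /and5P[_ _ j'1 _ /andP[_ tc]]].
have j's : (third1 j, labels_at k (third1 j)) \in nears k.
  move: j'1; rewrite -Dfst => /mapP[[i s] is_ /= ->].
  by have [_ _ _ <-] := mem_nears k12 is_.
have [y' yy' y'l] := nb_B_C kB yk j's.
exists (third y y'); first by have [] := third_col yy'.
exact: third_lab yk y'l yy' tc.
Qed.

Lemma labels_at_nears k j l : k \in labs12 -> l \in labels_at k j ->
  (j, labels_at k j) \in nears k /\ l \in labs12.
Proof.
move=> k12 lj; have js: (j, labels_at k j) \in nears k.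
  move: (lj); rewrite {1}/labels_at => /flatten_mapP[[i s]]; rewrite mem_filter /= => /andP[/eqP-> is_] _.
  by have [j_pts ckj _ _] := mem_nears k12 is_; apply: nears_intro.
split=> //; move: lj; have [_ _ -> _] := mem_nears k12 js.
by rewrite mem_filter => /andP[].
Qed.

Lemma nearC_cases k j : k \in labelsC -> (j, labels_at k j) \in nears k ->
  j \in map fst (others k) \/ quad_check k j (labels_at k j) /\ j \in pts.
Proof.
move=> kC js; have [j_pts _ _ _] := mem_nears (labelsC_12 kC) js.
have /orP[lev3|/andP[_ qc]] := allP (allP nearC_check k kC) _ js; last by right.
by left; apply/mapP; exists (j, labels_at k j); rewrite ?mem_filter ?lev3.
Qed.

Lemma quadP k j l : quad_check k j (labels_at k j) -> l \in labels_at k j ->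
  let i := wapp (winv (tw j)) 1 in let j' := third1 j in let i' := wapp (winv (tw j')) j in
  [/\ size (labels_at k j) = 2, labC k j \in labels_at k j /\ typeC (labC k j),
   exists2 b, b \in labelsB & [/\ b \in labels_at k j, i \in adjs 1
     & relabel_ok (tw j ++ tw i) (labC b i) [::] k],
   partner (labC k j) \notin labels_at k j
   & exists2 b, b \in labelsB & [/\ b \in labels_at k j', typeB b, i' \in adjs 1
     & relabel_ok (tw j' ++ tw i') (labC b i') (tw j) (partner (labC k j))]].
Proof.
rewrite /quad_check; case Ds: labels_at => [//|l1 s]; rewrite -Ds => + _.
case/and5P=> /eqP size2 gC tC /hasP[b0 b0B /and4P[b0s _ i1 rel]] /andP[pN /hasP[b bB]].
by case/and5P=> _ tB bj' i1' rel'; split=> //; [exists b0 | exists b].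
Qed.

(** The adjacency is read from the other end: a point with label [b] at [j] exists, [nb_B_C] gives
    it a neighbour whose label at the base point is [k] after a change of frame, and by uniqueness
    this neighbour is [y]. *)
Lemma nb_C_B k w y j b : k \in labelsC -> lab w k y -> b \in labels_at k j -> typeB b ->
  exists2 y', d y y' = 1 & lab (w ++ tw j) b y'.
Proof.
move=> kC yk bj tB; have k12 := labelsC_12 kC; have [js b12] := labels_at_nears k12 bj.
have bB: b \in labelsB by rewrite !inE; move: tB; rewrite /typeB.
have NC b1 : b1 \in labelsB -> typeC b1 = false by case/labelsBP=> ->.
have [jo|[qc j_pts]] := nearC_cases kC js.
  have [_ _ Ds nC] := othersP kC jo; move: bj; rewrite Ds inE => /eqP Db.
  by move: nC; rewrite -Db -typeC_labels // NC.
have [size2 [gC tC] [b0 b0B [b0s i1 rel]] _ _] := quadP qc bj.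
have Db: b = b0.
  move: gC b0s size2 bj {js qc}; case: (labels_at k j) => [|l1 [|l2 [|? ?]]] //; rewrite !inE => gC b0s _ bj.
  case/orP: gC => /eqP g; case/orP: bj => /eqP Db; case/orP: b0s => /eqP Db0; rewrite Db Db0 //.
  - by move: tC; rewrite g -Db NC.
  - by move: tC; rewrite g -Db0 NC.
  - by move: tC; rewrite g -Db0 NC.
  by move: tC; rewrite g -Db NC.
rewrite {}Db in bj bB b12 tB *.
have [y' y'b] := occurs_lab (w ++ tw j) (labs12_13 b12).
have i_s : (wapp (winv (tw j)) 1, labels_at b0 (wapp (winv (tw j)) 1)) \in nears b0.
  have /andP[/eqP Dfst _] := allP nearB_check b0 bB.
  move: i1; rewrite -Dfst => /mapP[[i s0] is_ /= ->].
  by have [_ _ _ <-] := mem_nears b12 is_.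
have [z y'z zl] := nb_B_C bB y'b i_s; exists y' => //; rewrite dC -[y](_ : z = y) //.
apply: (lab_uniq (labs12_13 k12) _ yk); rewrite -[w]cats0; apply: (relabel rel).
by rewrite catA.
Qed.

Lemma pat2 a b : pat 2 a b -> a <= 2 -> a != 0 -> a != 1 -> b = 1.
Proof. rewrite /pat; lia. Qed.

Lemma d_col y y' x : d y y' = 1 -> (d y x <= (d y' x).+1) && (d y' x <= (d y x).+1).
Proof.
move=> yy'; have := d_tri y y' x; have := d_tri y' y x.
by rewrite [d y' y]dC yy'; lia.
Qed.

(** In the quad case one goes from [y] over a type B point at [third1 j] to the point [p'] at [j]
    whose label is the partner of the wanted one. It is at distance at most 2 from [y], not 0, and
    not 1 because its label is not compatible. As [j] is also at distance 2, the third point of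
    their line is collinear with [y], and it carries the wanted label. *)
Lemma nb_C_C k w y j : k \in labelsC -> lab w k y -> labC k j \in labels_at k j -> typeC (labC k j) ->
  exists2 y', d y y' = 1 & lab (w ++ tw j) (labC k j) y'.
Proof.
move=> kC yk gj tC; have k12 := labelsC_12 kC; have [js g12] := labels_at_nears k12 gj.
have [j_pts ckj Ds0 _] := mem_nears k12 js.
have [jo|[qc _]] := nearC_cases kC js.
  have [_ _ Ds nC] := othersP kC jo; move: gj; rewrite Ds inE => /eqP->; exact: step_lab.
have [_ _ _ pN [b bB [bj' tB i1 rel]]] := quadP qc gj.
set g := labC k j in gj tC g12 pN rel *.
have [b' yb' b'l] := nb_C_B kC yk bj' tB; have b12 := labelsB_12 bB.
have i_s : (wapp (winv (tw (third1 j))) j, labels_at b (wapp (winv (tw (third1 j))) j)) \in nears b.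
  have /andP[/eqP Dfst _] := allP nearB_check b bB.
  move: i1; rewrite -Dfst => /mapP[[i s0] is_ /= ->].
  by have [_ _ _ <-] := mem_nears b12 is_.
have [p' b'p' p'l0] := nb_B_C bB b'l i_s.
have {p'l0} p'l : lab (w ++ tw j) (partner g) p'.
  by apply: (relabel rel); rewrite catA.
have [p12 _ _] := partnerP g12; have g_pp : partner (partner g) = g.
  by apply/eqP; apply: (allP (_ : all (fun l => partner (partner l) == l) labs12)).
have yx0: d y (e (wapp w j)) = 2 by rewrite yk.
have p'x0: d (e (wapp w j)) p' = 1.
  by have := lab_d1 p12 p'l; rewrite wapp_cat tw1 // dC.
exists (third (e (wapp w j)) p'); last first.
  by have := lab_partner p12 p'l; rewrite g_pp wapp_cat tw1.
have yp'_pat: pat 2 (d y p') (d y (third (e (wapp w j)) p')) by rewrite -yx0; apply: thirdP.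
have yp'_le: d y p' <= 2 by rewrite (leq_trans (d_tri _ b' _)) // yb' b'p'.
have yp'0: d y p' != 0.
  rewrite d_eq0; apply/eqP=> Dp'; have yj: d y (e (wapp w j)) = 1 by rewrite Dp' dC.
  by rewrite yj in yx0.
apply: (pat2 yp'_pat yp'_le yp'0); apply/eqP=> yp'; case/negP: pN; rewrite Ds0 mem_filter p12 andbT.
apply/allP=> u u_pts /=; rewrite -(p'l u u_pts) wapp_cat -(yk _ (wapp_pts (tw j) u_pts)).
exact: d_col.
Qed.

Lemma twq1 : tw 1 = [::]. Proof. by []. Qed.

Lemma nbl_realized k w y p : k \in labs13 -> lab w k y -> p \in nbl k ->
  exists2 y', d y y' = 1 & lab (w ++ tw p.1) p.2 y'.
Proof.
move=> k13 yk; have /and4P[/eqP-> _ _ _] := allP nbl_check k k13.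
have [Dk|k_n0] := eqVneq k 0.
  have Dy : y = e (wapp w 1) by apply: lab0_eq; rewrite -Dk.
  rewrite Dk /near_labels mem_cat => /orP[/mapP[j j1 ->]|/mapP[l l12 ->]] /=.
    exists (e (wapp w j)); first by rewrite Dy e_lev ?adj1_pts //; apply/eqP; rewrite adj1P ?adj1_pts.
    by have := lab0 (w ++ tw j); rewrite wapp_cat tw1 ?adj1_pts.
  have [y' y'l] := occurs_lab w (labs12_13 l12); exists y'; last by rewrite twq1 cats0.
  by rewrite Dy dC (lab_d1 l12 y'l).
have k12: k \in labs12 by move: k13 k_n0; rewrite !mem_iota; lia.
have yx := lab_d1 k12 yk; have xy: d (e (wapp w 1)) y = 1 by rewrite dC.
case: k k13 k12 k_n0 yk => // k' k13 k12 k_n0 yk; set k := k'.+1 in k13 k12 yk *.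
rewrite /near_labels -/k !inE => /or3P[/eqP->|/eqP->|] /=.
- exists (e (wapp w 1)) => //; rewrite twq1 cats0; exact: lab0.
- exists (third (e (wapp w 1)) y); first by have [] := third_col xy.
  by rewrite twq1 cats0; apply: lab_partner.
have labels_near (p1 : positive * seq nat) : p1 \in nears k -> p1.2 = labels_at k p1.1.
  by case: p1 => j s /(mem_nears k12)[_ _ _].
have [kB|kC] := labs12_BC k12.
  have ->: typeB k by case/labelsBP: kB => ->.
  move=> /flatten_mapP[[j s] js]; have Ds := labels_near _ js; rewrite /= in Ds; rewrite Ds in js.
  rewrite !inE => /orP[]/eqP->; [exact: nb_B_C | exact: nb_B_B].
have ->: typeB k = false.
  by have := kC; rewrite -typeC_labels // /typeC => /and3P[_ _ /negPf].
move=> /flatten_mapP[[j s] js /mapP[l]]; have Ds := labels_near _ js; rewrite /= in Ds *.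
rewrite Ds => lj ->; rewrite Ds in js; have [_ l12] := labels_at_nears k12 lj.
have [lB|lC] := labs12_BC l12.
  by apply: (nb_C_B kC) => //; case/labelsBP: lB => ->.
have tC: typeC l by rewrite typeC_labels.
suffices Dl: l = labC k j by move: lj tC; rewrite Dl; apply: nb_C_C.
have [jo|[qc _]] := nearC_cases kC js.
  have [_ _ Dn nC] := othersP kC jo; move: lj; rewrite Dn inE => /eqP Dl.
  by rewrite /labC Dn -Dl /filter tC.
have [size2 [gC tg] [b0 b0B [b0s _ _]] _ _] := quadP qc lj.
have NC b1 : b1 \in labelsB -> typeC b1 = false by case/labelsBP=> ->.
move: size2 gC b0s lj {js qc}; case: (labels_at k j) => [|l1 [|l2 [|? ?]]] // _; rewrite !inE.
case/orP=> /eqP g; case/orP=> /eqP Db; case/orP=> /eqP Dl; rewrite ?g ?Dl //.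
- by move: tg; rewrite g -Db NC.
- by move: tC; rewrite Dl -Db NC.
- by move: tC; rewrite Dl -Db NC.
by move: tg; rewrite g -Db NC.
Qed.

(** The 22 entries of [nbl k] are realised by distinct neighbours, hence by all of them. This
    excludes far neighbours of type C points as well. *)
Lemma nb_labelled k w y y' : k \in labs13 -> lab w k y -> d y y' = 1 ->
  exists2 p, p \in nbl k & lab (w ++ tw p.1) p.2 y'.
Proof.
move=> k13 yk yy'; have /and4P[_ nbl_uniq /eqP nbl_size /allP nbl_ok] := allP nbl_check k k13.
have [p|f fP] := @choice _ _ (fun p z => p \in nbl k -> d y z = 1 /\ lab (w ++ tw p.1) p.2 z).
  have [p_nbl|_] := boolP (p \in nbl k); last by exists y.
  by have [z yz zl] := nbl_realized k13 yk p_nbl; exists z.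
have f_uniq : uniq (map f (nbl k)).
  rewrite map_inj_in_uniq // => p q p_in q_in Df; have [_ pl] := fP p p_in; have [_ ql] := fP q q_in.
  have /andP[p1 p2] := nbl_ok p p_in; have /andP[q1 q2] := nbl_ok q q_in.
  rewrite Df in pl; case: p q p1 p2 q1 q2 pl ql {p_in q_in Df} => [p1 p2] [q1 q2] /= p1_pts p2_13 q1_pts q2_13 pl ql.
  exact: labs_inj p1_pts q1_pts p2_13 q2_13 pl ql.
have sub: {subset map f (nbl k) <= nb y}.
  by move=> _ /mapP[p p_in ->]; rewrite mem_nb; have [->] := fP p p_in.
have [|_ Dnb] := uniq_min_size f_uniq sub; first by rewrite size_map nbl_size nb_size.
have: y' \in nb y by rewrite mem_nb yy'.
by rewrite -Dnb => /mapP[p p_in ->]; exists p => //; have [] := fP p p_in.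
Qed.

(** Labels pass from point to point along a geodesic that starts at [e 1]. *)
Lemma all_labelled y : exists w k, k \in labs13 /\ lab w k y.
Proof.
have [n Dn] : exists n, d y (e 1) = n by exists (d y (e 1)).
elim: n y Dn => [|n IHn] y Dn.
  exists [::], 0; split=> //; move/eqP: Dn; rewrite d_eq0 => /eqP->; exact: (lab0 [::]).
have [z yz zn] := d_geo Dn; have [w [k [k13 zk]]] := IHn z zn.
have [p p_in yl] : exists2 p, p \in nbl k & lab (w ++ tw p.1) p.2 y.
  by apply: nb_labelled k13 zk _; rewrite dC.
exists (w ++ tw p.1), p.2; split=> //.
by have /and4P[_ _ _ /allP/(_ p p_in)/andP[]] := allP nbl_check k k13.
Qed.

End NearOctagon.

(** * Central involutions *)

Section CentralInvolutions.
Import GroupScope.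
Variables (gT : finGroupType) (G E : {group gT}) (T : {set gT}) (x0 : gT).
Hypothesis TG : T \subset G.
Hypothesis TJ : forall x g, x \in T -> g \in G -> x ^ g \in T.
Hypothesis T_trans : forall x, x \in T -> exists2 g, g \in G & x = x0 ^ g.
Hypothesis x0T : x0 \in T.
Hypothesis T_odd : odd #|T|.
Hypothesis x0_order : #[x0] = 2.
Let C : {set gT} := T :&: 'C[x0].
(** [E] is generated by [zJ] in the application to J_2 and is a four-group of root elements in that
    to G_2(4):2. The hypotheses say that modulo [E] the elements of [C] commute. *)
Hypothesis E2 : 2.-group E.
Hypothesis EC : E \subset 'C(C).
Hypothesis EQ : E \subset <<C>>.
Hypothesis CJ : forall x y, x \in C -> y \in C -> x ^ y \in x *: E.
Hypothesis cent_C : forall z, z \in G -> z \in 'C(C) -> #[z] = 2 -> z \in T.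

Lemma order_T x : x \in T -> #[x] = 2.
Proof. by case/T_trans=> g _ ->; rewrite orderJ. Qed.

(* [S] is a 2-group acting on the odd set [T]. *)
Lemma Sylow_fix (S : {group gT}) : S \in 'Syl_2(G) -> exists2 t, t \in T & S \subset 'C[t].
Proof.
rewrite inE => sylS; have [SG S2 _] := and3P sylS.
have actsS: [acts S, on T | 'J].
  apply/subsetP=> g gS; rewrite !inE /=; apply/subsetP=> x xT; rewrite inE /=.
  by apply: TJ => //; apply: (subsetP SG).
have := pgroup_fix_mod S2 actsS.
have [-> |[t]] := set_0Vmem ('Fix_(T | 'J)(S)).
  by rewrite cards0 => /eqP; rewrite mod0n -/(dvdn 2 _) dvdn2 T_odd.
rewrite inE => /andP[tT tfix] _; exists t => //.
by move: tfix; rewrite afixJ -sub_cent1 => /subsetP tS; apply/subsetP=> g /tS.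
Qed.

Lemma central_mem (S : {group gT}) t : S \in 'Syl_2(G) -> t \in T -> S \subset 'C[t] -> t \in 'Z(S).
Proof.
rewrite inE => sylS tT St; have [SG _ _] := and3P sylS.
have tS: t \in 'C(S) by rewrite -sub_cent1.
rewrite inE tS andbT -cycle_subG.
have sylN: 2.-Sylow('N_G(S)) S.
  by apply: (pHall_subl _ (subsetIl _ _) sylS); rewrite subsetI SG normG.
rewrite (sub_normal_Hall sylN) ?normalSG //.
  by rewrite /pgroup -orderE order_T.
by rewrite cycle_subG inE (subsetP TG) //= (subsetP (cent_sub _)).
Qed.

Lemma Q_sub : C \subset G.
Proof. exact: subset_trans (subsetIl _ _) TG. Qed.

(* As [x ^ y \in x *: E], each [x] of [C] lies in the normal 2-subgroup [E <*> <[x]>]. *)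
Lemma Q_pgroup : 2.-group <<C>>.
Proof.
suffices Ccore: C \subset 'O_2(<<C>>).
  apply: (pgroupS _ (pcore_pgroup 2 <<C>>)).
  by rewrite gen_subG.
apply/subsetP=> x xC; have xT: x \in T by case/setIP: xC.
have xE: x \in 'C(E) by rewrite (subsetP _ x xC) // centsC.
pose H := (E <*> <[x]>)%G.
have DH: E * <[x]> = H by rewrite /= cent_joinEr // cycle_subG.
have H2: 2.-group H by rewrite -DH pgroupM E2 /pgroup -orderE order_T.
have xH: x \in H by rewrite /= mem_gen // inE cycle_id orbT.
have nH: H <| <<C>>.
  apply/andP; split; first by rewrite join_subG EQ cycle_subG mem_gen.
  rewrite gen_subG; apply/subsetP=> y yC; rewrite inE /= conjYg join_subG -cycleJ cycle_subG.
  have yE: y \in 'C(E) by rewrite (subsetP _ y yC) // centsC.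
  rewrite (normP (subsetP (cent_sub _) y yE)) joing_subl /=.
  have := CJ xC yC; rewrite mem_lcoset => xyE.
  by rewrite -[x ^ y](mulKVg x) groupM // mem_gen // inE xyE.
exact: (subsetP (pcore_max H2 nH)).
Qed.

(** [S] fixes [x0], so it normalises the 2-group [<<C>>], which therefore lies in the Sylow subgroup
    [S]. An involution central in [S] then centralises [C]. *)
Lemma centralizer_T (S : {group gT}) z : S \in 'Syl_2(G) -> S \subset 'C[x0] ->
  z \in 'Z(S) -> #[z] = 2 -> z \in T.
Proof.
rewrite inE => sylS Sx0 /setIP[zS zC] oz; have [SG S2 _] := and3P sylS.
apply: cent_C => //; first exact: (subsetP SG).
suffices QS: <<C>> \subset S.
  apply: (subsetP _ z zC); apply: centS; exact: subset_trans (subset_gen _) QS.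
have nQS: S \subset 'N(<<C>>).
  apply/subsetP=> s sS; rewrite inE -genJ gen_subG; apply: subset_trans (subset_gen _).
  apply/subsetP=> _ /imsetP[y /setIP[yT yx0] ->].
  rewrite inE TJ ?(subsetP SG) //=.
  have Ds: x0 ^ s = x0 by rewrite conjgE -(cent1P (subsetP Sx0 s sS)) mulKg.
  by rewrite -Ds cent1J memJ_conjg.
have sylN: 2.-Sylow('N_G(<<C>>)) S.
  by apply: (pHall_subl _ (subsetIl _ _) sylS); rewrite subsetI SG.
apply: (normal_sub_max_pgroup (Hall_max sylN) Q_pgroup).
by rewrite normalSG // gen_subG Q_sub.
Qed.

(** Every Sylow subgroup fixes an element of the odd set [T]. Conjugating this element to [x0] shows
    that central involutions lie in [T]; conversely the fixed element is central in the Sylow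
    subgroup, and [T] is one class. *)
Lemma central_involutionsE : central_involutions G = T.
Proof.
apply/setP=> z; rewrite inE; apply/idP/idP=> [/and3P[zG /eqP oz /existsP[S /andP[sylS zS]]]|zT].
  have [t tT St] := Sylow_fix sylS; have [g gG Dt] := T_trans tT.
  have sylS' : (S :^ g^-1)%G \in 'Syl_2(G) by move: sylS; rewrite !inE pHallJ ?groupV.
  have: z ^ g^-1 \in T.
    apply: centralizer_T sylS' _ _ _; rewrite ?orderJ //.
      by rewrite /= sub_conjg invgK -cent1J -Dt.
    by rewrite /= /center centJ -conjIg memJ_conjg.
  by move/TJ/(_ gG); rewrite conjgKV.
have [S sylS] := Sylow_exists 2 G; have sylS' : S \in 'Syl_2(G) by rewrite inE.
have [t tT St] := Sylow_fix sylS'.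
have tZ := central_mem sylS' tT St.
have [g gG Dz] := T_trans zT; have [h hG Dt] := T_trans tT.
have Dzt: z = t ^ (h^-1 * g) by rewrite conjgM Dt conjgK.
rewrite (subsetP TG) // order_T //=; apply/existsP; exists (S :^ (h^-1 * g))%G.
rewrite inE pHallJ ?groupM ?groupV // sylS /= Dzt.
by rewrite /center centJ -conjIg memJ_conjg.
Qed.
End CentralInvolutions.

(** * The Hall-Janko near octagon as a set of permutations *)

Definition pos_ord (i : 'I_100) : positive := Pos.of_succ_nat i.
Definition code (s : 'S_100) : seq positive := [seq pos_ord (s i) | i <- enum 'I_100].

Lemma pos_ord_inj : injective pos_ord.
Proof. by move=> i j /SuccNat2Pos.inj/val_inj. Qed.

Lemma dom100E : dom100 = [seq pos_ord i | i <- enum 'I_100].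
Proof.
rewrite (_ : dom100 = pos_seq 100); last by vm_cast_no_check (erefl dom100).
by rewrite /pos_seq -val_enum_ord -map_comp.
Qed.

Lemma get_trie_zip (I : eqType) (s : seq I) (f : I -> positive) (A : Type) (g : I -> A) x0 i :
  injective f -> i \in s -> get x0 (trie_of (zip (map f s) (map g s))) (f i) = g i.
Proof.
move=> f_inj; elim: s => //= j s IHs; rewrite inE get_add (inj_eq f_inj).
by case: eqP => [-> //|_] /= /IHs.
Qed.

Lemma get_code s i : get 1%positive (arr_trie (code s)) (pos_ord i) = pos_ord (s i).
Proof.
by rewrite /arr_trie dom100E (get_trie_zip (fun i => pos_ord (s i))) ?mem_enum //; apply: pos_ord_inj.
Qed.

Lemma code_mul s t : code (s * t)%g = acomp (code s) (code t).
Proof. by rewrite /acomp -map_comp; apply: eq_map => i /=; rewrite get_code permM. Qed.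

Lemma code1 : code 1%g = dom100.
Proof. by rewrite dom100E; apply: eq_map => i; rewrite perm1. Qed.

Lemma code_inj : injective code.
Proof.
move=> s t Dst; apply/permP=> i; apply: pos_ord_inj.
by rewrite -!get_code Dst.
Qed.

(** The cycles are replayed on natural numbers, where they evaluate. *)
Definition swap100 (h k x : nat) : nat := if x == h then k else if x == k then h else x.
Definition cycle_nat (c : seq nat) (x : nat) : nat :=
  foldl (fun x k => swap100 (head 0 c).-1 k.-1 x) x (behead c).
Definition cycles_nat (cs : seq (seq nat)) (x : nat) : nat := foldl (fun x c => cycle_nat c x) x cs.
Definition small_cycles (cs : seq (seq nat)) := all (all (fun k => k <= 100)) cs.

Lemma swap100P h k (x : 'I_100) : h < 100 -> k < 100 ->
  tperm (inord h) (inord k) x = swap100 h k x :> nat.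
Proof.
move=> h_lt k_lt; rewrite /swap100; case: tpermP => [->|->|/eqP xh /eqP xk]; rewrite ?inordK ?eqxx //.
  by case: eqP => // ->.
have neq j (j_lt : j < 100) : x != inord j -> (x == j :> nat) = false.
  by apply: contraNF => /eqP Dx; apply/eqP/val_inj; rewrite /= inordK.
by rewrite !neq.
Qed.

Lemma cycle_natP c (x : 'I_100) : all (fun k => k <= 100) c -> cycle100 c x = cycle_nat c x :> nat.
Proof.
have lt100 k : k <= 100 -> k.-1 < 100 by lia.
rewrite /cycle100 /cycle_nat; case: c => [|h c] /=; first by rewrite big_nil perm1.
case/andP=> /lt100 h_lt; elim: c x => [|k c IHc] x /=; first by rewrite big_nil perm1.
by case/andP=> /lt100 k_lt /IHc Dc; rewrite big_cons permM Dc swap100P.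
Qed.

Lemma cycles_natP cs (x : 'I_100) : small_cycles cs -> perm_of_cycles cs x = cycles_nat cs x :> nat.
Proof.
rewrite /perm_of_cycles /cycles_nat; elim: cs x => [|c cs IHcs] x /=; first by rewrite big_nil perm1.
by case/andP=> c_ok /IHcs Dcs; rewrite big_cons permM Dcs cycle_natP.
Qed.

Lemma code_cycles cs : small_cycles cs ->
  code (perm_of_cycles cs) = [seq Pos.of_succ_nat (cycles_nat cs i) | i <- iota 0 100].
Proof.
move=> cs_ok; rewrite -val_enum_ord -map_comp; apply: eq_map => i /=.
by rewrite /pos_ord cycles_natP.
Qed.

Lemma code_a : code J2_a = arr_a.
Proof. by rewrite /J2_a code_cycles //; vm_cast_no_check (erefl arr_a). Qed.

Lemma code_b : code J2_b = arr_b.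
Proof. by rewrite /J2_b code_cycles //; vm_cast_no_check (erefl arr_b). Qed.

Definition gperm (c : bool) : 'S_100 := if c then J2_b else J2_a.

Lemma invJ_a : (J2_a^-1 = J2_a)%g.
Proof.
apply/eqP; rewrite eq_invg_mul; apply/eqP/code_inj.
by rewrite code_mul code1 code_a; vm_cast_no_check (erefl dom100).
Qed.

Lemma invJ_b : (J2_b^-1 = J2_b * J2_b)%g.
Proof.
apply/eqP; rewrite eq_invg_mul; apply/eqP/code_inj.
by rewrite !code_mul code1 code_b; vm_cast_no_check (erefl dom100).
Qed.

Lemma code_conj c s : code (s ^ gperm c)%g = aconj c (code s).
Proof.
rewrite conjgE mulgA /aconj; case: c => /=; rewrite !code_mul ?invJ_a ?invJ_b ?code_mul ?code_a ?code_b.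
  by congr (acomp (acomp _ _) _); vm_cast_no_check (erefl arr_b').
by [].
Qed.

(** Permutations compose from left to right while the head of a word acts last, hence the reversed
    order. *)
Fixpoint wordJ (w : seq bool) : 'S_100 := if w is c :: w' then (wordJ w' * gperm c)%g else 1%g.

Lemma wordJ_cat v w : wordJ (v ++ w) = (wordJ w * wordJ v)%g.
Proof. by elim: v => [|c v IHv] /=; rewrite ?mulg1 // IHv mulgA. Qed.

Lemma gperm_J2 c : gperm c \in J2.
Proof. by rewrite mem_gen // !inE; case: c; rewrite eqxx ?orbT. Qed.

Lemma wordJ_J2 w : wordJ w \in J2.
Proof. by elim: w => [|c w IHw] /=; rewrite ?group1 // groupM ?gperm_J2. Qed.

Definition zJ : 'S_100 :=
  let g := (J2_a * J2_b * J2_a * (J2_b * J2_b))%g in ((g * g) * (g * g) * (g * g))%g.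

Lemma code_zJ : code zJ = arr_z.
Proof. by rewrite /zJ !code_mul code_a code_b; vm_cast_no_check (erefl arr_z). Qed.

Definition zu (u : positive) : 'S_100 := (zJ ^ wordJ (tw u))%g.

Definition arr_table : trie (seq positive) := Eval vm_compute in trie_of (zip pts hj_arr).
Definition arr_of (u : positive) : seq positive := get [::] arr_table u.

Lemma arr_of_check : (arr_of 1 == arr_z) && all (fun u => (aconj false (arr_of u) == arr_of (gen false u))
  && (aconj true (arr_of u) == arr_of (gen true u))) pts.
Proof. by vm_cast_no_check (erefl true). Qed.

Lemma arr_of_uniq : uniq [seq arr_of u | u <- pts].
Proof. by vm_cast_no_check (erefl true). Qed.

Lemma hj_triesE : hj_tries = [seq arr_trie (arr_of u) | u <- pts].
Proof. by vm_cast_no_check (erefl hj_tries). Qed.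

Lemma adj_check : all (fun p => adjs p.1 == adj_list p.2 p.1) (zip pts hj_tries).
Proof. by vm_cast_no_check (erefl true). Qed.

Lemma code_zJ_word w : code (zJ ^ wordJ w)%g = arr_of (wapp w 1).
Proof.
elim: w => [|c w IHw] /=.
  by rewrite conjg1 code_zJ; apply/esym/eqP; have /andP[] := arr_of_check.
rewrite conjgM code_conj IHw; have /andP[_ /allP/(_ _ (wapp_pts w pts1))] := arr_of_check.
by case: c => /andP[/eqP ? /eqP ?].
Qed.

Lemma code_zu u : u \in pts -> code (zu u) = arr_of u.
Proof. by move=> u_pts; rewrite /zu code_zJ_word tw1. Qed.

Lemma zJ_word w : (zJ ^ wordJ w)%g = zu (wapp w 1).
Proof. by apply: code_inj; rewrite code_zJ_word code_zu // wapp_pts ?pts1. Qed.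

Lemma zu1 : zu 1 = zJ. Proof. by rewrite /zu conjg1. Qed.

Lemma zu_word w u : u \in pts -> (zu u ^ wordJ w)%g = zu (wapp w u).
Proof. by move=> u_pts; rewrite {1}/zu -conjgM -wordJ_cat zJ_word wapp_cat tw1. Qed.

Lemma map_uniq_inj (I J : eqType) (f : I -> J) s : uniq (map f s) -> {in s &, injective f}.
Proof.
elim: s => //= x s IHs /andP[fx /IHs inj] y z; rewrite !inE => /predU1P[->|ys] /predU1P[->|zs] // Df.
- by move: fx; rewrite Df map_f.
- by move: fx; rewrite -Df map_f.
exact: inj.
Qed.

Lemma zu_inj : {in pts &, injective zu}.
Proof.
move=> u v u_pts v_pts Duv; have inj := map_uniq_inj arr_of_uniq; apply: inj => //.
by rewrite -!code_zu // Duv.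
Qed.

Lemma acommuteP s t : reflect (commute s t) (acommute (arr_trie (code s)) (arr_trie (code t))).
Proof.
rewrite /acommute dom100E all_map; apply: (iffP allP) => [com|com i _ /=].
  apply/permP=> i; rewrite !permM; apply: pos_ord_inj.
  by have /eqP := com i (mem_enum _ i); rewrite !get_code.
apply/eqP; rewrite !get_code; congr pos_ord.
by have /permP/(_ i) := com; rewrite !permM.
Qed.

Lemma adjsP u v : u \in pts -> v \in pts -> (v \in adjs u) = (u != v) && (zu u * zu v == zu v * zu u)%g.
Proof.
have zip_graph A (h : positive -> A) : zip pts (map h pts) = [seq (w, h w) | w <- pts].
  by rewrite -[X in zip X _]map_id zip_map.
move=> u_pts v_pts; have := adj_check; rewrite hj_triesE zip_graph all_map.
move=> /allP/(_ u u_pts)/eqP /= ->; rewrite /adj_list hj_triesE zip_graph filter_map -map_comp map_id.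
rewrite mem_filter /= v_pts andbT -[Pos.eqb v u]/(v == u) eq_sym; congr (_ && _).
by rewrite -!code_zu //; apply/acommuteP/eqP.
Qed.

Lemma adjs_word w u v : u \in pts -> v \in pts -> (wapp w v \in adjs (wapp w u)) = (v \in adjs u).
Proof.
move=> u_pts v_pts; rewrite !adjsP ?wapp_pts // -!zu_word // -!conjMg (inj_eq (conjg_inj _)).
congr (~~ _ && _); apply/eqP/eqP=> [Duv|-> //].
by rewrite -(winvK w u_pts) Duv winvK.
Qed.

(* The Hall-Janko graph: the orbit of length 36 * 100 of J_2 on pairs. *)
Fixpoint close_pairs (ta tb : trie positive) (n : nat) (queue : seq (positive * positive)) (t : trie (trie unit)) :=
  if n is n'.+1 then
    if queue is (x, y) :: q then
      let nx := get (PositiveMap.empty unit) t x in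
      if PositiveMap.mem y nx then close_pairs ta tb n' q t
      else close_pairs ta tb n' ((get 1%positive ta x, get 1%positive ta y)
             :: (get 1%positive tb x, get 1%positive tb y) :: q)
             (PositiveMap.add x (PositiveMap.add y tt nx) t)
    else t
  else t.
Definition hj_graph : trie (trie unit) := Eval vm_compute in
  close_pairs (arr_trie arr_a) (arr_trie arr_b) (100 * 100) [:: (1, 5)%positive] (PositiveMap.empty _).
Definition edge (x y : positive) : bool := PositiveMap.mem y (get (PositiveMap.empty unit) hj_graph x).
Definition arr_app (t : trie positive) (x : positive) : positive := get 1%positive t x.

Lemma edge_check : let a := arr_trie arr_a in let b := arr_trie arr_b in
  all (fun x => all (fun y => (edge (arr_app a x) (arr_app a y) == edge x y)
     && (edge (arr_app b x) (arr_app b y) == edge x y)) dom100) dom100.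
Proof. by vm_cast_no_check (erefl true). Qed.

(* [zJ] and four of its neighbours generate an extraspecial group of order 32. *)
Definition Qgens : seq positive := [:: 1; 182; 203; 242; 259]%positive.
Definition Qarrs : seq (seq positive) :=
  foldr (fun u acc => acc ++ [seq acomp l (arr_of u) | l <- acc]) [:: dom100] Qgens.
Definition Qtries : seq (trie positive) := map arr_trie Qarrs.

Definition extend (qs : seq (trie positive)) (r x : positive) : seq (positive * positive) :=
  [seq (arr_app q r, arr_app q x) | q <- qs].
Definition fits (r x : positive) (pm : seq (positive * positive)) : bool :=
  all (fun p => ((p.1 == r) == (p.2 == x)) && (edge p.1 r == edge p.2 x)) pm.
(** Backtracking over the graph automorphisms that commute with all of [qs]: the image of [r]
    determines the images on its orbit. [fits] tests injectivity and edges at [r] against the part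
    already built and against the new orbit. *)
Fixpoint search (qs : seq (trie positive)) (reps : seq positive) (pm : seq (positive * positive)) :
    seq (seq (positive * positive)) :=
  if reps is r :: reps' then
    flatten [seq (if fits r x pm then let new := extend qs r x in
       if fits r x new then search qs reps' (new ++ pm) else [::] else [::]) | x <- dom100]
  else [:: pm].
Lemma search_cons qs r reps pm : search qs (r :: reps) pm =
  flatten [seq (if fits r x pm then let new := extend qs r x in
       if fits r x new then search qs reps (new ++ pm) else [::] else [::]) | x <- dom100].
Proof. by []. Qed.
Definition Qreps : seq positive := [:: 2; 3; 4; 8; 11; 1; 5; 6; 21; 22; 33; 34; 42; 62; 64]%positive.

Lemma search_check : let qs := Qtries in let z := arr_trie arr_z in
  all (fun pm => all (fun x => x \in map fst pm) dom100 &&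
     (all (fun p => p.2 == p.1) pm || all (fun p => p.2 == arr_app z p.1) pm)) (search qs Qreps [::]).
Proof. by vm_cast_no_check (erefl true). Qed.

Lemma edge_J g i j : g \in J2 -> edge (pos_ord (g i)) (pos_ord (g j)) = edge (pos_ord i) (pos_ord j).
Proof.
pose G := [set s : 'S_100 | [forall i, forall j, edge (pos_ord (s i)) (pos_ord (s j)) == edge (pos_ord i) (pos_ord j)]].
have inG (s : 'S_100) : reflect (forall i j, edge (pos_ord (s i)) (pos_ord (s j)) = edge (pos_ord i) (pos_ord j)) (s \in G).
  rewrite inE; apply: (iffP forallP) => sG x; first by move=> y; have /forallP/(_ y)/eqP := sG x.
  by apply/forallP=> y; rewrite sG.
have G_group: group_set G.
  apply/group_setP; split=> [|s t /inG sG /inG tG]; first by apply/inG=> x y; rewrite !perm1.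
  by apply/inG=> x y; rewrite !permM tG sG.
suffices: J2 \subset Group G_group by move=> /subsetP sub gJ; exact: (elimT (inG g) (sub g gJ)).
have mem100 x : pos_ord x \in dom100 by rewrite dom100E map_f ?mem_enum.
have check x y := allP (allP edge_check _ (mem100 x)) _ (mem100 y).
rewrite gen_subG; apply/subsetP=> s /set2P[]->; apply: (introT (inG _)) => x y.
  by have /andP[/eqP <- _] := check x y; rewrite /arr_app -code_a !get_code.
by have /andP[_ /eqP <-] := check x y; rewrite /arr_app -code_b !get_code.
Qed.

Section Search.
Variables (g : positive -> positive).
Hypothesis g_dom : forall x, x \in dom100 -> g x \in dom100.
Hypothesis g_inj : {in dom100 &, injective g}.
Hypothesis g_edge : forall x y, x \in dom100 -> y \in dom100 -> edge (g x) (g y) = edge x y.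

Definition graph_of (pm : seq (positive * positive)) :=
  forall p, p \in pm -> p.1 \in dom100 /\ p.2 = g p.1.

Lemma fits_graph r pm : r \in dom100 -> graph_of pm -> fits r (g r) pm.
Proof.
move=> r100 pm_g; apply/allP=> [[x y] /pm_g[/= x100 ->]].
by rewrite g_edge // (inj_in_eq g_inj) // !eqxx.
Qed.

Lemma searchP qs reps pm : (forall q, List.In q qs -> forall x, x \in dom100 ->
      arr_app q x \in dom100 /\ arr_app q (g x) = g (arr_app q x)) ->
    {subset reps <= dom100} -> graph_of pm ->
  exists2 pm', pm' \in search qs reps pm & graph_of pm'.
Proof.
move=> qsP; elim: reps pm => [|r reps IHr] pm reps100 pm_g; first by exists pm; rewrite ?inE.
have r100 : r \in dom100 by apply: reps100; rewrite inE eqxx.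
have new_g : graph_of (extend qs r (g r)).
  move=> p; rewrite /extend; elim: qs qsP {IHr} => //= q qs IHq qsP; rewrite inE => /predU1P[->|].
    by have [|? ->] := qsP q _ r r100; [left | split].
  by apply: IHq => q' q'_in; apply: qsP; right.
have [||pm' pm'_in pm'_g] := IHr (extend qs r (g r) ++ pm).
- by move=> x x_reps; apply: reps100; rewrite inE x_reps orbT.
- by move=> p; rewrite mem_cat => /orP[/new_g|/pm_g].
exists pm' => //; rewrite search_cons; apply/flattenP; exists (search qs reps (extend qs r (g r) ++ pm)) => //.
apply/mapP; exists (g r); first exact: g_dom.
cbv zeta; rewrite (fits_graph r100 pm_g) (fits_graph r100 new_g).
by [].
Qed.
End Search.

Lemma QarrsP g l : (forall u, u \in Qgens -> commute g (zu u)) -> l \in Qarrs ->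
  exists2 s, l = code s & commute g s.
Proof.
rewrite /Qarrs; have : {subset Qgens <= pts} by apply/allP; vm_cast_no_check (erefl true).
elim: Qgens l => [|u us IHu] l us_pts us_com /=.
  by rewrite inE => /eqP->; exists 1%g; [rewrite code1 | apply: commute1].
have {}IHu l' := IHu l' (fun v v_us => us_pts v (mem_behead (s := u :: us) v_us))
  (fun v v_us => us_com v (mem_behead (s := u :: us) v_us)).
rewrite mem_cat => /orP[/IHu //|/mapP[l' /IHu[s -> s_com] ->]].
have u_us : u \in u :: us by rewrite inE eqxx.
exists (s * zu u)%g; first by rewrite code_mul (code_zu (us_pts u u_us)).
by apply: commuteM => //; apply: us_com.
Qed.

Lemma In_map (A B : Type) (f : A -> B) s y : List.In y (map f s) -> exists2 x, y = f x & List.In x s.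
Proof. by elim: s => //= x s IHs [<-|/IHs[x' ? ?]]; [exists x; [|left] | exists x'; [|right]]. Qed.

Lemma In_mem (T : eqType) (s : seq T) x : List.In x s -> x \in s.
Proof. by elim: s => //= y s IHs [->|/IHs]; rewrite inE ?eqxx // => ->; rewrite orbT. Qed.

Lemma Qgens_adj : {subset Qgens <= 1%positive :: adjs 1}.
Proof. by apply/allP; vm_cast_no_check (erefl true). Qed.

Lemma search_result f : (forall x, x \in dom100 -> f x \in dom100) -> {in dom100 &, injective f} ->
    (forall x y, x \in dom100 -> y \in dom100 -> edge (f x) (f y) = edge x y) ->
    (forall q, List.In q Qtries -> forall x, x \in dom100 ->
       arr_app q x \in dom100 /\ arr_app q (f x) = f (arr_app q x)) ->
  exists2 pm, graph_of f pm & all (fun x => x \in map fst pm) dom100 &&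
     (all (fun p => p.2 == p.1) pm || all (fun p => p.2 == arr_app (arr_trie arr_z) p.1) pm).
Proof.
move=> f_dom f_inj f_edge f_com.
have reps100 : {subset Qreps <= dom100} by apply/allP; vm_cast_no_check (erefl true).
have f0 : graph_of f [::] by [].
have [pm pm_in pm_f] := searchP f_dom f_inj f_edge f_com reps100 f0.
exists pm; first exact: pm_f.
exact: (allP search_check pm pm_in).
Qed.

(** The hypothesis [cent_C] for J_2. Such a [g] preserves the Hall-Janko graph and commutes with the
    extraspecial group, so its graph survives the search, which leaves only the identity and
    [zJ]. *)
Lemma search_J2 g : g \in J2 -> (forall u, u \in 1%positive :: adjs 1 -> commute g (zu u)) -> g \in [set 1%g; zJ].
Proof.
move=> gJ g_com; have mem100 i : pos_ord i \in dom100 by rewrite dom100E map_f ?mem_enum.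
have ord100 x : x \in dom100 -> exists i, x = pos_ord i by rewrite dom100E => /mapP[i _ ->]; exists i.
pose f x := get 1%positive (arr_trie (code g)) x.
have fE i : f (pos_ord i) = pos_ord (g i) by rewrite /f get_code.
have f_dom x : x \in dom100 -> f x \in dom100 by move=> /ord100[i ->]; rewrite fE.
have f_inj : {in dom100 &, injective f}.
  by move=> _ _ /ord100[i ->] /ord100[j ->]; rewrite !fE => /pos_ord_inj/perm_inj->.
have f_edge x y : x \in dom100 -> y \in dom100 -> edge (f x) (f y) = edge x y.
  by move=> /ord100[i ->] /ord100[j ->]; rewrite !fE edge_J.
have f_com q : List.In q Qtries -> forall x, x \in dom100 ->
    arr_app q x \in dom100 /\ arr_app q (f x) = f (arr_app q x).
  move=> q_in; have [l Dq l_in'] := In_map q_in; have l_in := In_mem l_in'; rewrite Dq => _ /ord100[i ->].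
  have [s -> s_com] := QarrsP (fun u u_in => g_com u (Qgens_adj u_in)) l_in.
  by rewrite /arr_app get_code !fE get_code -!permM s_com.
have [pm pm_f /andP[/allP pm100 pm_z]] := search_result f_dom f_inj f_edge f_com.
have cover i : exists2 p, p \in pm & p.1 = pos_ord i.
  by have /mapP[p p_pm ->] := pm100 _ (mem100 i); exists p.
rewrite !inE; case/orP: pm_z => /allP pm_z; apply/orP; [left|right]; apply/eqP/permP=> i;
  have [p p_pm Dp] := cover i; apply: pos_ord_inj; have [_ Dp2] := pm_f _ p_pm; have /eqP := pm_z _ p_pm;
  rewrite Dp2 Dp fE => ->; first by rewrite perm1.
by rewrite /arr_app -code_zJ get_code.
Qed.

Definition J2_class : {set 'S_100} := [set s in map zu pts].

Lemma mem_class s : reflect (exists2 u, u \in pts & s = zu u) (s \in J2_class).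
Proof. by rewrite inE; apply: mapP. Qed.

Lemma zu_class u : u \in pts -> zu u \in J2_class.
Proof. by move=> u_pts; apply/mem_class; exists u. Qed.

Lemma card_set_seq (T : finType) (s : seq T) : uniq s -> #|[set x in s]| = size s.
Proof. by move=> s_uniq; rewrite cardsE (card_uniqP s_uniq). Qed.

Lemma card_class : #|J2_class| = 315.
Proof.
have zu_uniq : uniq (map zu pts).
  by rewrite map_inj_in_uniq; [vm_cast_no_check (erefl true) | apply: zu_inj].
have Dsize : size (map zu pts) = 315 by rewrite size_map; vm_cast_no_check (erefl 315).
exact: etrans (card_set_seq zu_uniq) Dsize.
Qed.

Lemma classJ s g : s \in J2_class -> g \in J2 -> (s ^ g \in J2_class)%g.
Proof.
suffices /subsetP sub : (J2 \subset 'N(J2_class))%g.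
  by move=> sT /sub/normP <-; rewrite memJ_conjg.
rewrite gen_subG; apply/subsetP=> g0 g0_gen.
have [c ->] : exists c, g0 = gperm c by case/set2P: g0_gen => ->; [exists false | exists true].
rewrite inE; apply/subsetP=> _ /imsetP[s' /mem_class[u u_pts ->] ->].
apply/mem_class; exists (wapp [:: c] u); first exact: (wapp_pts [:: c]).
by rewrite -zu_word //= mul1g.
Qed.

Lemma zJ_sqr : (zJ * zJ = 1)%g.
Proof. by apply: code_inj; rewrite code_mul code1 code_zJ; vm_cast_no_check (erefl dom100). Qed.

Lemma zJ_order : #[zJ]%g = 2.
Proof.
apply: nt_prime_order; [by [] | by rewrite expgS expg1 zJ_sqr |]; apply/eqP => z1; move: (congr1 code z1); rewrite code1 code_zJ.
by apply/eqP; vm_cast_no_check (erefl true).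
Qed.

Lemma zu_sqr u : (zu u * zu u = 1)%g.
Proof. by rewrite /zu -conjMg zJ_sqr conj1g. Qed.

Definition nbrs1 : seq positive := 1%positive :: adjs 1.
(** The hypothesis [CJ] for J_2: commutators inside [C] lie in {1, z}. *)
Lemma nbrs1_conj_check : let z := arr_trie arr_z in
  all (fun u => all (fun v => let l := acomp (acomp (arr_of v) (arr_of u)) (arr_of v) in
    (l == arr_of u) || (l == acomp (arr_of u) arr_z)) nbrs1) nbrs1.
Proof. by vm_cast_no_check (erefl true). Qed.

Lemma nbrs1_pts u : u \in nbrs1 -> u \in pts.
Proof. by rewrite inE => /predU1P[->|/adj1_pts //]; apply: pts1. Qed.

Lemma mem_class_cent s : reflect (exists2 u, u \in nbrs1 & s = zu u) (s \in J2_class :&: 'C[zJ])%g.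
Proof.
apply: (iffP setIP) => [[/mem_class[u u_pts ->] /cent1P com]|[u u_in ->]].
  exists u => //; rewrite inE; case: eqP => //= /eqP u_neq1.
  by rewrite (adjsP pts1 u_pts) zu1 eq_sym u_neq1; apply/eqP.
split; first exact/zu_class/nbrs1_pts.
apply/cent1P; move: u_in; rewrite inE => /predU1P[->|u_adj]; first by rewrite zu1.
by move: (u_adj); rewrite (adjsP pts1 (adj1_pts u_adj)) zu1 => /andP[_ /eqP].
Qed.

Lemma central_J2 : central_involutions J2 = J2_class.
Proof.
have zJ_class : zJ \in J2_class by rewrite -zu1 zu_class ?pts1.
apply: (@central_involutionsE _ J2 <[zJ]>%G _ zJ) => //=.
- apply/subsetP=> _ /mem_class[u _ ->]; rewrite memJ_norm //; last exact/(subsetP (normG _))/wordJ_J2.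
  by rewrite /zJ; repeat apply: groupM; solve [exact: (gperm_J2 false) | exact: (gperm_J2 true)].
- exact: classJ.
- by move=> _ /mem_class[u _ ->]; exists (wordJ (tw u)); first exact: wordJ_J2.
- by rewrite card_class.
- exact: zJ_order.
- by rewrite /pgroup -orderE zJ_order.
- by rewrite cycle_subG; apply/centP=> s /setIP[_ /cent1P].
- by rewrite cycle_subG mem_gen // inE zJ_class cent1id.
- move=> _ _ /mem_class_cent[u u_in ->] /mem_class_cent[v v_in ->].
  have vV : ((zu v)^-1 = zu v)%g by apply/eqP; rewrite eq_invg_mul zu_sqr.
  rewrite mem_lcoset conjgE vV; apply/cycleP.
  have /orP[/eqP|/eqP] := allP (allP nbrs1_conj_check u u_in) v v_in.
    rewrite -!code_zu ?nbrs1_pts // -!code_mul => /code_inj Duv; exists 0.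
    by rewrite (mulgA (zu v)) Duv mulVg.
  rewrite -!code_zu ?nbrs1_pts // -code_zJ -!code_mul => /code_inj Duv; exists 1.
  by rewrite (mulgA (zu v)) Duv mulKg.
move=> z zJ2 /centP zC oz.
have com u : u \in 1%positive :: adjs 1 -> commute z (zu u).
  by move=> u_in; apply: zC; apply/mem_class_cent; exists u.
have [Dz|->] := set2P (search_J2 zJ2 com); last exact: zJ_class.
by move: oz; rewrite Dz order1.
Qed.

Lemma hj_proof u : u \in pts -> zu u \in central_involutions J2.
Proof. by rewrite central_J2; apply: zu_class. Qed.

Definition hjp (u : positive) : points HJ :=
  insubd (exist _ (zu 1) (hj_proof pts1) : {x | x \in central_involutions J2}) (zu u).

Lemma val_hjp u : u \in pts -> sval (hjp u) = zu u.
Proof. by move=> u_pts; rewrite -/(val (hjp u)) val_insubd hj_proof. Qed.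

Lemma hjp_onto (x : points HJ) : exists2 u, u \in pts & x = hjp u.
Proof.
case: x => s s_in; have := s_in; rewrite {1}central_J2 => /mem_class[u u_pts Ds]; exists u => //.
by apply: val_inj; rewrite /= -/(sval (hjp u)) val_hjp.
Qed.

Lemma hj_collinear u v : u \in pts -> v \in pts -> collinear (hjp u) (hjp v) <-> v \in adjs u.
Proof.
move=> u_pts v_pts; rewrite adjsP //; split=> [[/eqP uv [[l l_line] /=]]|/andP[uv /eqP com]].
  rewrite !val_hjp //; case/imset2P: (l_line) => x y _; rewrite inE => /and4P[_ _ /eqP com _] ->.
  have comxy : {in [set x; y; (x * y)%g] &, commutative mulg}.
    have comxxy : commute x (x * y)%g by apply: commuteM.
    have comyxy : commute y (x * y)%g by apply: commuteM.
    by move=> s t; rewrite !inE -!orbA => /or3P[]/eqP-> /or3P[]/eqP->.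
  case=> u_in v_in; rewrite (comxy _ _ u_in v_in) eqxx andbT.
  by apply: contraNneq uv => ->.
split=> [Duv|]; first by move: uv; rewrite (zu_inj u_pts v_pts) ?eqxx // -!val_hjp // Duv.
have l_line : [set zu u; zu v; (zu u * zu v)%g] \in involution_lines J2 xpredT.
  apply/imset2P; exists (zu u) (zu v) => //; first exact: hj_proof.
  rewrite inE hj_proof // com eqxx !andbT /=.
  by apply: contraNneq uv => /(zu_inj u_pts v_pts)->.
exists (exist (fun l => l \in involution_lines J2 xpredT) _ l_line : lines HJ).
by rewrite /= !val_hjp // !inE !eqxx ?orbT.
Qed.

Lemma adj_lev_check : all (fun u => all (fun v => (v \in pts) && (lev u <= (lev v).+1)) (adjs u) &&
  ((lev u == 0) || has (fun v => lev u == (lev v).+1) (adjs u)) &&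
  ((lev u == 0) ==> (u == 1%positive))) pts.
Proof. by vm_cast_no_check (erefl true). Qed.

Lemma adjs_pts u v : u \in pts -> v \in adjs u -> v \in pts.
Proof. by move=> /(allP adj_lev_check)/andP[/andP[/allP all_v _] _] /all_v/andP[]. Qed.

(** An edge lowers [lev] by at most 1, and each point with [lev] nonzero has a neighbour where it is
    smaller by 1. So the tabulated [lev] is the distance from 1. *)
Lemma hj_walk_lev n w u : u \in pts -> walk n (hjp (wapp w u)) (hjp (wapp w 1)) -> lev u <= n.
Proof.
elim: n u => [|n IHn] u u_pts /=.
  move/(congr1 sval); rewrite !val_hjp ?wapp_pts ?pts1 // => /zu_inj Du.
  by rewrite -(winvK w u_pts) Du ?wapp_pts ?pts1 // winvK ?pts1.
case=> x [] /[swap]; have [v' v'_pts ->] := hjp_onto x; rewrite -(wappK w v'_pts).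
have v_pts := wapp_pts (winv w) v'_pts; move: (wapp _ v') v_pts => v v_pts {v' v'_pts x} wk.
rewrite hj_collinear ?wapp_pts // adjs_word // => uv; apply: leq_trans (_ : (lev v).+1 <= _).
  by have /andP[/andP[/allP/(_ v uv)/andP[]]] := allP adj_lev_check u u_pts.
by rewrite ltnS IHn.
Qed.

Lemma hj_lev_walk n w u : u \in pts -> lev u = n -> walk n (hjp (wapp w u)) (hjp (wapp w 1)).
Proof.
elim: n u => [|n IHn] u u_pts Du /=; have /andP[/andP[_ has_v] u1] := allP adj_lev_check u u_pts.
  by move: u1; rewrite Du => /eqP->.
move: has_v; rewrite Du /= => /hasP[v uv /eqP[Dv]]; have v_pts := adjs_pts u_pts uv.
exists (hjp (wapp w v)); split; last exact: IHn.
by rewrite hj_collinear ?wapp_pts // adjs_word.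
Qed.

Lemma hj_dist w u : u \in pts -> dist (hjp (wapp w u)) (hjp (wapp w 1)) (lev u).
Proof. by move=> u_pts; split=> [|m]; [apply: hj_lev_walk | apply: hj_walk_lev]. Qed.

(** * Octonions over the field of four elements *)

(* The field with four elements [0, 1, w, w + 1]. *)
Inductive k4 := K0 | K1 | K2 | K3.

Definition nat_of_k4 (x : k4) : nat := match x with K0 => 0 | K1 => 1 | K2 => 2 | K3 => 3 end.
Definition k4_of_nat (n : nat) : k4 := match n with 0 => K0 | 1 => K1 | 2 => K2 | _ => K3 end.
Lemma nat_of_k4K : cancel nat_of_k4 k4_of_nat. Proof. by case. Qed.
HB.instance Definition _ := Choice.copy k4 (can_type nat_of_k4K).

Definition addk (x y : k4) : k4 :=
  match x, y with
  | K0, _ => y | _, K0 => x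
  | K1, K1 | K2, K2 | K3, K3 => K0
  | K1, K2 | K2, K1 => K3
  | K1, K3 | K3, K1 => K2
  | K2, K3 | K3, K2 => K1
  end.
Definition mulk (x y : k4) : k4 :=
  match x, y with
  | K0, _ | _, K0 => K0
  | K1, _ => y | _, K1 => x
  | K2, K2 => K3 | K3, K3 => K2
  | K2, K3 | K3, K2 => K1
  end.
Definition sqk (x : k4) : k4 := mulk x x.

Lemma addkA : associative addk. Proof. by do 3!case. Qed.
Lemma addkC : commutative addk. Proof. by do 2!case. Qed.
Lemma add0k : left_id K0 addk. Proof. by case. Qed.
Lemma addkk : left_inverse K0 id addk. Proof. by case. Qed.
Lemma mulkA : associative mulk. Proof. by do 3!case. Qed.
Lemma mulkC : commutative mulk. Proof. by do 2!case. Qed.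
Lemma mul1k : left_id K1 mulk. Proof. by case. Qed.
Lemma mulkDl : left_distributive mulk addk. Proof. by do 3!case. Qed.
HB.instance Definition _ := GRing.isZmodule.Build k4 addkA addkC add0k addkk.
HB.instance Definition _ := GRing.Zmodule_isComNzRing.Build k4 mulkA mulkC mul1k mulkDl isT.

Arguments addk : simpl never.
Arguments mulk : simpl never.

Lemma sqk_add x y : sqk (addk x y) = addk (sqk x) (sqk y). Proof. by case: x y => [] []. Qed.
Lemma sqk_mul x y : sqk (mulk x y) = mulk (sqk x) (sqk y). Proof. by case: x y => [] []. Qed.
Lemma sqkK : involutive sqk. Proof. by case. Qed.

(* Vectors of length 8: the entry (a, u, v, b) of the octonion algebra is the
   sequence a, u_0, u_1, u_2, v_0, v_1, v_2, b; signs disappear over F_4. *)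
Notation vec := (seq k4).
Definition V8 (v : vec) : bool := size v == 8.
Fixpoint vadd (x y : vec) : vec :=
  if x is a :: x' then if y is b :: y' then addk a b :: vadd x' y' else [::] else [::].
Definition scale (c : k4) (x : vec) : vec := map (mulk c) x.
Definition vzero : vec := nseq 8 K0.
Definition basis : seq vec := [seq [seq (if i == j then K1 else K0) | j <- iota 0 8] | i <- iota 0 8].
Fixpoint app (M : seq vec) (v : vec) : vec :=
  if v is c :: v' then if M is r :: M' then vadd (scale c r) (app M' v') else vzero else vzero.

Definition mulc (x y : vec) : vec :=
  if x is [:: a; u0; u1; u2; v0; v1; v2; b] then
    if y is [:: c; p0; p1; p2; q0; q1; q2; d] then
      let s x y z := addk x (addk y z) in
      [:: addk (mulk a c) (s (mulk u0 q0) (mulk u1 q1) (mulk u2 q2));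
          s (mulk a p0) (mulk d u0) (addk (mulk v1 q2) (mulk v2 q1));
          s (mulk a p1) (mulk d u1) (addk (mulk v2 q0) (mulk v0 q2));
          s (mulk a p2) (mulk d u2) (addk (mulk v0 q1) (mulk v1 q0));
          s (mulk c v0) (mulk b q0) (addk (mulk u1 p2) (mulk u2 p1));
          s (mulk c v1) (mulk b q1) (addk (mulk u2 p0) (mulk u0 p2));
          s (mulk c v2) (mulk b q2) (addk (mulk u0 p1) (mulk u1 p0));
          addk (mulk b d) (s (mulk v0 p0) (mulk v1 p1) (mulk v2 p2))]
    else [::] else [::].
(** The polar form of the norm a b - u . v; [trk] is the trace. *)
Definition form (x y : vec) : k4 :=
  if x is [:: a; u0; u1; u2; v0; v1; v2; b] then
    if y is [:: c; p0; p1; p2; q0; q1; q2; d] then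
      addk (addk (addk (mulk a d) (mulk b c)) (addk (mulk u0 q0) (mulk v0 p0)))
        (addk (addk (mulk u1 q1) (mulk v1 p1)) (addk (mulk u2 q2) (mulk v2 p2)))
    else K0 else K0.
Definition trk (x : vec) : k4 := addk (nth K0 x 0) (nth K0 x 7).
Definition vone : vec := [:: K1; K0; K0; K0; K0; K0; K0; K1].

Lemma V8P v : V8 v -> exists a u0 u1 u2 v0 v1 v2 b, v = [:: a; u0; u1; u2; v0; v1; v2; b].
Proof. by move: v => [|a [|u0 [|u1 [|u2 [|v0 [|v1 [|v2 [|b [|]]]]]]]]] // _; do 8!eexists. Qed.

Ltac vdest x := let H := fresh in
  move=> /V8P[? [? [? [? [? [? [? [? H]]]]]]]]; subst x.
Ltac kring := rewrite /= -?[K0]/(0 : k4)%R -?[K1]/(1 : k4)%R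
    -?[addk]/(@GRing.add k4) -?[mulk]/(@GRing.mul k4);
  repeat match goal with |- cons _ _ = cons _ _ => congr cons end; try ring.

Lemma mulc_V8 x y : V8 x -> V8 y -> V8 (mulc x y). Proof. by vdest x; vdest y. Qed.
Lemma vadd_V8 x y : V8 x -> V8 y -> V8 (vadd x y). Proof. by vdest x; vdest y. Qed.
Lemma scale_V8 c x : V8 x -> V8 (scale c x). Proof. by vdest x. Qed.
Lemma mulcDl x y z : V8 x -> V8 y -> V8 z -> mulc (vadd x y) z = vadd (mulc x z) (mulc y z).
Proof. by vdest x; vdest y; vdest z; kring. Qed.
Lemma mulcDr x y z : V8 x -> V8 y -> V8 z -> mulc x (vadd y z) = vadd (mulc x y) (mulc x z).
Proof. by vdest x; vdest y; vdest z; kring. Qed.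
Lemma mulcZl c x y : V8 x -> V8 y -> mulc (scale c x) y = scale c (mulc x y).
Proof. by vdest x; vdest y; kring. Qed.
Lemma mulcZr c x y : V8 x -> V8 y -> mulc x (scale c y) = scale c (mulc x y).
Proof. by vdest x; vdest y; kring. Qed.
Lemma vaddC x y : V8 x -> V8 y -> vadd x y = vadd y x.
Proof. by vdest x; vdest y; kring. Qed.
Lemma vaddA x y z : V8 x -> V8 y -> V8 z -> vadd x (vadd y z) = vadd (vadd x y) z.
Proof. by vdest x; vdest y; vdest z; kring. Qed.
Lemma vaddx x : V8 x -> vadd x x = vzero.
Proof. by vdest x; rewrite /= !addkk. Qed.
Lemma vadd0 x : V8 x -> vadd x vzero = x.
Proof. by vdest x; kring. Qed.
Lemma scaleD c x y : V8 x -> V8 y -> scale c (vadd x y) = vadd (scale c x) (scale c y).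
Proof. by vdest x; vdest y; kring. Qed.
Lemma scaleDl c d x : V8 x -> scale (addk c d) x = vadd (scale c x) (scale d x).
Proof. by vdest x; kring. Qed.
Lemma scaleA c d x : V8 x -> scale c (scale d x) = scale (mulk c d) x.
Proof. by vdest x; kring. Qed.
Lemma scale0 x : V8 x -> scale K0 x = vzero. Proof. by vdest x. Qed.
Lemma scale1 x : V8 x -> scale K1 x = x. Proof. by vdest x; kring. Qed.
Lemma formDl x y z : V8 x -> V8 y -> V8 z -> form (vadd x y) z = addk (form x z) (form y z).
Proof. by vdest x; vdest y; vdest z; kring. Qed.
Lemma formZl c x y : V8 x -> V8 y -> form (scale c x) y = mulk c (form x y).
Proof. by vdest x; vdest y; kring. Qed.
Lemma formC x y : V8 x -> V8 y -> form x y = form y x.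
Proof. by vdest x; vdest y; kring. Qed.

Definition linear_map (F : vec -> vec) : Prop :=
  [/\ forall x, V8 x -> V8 (F x),
      forall x y, V8 x -> V8 y -> F (vadd x y) = vadd (F x) (F y)
    & forall c x, V8 x -> F (scale c x) = scale c (F x)].

Lemma basis_V8 v : v \in basis -> V8 v.
Proof. by have /allP/(_ v) : all V8 basis by []. Qed.

Lemma app_basis v : V8 v -> v = app basis v.
Proof. by vdest v; kring. Qed.

Lemma app_linear F M v : linear_map F -> all V8 M -> size M = size v ->
  F (app M v) = app (map F M) v /\ V8 (app M v).
Proof.
case=> F8 FD FZ; elim: v M => [|c v IHv] [|r M] //=.
  have z8 : V8 vzero by [].
  by move=> _ _; split=> //; rewrite -[X in F X](scale0 z8) FZ // scale0 ?F8.
case/andP=> r8 M8 [/(IHv _ M8)[FM Mv8]].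
by rewrite FD ?FZ ?scale_V8 // FM vadd_V8 ?scale_V8.
Qed.

Lemma linear_ext F G : linear_map F -> linear_map G -> {in basis, F =1 G} -> forall v, V8 v -> F v = G v.
Proof.
move=> Flin Glin FG v v8; rewrite (app_basis v8).
have sz : size basis = size v by rewrite (eqP v8).
have b8 : all V8 basis by [].
have [-> _] := app_linear Flin b8 sz; have [-> _] := app_linear Glin b8 sz.
by rewrite (eq_in_map F G basis).1.
Qed.

Definition bilinear_map (F : vec -> vec -> vec) : Prop :=
  (forall x, V8 x -> linear_map (F x)) /\ (forall y, V8 y -> linear_map (F^~ y)).

Lemma bilinear_ext F G : bilinear_map F -> bilinear_map G ->
  {in basis &, F =2 G} -> forall x y, V8 x -> V8 y -> F x y = G x y.
Proof.
move=> [Fr Fl] [Gr Gl] FG x y x8 y8.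
apply: (linear_ext (Fl _ y8) (Gl _ y8)) => // e eb; have e8 := basis_V8 eb.
by apply: (linear_ext (Fr _ e8) (Gr _ e8)) => // e' e'b; apply: FG.
Qed.

Lemma vaddACA a b c d : V8 a -> V8 b -> V8 c -> V8 d ->
  vadd (vadd a b) (vadd c d) = vadd (vadd a c) (vadd b d).
Proof. by vdest a; vdest b; vdest c; vdest d; kring. Qed.

Lemma scaleC a b x : V8 x -> scale a (scale b x) = scale b (scale a x).
Proof. by move=> x8; rewrite !scaleA // mulkC. Qed.

Lemma app_V8 M v : all V8 M -> size v = size M -> V8 (app M v).
Proof.
elim: M v => [|r M IHM] [|c v] //= /andP[r8 M8] [sz].
by rewrite vadd_V8 ?scale_V8 ?IHM.
Qed.

Lemma linear_app M : all V8 M -> size M = 8 -> linear_map (app M).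
Proof.
have z8 : V8 vzero by [].
move=> M8 sz; have size8 x : V8 x -> size x = size M by rewrite sz => /eqP.
split=> [x /size8 xM|x y /size8 xM /size8 yM|c x /size8 xM]; first exact: app_V8.
  clear sz size8; elim: M M8 x y xM yM => [|r M IHM] /=; first by move=> _ [|? ?] [|? ?].
  case/andP=> r8 M8 [|c x] [|d y] //= [sx] [sy].
  by rewrite IHM // scaleDl // vaddACA ?scale_V8 ?app_V8.
clear sz size8; elim: M M8 x xM => [|r M IHM] /=; first by move=> _ [|? ?]; case: c.
case/andP=> r8 M8 [|d x] //= [sx].
by rewrite IHM // -scaleA // scaleD ?scale_V8 ?app_V8.
Qed.

Lemma mulc_bilinear : bilinear_map mulc.
Proof.
split=> [x|y] h8; split=> *; rewrite ?mulc_V8 ?mulcDr ?mulcDl ?mulcZl ?mulcZr //.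
Qed.

Lemma linear_comp F G : linear_map F -> linear_map G -> linear_map (F \o G).
Proof.
move=> [F8 FD FZ] [G8 GD GZ]; split=> [x x8|x y x8 y8|c x x8] /=; first by rewrite F8 ?G8.
  by rewrite GD ?FD ?G8.
by rewrite GZ ?FZ ?G8.
Qed.

Lemma app_mulc M : all V8 M -> size M = 8 ->
    all (fun x => all (fun y => app M (mulc x y) == mulc (app M x) (app M y)) basis) basis ->
  forall x y, V8 x -> V8 y -> app M (mulc x y) = mulc (app M x) (app M y).
Proof.
move=> M8 sz check; have Mlin := linear_app M8 sz; have [m8 _ _] := Mlin.
have [mr ml] := mulc_bilinear.
apply: (@bilinear_ext (fun x y => app M (mulc x y)) (fun x y => mulc (app M x) (app M y))).
- by split=> z z8; apply: (linear_comp Mlin); [apply: mr | apply: ml].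
- by split=> z z8; have := linear_comp _ Mlin; [move/(_ _ (mr _ (m8 _ z8))) | move/(_ _ (ml _ (m8 _ z8)))].
by move=> x y xb yb; apply/eqP/(allP (allP check x xb)).
Qed.

(** The polarisation of x^2 - tr(x) x + N(x) 1 = 0, where signs disappear. Both sides are bilinear,
    so the basis vectors suffice. *)
Lemma mulc_anti x y : V8 x -> V8 y ->
  vadd (mulc x y) (mulc y x) = vadd (scale (form x y) vone) (vadd (scale (trk x) y) (scale (trk y) x)).
Proof.
have trD a b : V8 a -> V8 b -> trk (vadd a b) = addk (trk a) (trk b).
  by vdest a; vdest b; rewrite /trk; kring.
have trZ c a : V8 a -> trk (scale c a) = mulk c (trk a) by vdest a; rewrite /trk; kring.
(* Both sides are symmetric, so linearity in one argument gives it in the other. *)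
have fsym F : (forall a b, V8 a -> V8 b -> F a b = F b a) -> (forall b, V8 b -> linear_map (F^~ b)) -> bilinear_map F.
  move=> FC Fl; split=> // a a8; have [h8 hD hZ] := Fl a a8; split=> [b b8|b d b8 d8|c b b8].
  - by rewrite FC ?h8.
  - by rewrite ![F a _]FC ?vadd_V8 ?hD.
  by rewrite ![F a _]FC ?scale_V8 ?hZ.
have [mr ml] := mulc_bilinear.
apply: (@bilinear_ext (fun x y => vadd (mulc x y) (mulc y x))
  (fun x y => vadd (scale (form x y) vone) (vadd (scale (trk x) y) (scale (trk y) x)))).
- apply: fsym => [a b a8 b8|b b8]; first exact: vaddC (mulc_V8 a8 b8) (mulc_V8 b8 a8).
  split=> [a a8|a d a8 d8|c a a8].
  + exact: vadd_V8 (mulc_V8 a8 b8) (mulc_V8 b8 a8).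
  + rewrite (mulcDl a8 d8 b8) (mulcDr b8 a8 d8).
    exact: vaddACA (mulc_V8 a8 b8) (mulc_V8 d8 b8) (mulc_V8 b8 a8) (mulc_V8 b8 d8).
  rewrite (mulcZl _ a8 b8) (mulcZr _ b8 a8).
  exact: esym (scaleD _ (mulc_V8 a8 b8) (mulc_V8 b8 a8)).
- have v1 : V8 vone by [].
  apply: fsym => [a b a8 b8|b b8].
    by rewrite (formC a8 b8) (vaddC (scale_V8 (trk b) a8) (scale_V8 (trk a) b8)).
  split=> [a a8|a d a8 d8|c a a8].
  + exact: vadd_V8 (scale_V8 _ v1) (vadd_V8 (scale_V8 _ b8) (scale_V8 _ a8)).
  + rewrite (formDl a8 d8 b8) (trD _ _ a8 d8) (scaleDl _ _ v1) (scaleDl _ _ b8) (scaleD _ a8 d8).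
    rewrite (vaddACA (scale_V8 (trk a) b8) (scale_V8 (trk d) b8) (scale_V8 _ a8) (scale_V8 _ d8)).
    apply: vaddACA; rewrite ?scale_V8 //; exact: vadd_V8 (scale_V8 _ b8) (scale_V8 _ _).
  rewrite (formZl _ a8 b8) (trZ _ _ a8) -(scaleA _ _ v1) -(scaleA _ _ b8) (scaleC (trk b) c a8).
  rewrite -(scaleD _ (scale_V8 _ b8) (scale_V8 _ a8)) -scaleD ?scale_V8 //.
  exact: vadd_V8 (scale_V8 _ b8) (scale_V8 _ a8).
by move=> a b ab bb; apply/eqP; move: b bb; apply/allP; move: a ab; apply/allP.
Qed.

Section Octonions.
Import GRing.Theory.
Local Open Scope ring_scope.

Lemma F4_card : #|F4| = 4%N.
Proof. exact: (s2valP' (@pPrimePowerField 2 2 isT isT)). Qed.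

Lemma F4_add2 (x : F4) : x + x = 0.
Proof. exact: addrr_pchar2 (s2valP (@pPrimePowerField 2 2 isT isT)) x. Qed.

Lemma F4_opp (x : F4) : - x = x.
Proof. by apply/eqP; rewrite eq_sym -addr_eq0 F4_add2. Qed.

Lemma F4_gen : exists w : F4, w * w == w + 1.
Proof.
have [w /andP[w0 w1]] : exists w : F4, (w != 0) && (w != 1).
  apply/existsP; apply: contraT => /existsPn all01.
  have: (4 <= size ([:: 0; 1] : seq F4)%R)%N by rewrite -F4_card cardE uniq_leq_size ?enum_uniq // => x _;
    have := all01 x; rewrite !inE negb_and !negbK.
  by [].
(* The product is w^4 - w, which vanishes on a field of order 4; [w] is neither 0 nor 1. *)
exists w; have : w * (w - 1) * (w * w + w + 1) = 0.
  by transitivity (w ^+ 4 - w); [ring | rewrite -F4_card expf_card subrr].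
move/eqP; rewrite !mulf_eq0 (negPf w0) subr_eq0 (negPf w1) /= -addrA addr_eq0.
by rewrite F4_opp.
Qed.

Definition w4 : F4 := xchoose F4_gen.
Lemma w4_sqr : w4 * w4 = w4 + 1. Proof. exact/eqP/(xchooseP F4_gen). Qed.

(** [F4] is known only through an existence statement, so all computations are done in [k4] and
    carried over by this isomorphism, with [K2] going to a root of w^2 = w + 1. *)
Definition emb (x : k4) : F4 := match x with K0 => 0 | K1 => 1 | K2 => w4 | K3 => w4 + 1 end.

Lemma emb_add x y : emb (addk x y) = emb x + emb y.
Proof.
have [c2 w2] := (F4_add2, w4_sqr).
case: x y => [] [] /=; rewrite ?addr0 ?add0r ?c2 //.
- by rewrite addrC.
- by rewrite addrCA c2 addr0.
- by rewrite addrA c2 add0r.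
- by rewrite -addrA c2 addr0.
by rewrite addrAC c2 add0r.
Qed.

Lemma emb_mul x y : emb (mulk x y) = emb x * emb y.
Proof.
have [c2 w2] := (F4_add2, w4_sqr).
case: x y => [] [] /=; rewrite ?mulr0 ?mul0r ?mulr1 ?mul1r ?mulrDl ?mulrDr ?mulr1 ?mul1r ?w2 //.
- by rewrite addrAC c2 add0r.
- by rewrite addrAC c2 add0r.
by rewrite [_ + 1 + w4]addrAC c2 add0r addrCA c2 addr0.
Qed.

Lemma emb_inj : injective emb.
Proof.
have neq x : x != K0 -> emb x != 0.
  case: x => // _ /=; rewrite ?oner_eq0 //.
    by apply/eqP=> w0; have := w4_sqr; rewrite w0 mul0r add0r => /eqP; rewrite eq_sym oner_eq0.
  apply/eqP=> w0; have := w4_sqr; rewrite w0 => /eqP; rewrite mulf_eq0 orbb => /eqP w0'.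
  by move: w0; rewrite w0' add0r => /eqP; rewrite oner_eq0.
move=> x y Dxy; apply/eqP; apply: contraT => xy.
have := neq (addk x y); rewrite emb_add Dxy F4_add2 eqxx.
by case: x y xy {Dxy} => [] [] // _; apply.
Qed.

Definition unemb (x : F4) : k4 :=
  if x == 0 then K0 else if x == 1 then K1 else if x == w4 then K2 else K3.

Lemma embK : cancel emb unemb.
Proof.
move=> x; rewrite /unemb -[0]/(emb K0) -[1]/(emb K1) -{1}[w4]/(emb K2) !(inj_eq emb_inj).
by case: x.
Qed.

Lemma unembK : cancel unemb emb.
Proof.
have es_uniq : uniq [:: emb K0; emb K1; emb K2; emb K3] by rewrite -[uniq _]/(uniq (map emb [:: K0; K1; K2; K3])) (map_inj_uniq emb_inj).
have sub : {subset [:: emb K0; emb K1; emb K2; emb K3] <= enum F4} by move=> x _; rewrite mem_enum.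
have le4 : (size (enum F4) <= 4)%N by rewrite -cardE F4_card.
have [_ es_full] := uniq_min_size es_uniq sub le4.
move=> x; have : x \in [:: emb K0; emb K1; emb K2; emb K3] by rewrite es_full mem_enum.
by rewrite !inE => /or4P[]/eqP->; rewrite embK.
Qed.

Definition row3 (x y z : F4) : 'rV[F4]_3 := \row_i [:: x; y; z]`_i.
Let i0 : 'I_3 := @Ordinal 3 0 isT.
Let i1 : 'I_3 := @Ordinal 3 1 isT.
Let i2 : 'I_3 := @Ordinal 3 2 isT.

Lemma row3E (u : 'rV[F4]_3) : u = row3 (u 0 i0) (u 0 i1) (u 0 i2).
Proof.
by apply/rowP=> i; rewrite mxE; case: i => [[|[|[|]]] //= ilt]; congr (u 0 _); apply: val_inj.
Qed.

Lemma row3_eval x y z : (row3 x y z 0 i0 = x) * (row3 x y z 0 i1 = y) * (row3 x y z 0 i2 = z).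
Proof. by rewrite !mxE. Qed.

Lemma row3_ext (u v : 'rV[F4]_3) : u 0 i0 = v 0 i0 -> u 0 i1 = v 0 i1 -> u 0 i2 = v 0 i2 -> u = v.
Proof. by move=> E0 E1 E2; rewrite (row3E u) (row3E v) E0 E1 E2. Qed.

Lemma dot3 (u v : 'rV[F4]_3) : dot u v = u 0 i0 * v 0 i0 + (u 0 i1 * v 0 i1 + u 0 i2 * v 0 i2).
Proof.
rewrite /dot !big_ord_recl big_ord0 addr0.
by congr (_ + (_ + _)); congr (u _ _ * v _ _); apply: val_inj.
Qed.

Lemma cross3 (u v : 'rV[F4]_3) : cross u v = row3
  (u 0 i1 * v 0 i2 + u 0 i2 * v 0 i1) (u 0 i2 * v 0 i0 + u 0 i0 * v 0 i2) (u 0 i0 * v 0 i1 + u 0 i1 * v 0 i0).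
Proof.
have addE : (i0 + 1 = i1) * (i0 + 2%:R = i2) * (i1 + 1 = i2) * (i1 + 2%:R = i0) * (i2 + 1 = i0) * (i2 + 2%:R = i1).
  by do !split; apply: val_inj.
by apply: row3_ext; rewrite !mxE !addE F4_opp.
Qed.

Definition octo (v : vec) : octonion F4 :=
  let n i := emb (nth K0 v i) in (n 0, row3 (n 1) (n 2) (n 3), row3 (n 4) (n 5) (n 6), n 7)%N.
Definition unocto (x : octonion F4) : vec :=
  let: (a, u, v, b) := x in let n (u : 'rV[F4]_3) i := unemb (u 0 i) in
  [:: unemb a; n u i0; n u i1; n u i2; n v i0; n v i1; n v i2; unemb b].

Lemma unocto_V8 x : V8 (unocto x). Proof. by case: x => [[[a u] v] b]. Qed.

Lemma octoK v : V8 v -> unocto (octo v) = v.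
Proof. by vdest v; rewrite /unocto /octo !row3_eval !embK. Qed.

Lemma unoctoK x : octo (unocto x) = x.
Proof.
case: x => [[[a u] v] b]; rewrite /octo /unocto [nth]lock /= -lock /= !unembK.
by rewrite -!row3E.
Qed.

Lemma octo_add x y : V8 x -> V8 y -> octo (vadd x y) = octo x + octo y.
Proof.
vdest x; vdest y; rewrite /octo /= !emb_add.
by congr (_, _, _, _); apply: row3_ext; rewrite !mxE.
Qed.

Lemma octo_mul x y : V8 x -> V8 y -> octo (mulc x y) = octonion_mul (octo x) (octo y).
Proof.
vdest x; vdest y; rewrite /octo /= !dot3 !cross3 !row3_eval !emb_add !emb_mul.
congr (_, _, _, _).
  by apply: row3_ext; rewrite !mxE F4_opp /= addrA.
by apply: row3_ext; rewrite !mxE /= addrA.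
Qed.
End Octonions.

Definition auto_vec (F : vec -> vec) : Prop :=
  [/\ forall x, V8 x -> V8 (F x),
      forall x y, V8 x -> V8 y -> F (vadd x y) = vadd (F x) (F y)
    & forall x y, V8 x -> V8 y -> F (mulc x y) = mulc (F x) (F y)].

Definition hat (g : {perm octonion F4}) (v : vec) : vec := unocto (g (octo v)).

Lemma octo_hat g v : octo (hat g v) = g (octo v). Proof. exact: unoctoK. Qed.

Lemma octo_inj x y : V8 x -> V8 y -> octo x = octo y -> x = y.
Proof. by move=> x8 y8 /(congr1 unocto); rewrite !octoK. Qed.

Lemma hat_V8 g v : V8 (hat g v). Proof. exact: unocto_V8. Qed.

Lemma hat_auto g : g \in G24_2 -> auto_vec (hat g).
Proof.
rewrite inE => /forallP gP; have {gP} gE x y := forallP (gP x) y.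
split=> [x _|x y x8 y8|x y x8 y8]; first exact: unocto_V8.
  have /andP[/eqP gD _] := gE (octo x) (octo y).
  apply: octo_inj; rewrite ?vadd_V8 ?hat_V8 //.
  by rewrite octo_add ?hat_V8 // !octo_hat octo_add.
have /andP[_ /eqP gM] := gE (octo x) (octo y).
apply: octo_inj; rewrite ?mulc_V8 ?hat_V8 //.
by rewrite octo_mul ?hat_V8 // !octo_hat octo_mul.
Qed.

Definition vperm (F : vec -> vec) : {perm octonion F4} :=
  odflt 1%g [pick s : {perm octonion F4} | [forall x, s x == octo (F (unocto x))]].

Lemma vpermE F G v : (forall x, V8 x -> V8 (F x) /\ G (F x) = x) -> V8 v -> vperm F (octo v) = octo (F v).
Proof.
move=> FK v8; have F_inj : injective (fun x => octo (F (unocto x))).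
  move=> x y Dxy; have [Fx8 xK] := FK _ (unocto_V8 x).
  have [Fy8 yK] := FK _ (unocto_V8 y); have := octo_inj Fx8 Fy8 Dxy => /(congr1 G).
  by rewrite xK yK => /(congr1 octo); rewrite !unoctoK.
rewrite /vperm; case: pickP => [s /forallP/(_ (octo v))/eqP ->|/(_ (perm F_inj))/forallP[] x].
  by rewrite octoK.
by rewrite permE.
Qed.

Lemma vperm_auto F G : (forall x, V8 x -> V8 (F x) /\ G (F x) = x) -> auto_vec F -> vperm F \in G24_2.
Proof.
move=> FK [_ FD FM]; have E x : vperm F x = octo (F (unocto x)).
  by rewrite -{1}[x]unoctoK (vpermE FK) ?unocto_V8.
have F8 x : V8 x -> V8 (F x) by case/FK.
rewrite inE; apply/forallP=> x; apply/forallP=> y; rewrite !E.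
have [x8 y8] := (unocto_V8 x, unocto_V8 y).
rewrite -{1}[x]unoctoK -{1}[y]unoctoK -{3}[x]unoctoK -{3}[y]unoctoK.
by rewrite -octo_add // -octo_mul // !octoK ?vadd_V8 ?mulc_V8 // FD // FM // octo_add ?octo_mul ?F8 // !eqxx.
Qed.

Lemma perm_octo (g h : {perm octonion F4}) : (forall v, V8 v -> g (octo v) = h (octo v)) -> g = h.
Proof. by move=> gh; apply/permP=> x; rewrite -[x]unoctoK gh ?unocto_V8. Qed.

(** * The maps 1 + n_ab and their behaviour under ring automorphisms *)

Definition special (p : vec * vec) : bool :=
  [&& V8 p.1, V8 p.2, mulc p.1 p.1 == vzero, mulc p.2 p.2 == vzero,
      mulc p.1 p.2 == vzero & mulc p.2 p.1 == vzero].
Definition nn (p : vec * vec) (v : vec) : vec :=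
  vadd (scale (form v p.1) p.2) (scale (form v p.2) p.1).
Definition xf (p : vec * vec) (v : vec) : vec := vadd v (nn p v).

(** The diagonal entries of the square give a0^2 = u . v = a7^2, and squaring is injective on the
    field. *)
Lemma trk_square a : V8 a -> mulc a a = vzero -> trk a = K0.
Proof.
move=> a8; case/V8P: (a8) => [a0 [u0 [u1 [u2 [v0 [v1 [v2 [a7 Da]]]]]]]]; rewrite Da /trk /= => -[E0 _ _ _ _ _ _ E7].
have: sqk a0 = sqk a7.
  move: E0 E7; rewrite [mulk v0 _]mulkC [mulk v1 _]mulkC [mulk v2 _]mulkC -/(sqk a0) -/(sqk a7).
  by move: (addk (mulk u0 v0) _) => S; case: (sqk a0) (sqk a7) S => [] [] [].
by move/(can_inj sqkK)->; apply: addkk.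
Qed.

(** Since a has trace 0 and a b = 0, the anticommutator v a + a v multiplied by b is B(v, a) b. So
    n_ab is expressed by sums and products alone, and a ring automorphism carries it to the map of
    the image pair even when it is only semilinear. *)
Lemma nn_intrinsic p v : special p -> V8 v ->
  vadd (mulc (vadd (mulc v p.1) (mulc p.1 v)) p.2) (mulc (vadd (mulc v p.2) (mulc p.2 v)) p.1) = nn p v.
Proof.
case: p => a b /and5P[/= a8 b8 /eqP aa /eqP bb /andP[/eqP ab /eqP ba]] v8.
have one c : V8 c -> mulc vone c = c by vdest c; kring.
have half c d : V8 c -> V8 d -> mulc c c = vzero -> mulc c d = vzero ->
    mulc (vadd (mulc v c) (mulc c v)) d = scale (form v c) d.
  move=> c8 d8 cc cd; rewrite mulc_anti // (trk_square c8 cc) scale0 //.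
  rewrite vadd0 ?scale_V8 // mulcDl ?scale_V8 // !mulcZl // cd one //.
  by rewrite (_ : scale _ vzero = vzero) ?vadd0 ?scale_V8 //; case: (trk v).
by rewrite !half.
Qed.

Lemma nn_V8 p v : special p -> V8 (nn p v).
Proof. by case: p => a b /and5P[a8 b8 _ _ _]; rewrite vadd_V8 ?scale_V8. Qed.
Lemma xf_V8 p v : special p -> V8 v -> V8 (xf p v).
Proof. by move=> p_sp v8; rewrite vadd_V8 ?nn_V8. Qed.

Definition pmap2 (F : vec -> vec) (p : vec * vec) : vec * vec := (F p.1, F p.2).

Section Equivariance.
Variable F : vec -> vec.
Hypothesis F_auto : auto_vec F.

Lemma auto_zero : F vzero = vzero.
Proof. by have [F8 FD _] := F_auto; rewrite -[in LHS](@vaddx vzero) // FD // vaddx ?F8. Qed.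

Lemma special_auto p : special p -> special (pmap2 F p).
Proof.
have [F8 FD FM] := F_auto; case: p => a b /and5P[/= a8 b8 /eqP aa /eqP bb /andP[/eqP ab /eqP ba]].
by apply/and5P; rewrite /= !F8 // -!FM // aa bb ab ba auto_zero eqxx.
Qed.

Lemma nn_auto p v : special p -> V8 v -> F (nn p v) = nn (pmap2 F p) (F v).
Proof.
have [F8 FD FM] := F_auto => p_sp v8; rewrite -!nn_intrinsic ?special_auto ?F8 //.
case: p p_sp => a b /and5P[/= a8 b8 _ _ _].
by rewrite FD ?mulc_V8 ?vadd_V8 ?mulc_V8 // !FM ?vadd_V8 ?mulc_V8 // !FD ?mulc_V8 // !FM.
Qed.

Lemma xf_auto p v : special p -> V8 v -> F (xf p v) = xf (pmap2 F p) (F v).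
Proof. by have [F8 FD FM] := F_auto => p_sp v8; rewrite FD ?nn_V8 // nn_auto. Qed.
End Equivariance.

Definition represents (s : {perm octonion F4}) (p : vec * vec) : Prop :=
  special p /\ forall v, V8 v -> s (octo v) = octo (xf p v).

Definition rootT : {set {perm octonion F4}} := [set s | `[< s <> 1%g /\ exists p, represents s p >]].

Lemma rootTP s : reflect (s <> 1%g /\ exists p, represents s p) (s \in rootT).
Proof. by rewrite inE; apply: asboolP. Qed.

Lemma represents_conj s p g : g \in G24_2 -> represents s p -> represents (s ^ g)%g (pmap2 (hat g) p).
Proof.
move=> gG [p_sp sp]; have g_auto := hat_auto gG; split=> [|v v8]; first exact: special_auto.
have u8 := unocto_V8 (g^-1%g (octo v)); set u := unocto _ in u8.
have Dv : octo v = g (octo u) by rewrite unoctoK permKV.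
have -> : v = hat g u by apply: octo_inj; rewrite ?hat_V8 // octo_hat.
by rewrite octo_hat permJ sp // -xf_auto // octo_hat.
Qed.

Lemma rootT_conj s g : g \in G24_2 -> s \in rootT -> (s ^ g)%g \in rootT.
Proof.
move=> gG /rootTP[s1 [p sp]]; apply/rootTP; split; last by exists (pmap2 (hat g) p); apply: represents_conj.
by move=> sg1; apply: s1; rewrite -(conjgK g s) sg1 conj1g.
Qed.

Lemma nn_linear p : special p -> linear_map (nn p).
Proof.
case: p => a b /and5P[/= a8 b8 _ _ _]; split=> [x x8|x y x8 y8|c x x8] /=.
- by rewrite vadd_V8 ?scale_V8.
- rewrite /nn /= (formDl x8 y8 a8) (formDl x8 y8 b8) (scaleDl _ _ b8) (scaleDl _ _ a8).
  exact: vaddACA (scale_V8 _ b8) (scale_V8 _ b8) (scale_V8 _ a8) (scale_V8 _ a8).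
rewrite /nn /= (formZl _ x8 a8) (formZl _ x8 b8) -(scaleA _ _ b8) -(scaleA _ _ a8).
exact: esym (scaleD _ (scale_V8 _ b8) (scale_V8 _ a8)).
Qed.

(** The matrix of [nn p]: the coordinates dual under [form] are 0 and 7, 1 and 4, 2 and 5, 3 and 6.
    Different pairs can give the same map, so equality of group elements is tested on [rows]. *)
Definition rows (p : vec * vec) : seq vec := 
  let: (a, b) := p in if a is [:: a0; a1; a2; a3; a4; a5; a6; a7] then if b is [:: b0; b1; b2; b3; b4; b5; b6; b7] then
   let r x y := vadd (scale x b) (scale y a) in
   [:: r a7 b7; r a4 b4; r a5 b5; r a6 b6; r a1 b1; r a2 b2; r a3 b3; r a0 b0]
  else [::] else [::].

Lemma rowsE p : special p -> rows p = map (nn p) basis.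
Proof.
case: p => a b /and5P[/= + + _ _ _]; vdest a; vdest b; rewrite /nn /=.
repeat match goal with |- cons _ _ = cons _ _ => congr cons end => //.
all: by kring.
Qed.

Lemma vadd_inj x y z : V8 x -> V8 y -> V8 z -> vadd x y = vadd x z -> y = z.
Proof.
have z0 : V8 vzero by [].
move=> x8 y8 z8 /(congr1 (vadd x)); rewrite (vaddA x8 x8 y8) (vaddA x8 x8 z8) (vaddx x8).
by rewrite (vaddC z0 y8) (vaddC z0 z8) (vadd0 y8) (vadd0 z8).
Qed.

Lemma rows_eq s s' p p' : represents s p -> represents s' p' -> (s == s') = (rows p == rows p').
Proof.
move=> [p_sp sp] [p'_sp sp']; rewrite !rowsE //; apply/eqP/eqP=> [Ds|Dr].
  apply/eq_in_map=> v vb; have v8 := basis_V8 vb.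
  have := sp v v8; rewrite Ds sp' // => /octo_inj; rewrite !xf_V8 // => /(_ isT isT).
  by move/vadd_inj => -> //; apply: nn_V8.
apply: perm_octo => v v8; rewrite sp // sp' //; congr (octo (vadd _ _)).
apply: linear_ext v8; [exact: nn_linear | exact: nn_linear |].
exact/eq_in_map.
Qed.

(** * Root elements of G_2(4) *)

(* The rows are the images of the basis of the octonions. The first two matrices
   generate a subgroup J_2 of G_2(4), matching [J2_a] and [J2_b]; the third one
   is 1 + n_ab for a = E_2 and b = w E_4. *)
Definition mat_A : seq vec := [::
  [:: K3; K3; K2; K0; K2; K0; K1; K2];
  [:: K2; K3; K3; K0; K1; K0; K2; K2];
  [:: K0; K0; K2; K0; K0; K0; K2; K0];
  [:: K1; K3; K2; K2; K2; K2; K2; K1];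
  [:: K3; K3; K1; K0; K3; K0; K3; K3];
  [:: K2; K1; K1; K1; K3; K2; K2; K2];
  [:: K0; K0; K1; K0; K0; K0; K2; K0];
  [:: K2; K3; K2; K0; K2; K0; K1; K3]].
Definition mat_B : seq vec := [::
  [:: K0; K0; K2; K3; K2; K0; K0; K1];
  [:: K0; K0; K1; K2; K3; K1; K3; K0];
  [:: K1; K0; K0; K1; K1; K1; K1; K1];
  [:: K3; K0; K1; K1; K3; K2; K0; K3];
  [:: K3; K2; K2; K3; K1; K1; K3; K3];
  [:: K2; K1; K1; K3; K1; K3; K2; K2];
  [:: K3; K2; K1; K0; K2; K1; K3; K3];
  [:: K1; K0; K2; K3; K2; K0; K0; K0]].
Definition mat_q : seq vec := [::
  [:: K1; K0; K0; K0; K0; K0; K0; K0];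
  [:: K0; K1; K2; K0; K0; K0; K0; K0];
  [:: K0; K0; K1; K0; K0; K0; K0; K0];
  [:: K0; K0; K0; K1; K0; K0; K0; K0];
  [:: K0; K0; K0; K0; K1; K0; K0; K0];
  [:: K0; K0; K0; K0; K2; K1; K0; K0];
  [:: K0; K0; K0; K0; K0; K0; K1; K0];
  [:: K0; K0; K0; K0; K0; K0; K0; K1]].

(* The letters: 0 and 1 generate J_2, 2 is [mat_q], any other one the Frobenius map. *)
Definition lact (l : nat) (v : vec) : vec :=
  match l with 0 => app mat_A v | 1 => app mat_B v | 2 => app mat_q v | _ => map sqk v end.
Definition linv (l : nat) (v : vec) : vec := if l is 1 then lact 1 (lact 1 v) else lact l v.
Definition wact (w : seq nat) (v : vec) : vec := foldr lact v w.
Definition pact (w : seq nat) (p : vec * vec) : vec * vec := pmap2 (wact w) p.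

Definition ta : vec := [:: K0; K0; K0; K0; K0; K0; K1; K0].
Definition tb : vec := [:: K0; K0; K1; K0; K0; K0; K0; K0].
Definition h0 : vec * vec := (ta, tb).

(** The vectors of square zero: trace 0 makes the diagonal entries equal, and a^2 = u . v gives a =
    (u . v)^2 because squaring is an involution of the field. *)
Definition sing6 (u0 u1 u2 v0 v1 v2 : k4) : vec :=
  let s := sqk (addk (mulk u0 v0) (addk (mulk u1 v1) (mulk u2 v2))) in [:: s; u0; u1; u2; v0; v1; v2; s].
Definition allk (P : k4 -> bool) : bool := [&& P K0, P K1, P K2 & P K3].
Definition all_sing (P : vec -> bool) : bool :=
  allk (fun u0 => allk (fun u1 => allk (fun u2 => allk (fun v0 => allk (fun v1 => allk (fun v2 =>
    P (sing6 u0 u1 u2 v0 v1 v2))))))).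

Fixpoint kkey (v : vec) (p : positive) : positive :=
  if v is x :: v' then
    let p' := kkey v' p in
    match x with K0 => xO (xO p') | K1 => xO (xI p') | K2 => xI (xO p') | K3 => xI (xI p') end
  else p.
Definition vkey (v : vec) : positive := kkey v xH.

(* [depth_of v]: the length of a shortest word in the letters 0, 1, 2 taking [v] to [ta]. *)
Fixpoint depth_levels (n k : nat) (fr : seq vec) (t : trie nat) : trie nat :=
  if n is n'.+1 then
    let r := foldl (fun st v => foldl (fun (st : seq vec * trie nat) l => let u := linv l v in
        if PositiveMap.mem (vkey u) st.2 then st else (u :: st.1, PositiveMap.add (vkey u) k st.2))
      st [:: 0; 1; 2]) ([::], t) fr in
    depth_levels n' k.+1 r.1 r.2
  else t.
Definition depth_table : trie nat := Eval vm_compute in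
  depth_levels 16 1 [:: ta] (PositiveMap.add (vkey ta) 0 (PositiveMap.empty _)).
Definition depth_of (v : vec) : nat := get 99 depth_table (vkey v).

(** For a = E_6 the partner b has the form (0, x, y, 0, 0, 0, z, 0), and n_ab does not change with
    z, the coordinate along a. The 15 words carry [h0] to the maps of the 15 nonzero choices of (x,
    y). *)
Definition line_words : seq (seq nat) := [:: [::]; [:: 1; 0; 2; 1; 2; 1; 0; 1; 2; 0; 1; 1]; [:: 1; 2; 1; 0; 1; 2; 1; 2; 1; 0; 2; 1]; [:: 1; 1; 2; 0; 1; 0; 1; 1; 0; 2; 1]; [:: 1; 0; 2; 1; 2; 1; 1; 2; 0; 1; 1];
  [:: 0; 1; 0; 2; 1; 1; 2; 1; 0; 1; 1]; [:: 0; 1; 0; 1; 1; 2; 1; 2; 0; 1; 1]; [:: 2; 1; 2; 1; 2; 1; 1; 2; 1; 1]; [:: 2; 1; 0; 2; 1; 1; 0; 1; 2; 0; 1; 1];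
  [:: 1; 0; 2; 1; 1; 0; 1; 2; 0; 1; 1]; [:: 1; 2; 1; 2; 1; 1; 2; 1; 1]; [:: 1; 1; 0; 2; 1; 1; 0; 1; 2; 1]; [:: 0; 1; 1; 2; 0; 1; 0; 1; 0; 1; 1];
  [:: 2; 0; 1; 2; 1; 2; 1; 2; 1; 2; 1]; [:: 0; 1; 2; 1; 2; 1; 2; 1; 2; 1]].

(** The root elements assigned to the labels 0 to 12 at the point 1; entry 0 represents the same
    element as [h0]. *)
Definition taus : seq (vec * vec) := [::
  ([:: K0; K0; K1; K0; K0; K0; K0; K0], [:: K0; K0; K0; K0; K0; K0; K1; K0]);
  ([:: K0; K0; K1; K0; K0; K0; K3; K0], [:: K3; K2; K0; K0; K1; K0; K1; K3]);
  ([:: K0; K0; K2; K0; K0; K0; K3; K0], [:: K1; K2; K0; K0; K3; K0; K2; K1]);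
  ([:: K0; K0; K0; K0; K0; K0; K3; K0], [:: K0; K2; K2; K0; K0; K0; K0; K0]);
  ([:: K0; K0; K3; K0; K0; K0; K3; K0], [:: K2; K2; K0; K0; K2; K0; K3; K2]);
  ([:: K0; K0; K1; K0; K0; K0; K0; K0], [:: K0; K0; K0; K0; K1; K0; K1; K0]);
  ([:: K0; K0; K1; K0; K0; K0; K0; K0], [:: K0; K0; K0; K0; K0; K0; K3; K0]);
  ([:: K0; K0; K1; K0; K0; K0; K3; K0], [:: K3; K2; K0; K0; K1; K0; K0; K3]);
  ([:: K0; K0; K2; K0; K0; K0; K3; K0], [:: K1; K2; K0; K0; K3; K0; K1; K1]);
  ([:: K0; K0; K0; K0; K0; K0; K3; K0], [:: K0; K2; K0; K0; K0; K0; K0; K0]);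
  ([:: K0; K0; K3; K0; K0; K0; K3; K0], [:: K2; K2; K0; K0; K2; K0; K1; K2]);
  ([:: K0; K0; K1; K0; K0; K0; K0; K0], [:: K0; K0; K0; K0; K1; K0; K0; K0]);
  ([:: K0; K0; K1; K0; K0; K0; K0; K0], [:: K0; K0; K0; K0; K0; K0; K2; K0])].
Definition lword (w : seq bool) : seq nat := map nat_of_bool w.
Definition xtab : trie (seq (vec * vec)) := Eval vm_compute in
  foldl (fun t j => PositiveMap.add j (if tw j is c :: w then map (pmap2 (lact c)) (get [::] t (wapp w 1)) else taus) t)
    (PositiveMap.empty _) pts.
Definition xp (j : positive) (k : nat) : vec * vec := nth h0 (get [::] xtab j) k.
Definition rkey (p : vec * vec) : positive := foldr kkey xH (rows p).
Definition jks : seq (positive * nat) := [seq (j, k) | j <- pts, k <- labs13].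
Definition ktab : trie (positive * nat) := Eval vm_compute in
  trie_of [seq (rkey (xp p.1 p.2), p) | p <- jks].
Definition klookup (p : vec * vec) : positive * nat := get (1%positive, 99) ktab (rkey p).
Definition xpp (i : positive * nat) := xp i.1 i.2.
Definition known (i : positive * nat) : bool := (i.1 \in pts) && (i.2 < 13).

Definition xcommute (p q : vec * vec) : bool := all (fun v => xf p (xf q v) == xf q (xf p v)) basis.
Definition clist : seq (positive * nat) := Eval vm_compute in
  [seq i <- jks | xcommute (xpp i) h0].
Definition epairs : seq (vec * vec) := [:: h0; xp 1 6; xp 1 12].

(** Data showing that an automorphism [z] commuting with all root elements that commute with [h0]
    lies in the four-group of [epairs]. Such a [z] commutes with the nine maps [nn p] listed here,
    so [cprog], which applies these maps and products starting from E_3, computes vectors whose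
    images are determined by the image of E_3. *)
Definition cprog_pairs : seq (vec * vec) := [::
  ([:: K0; K0; K1; K0; K0; K0; K0; K0], [:: K0; K0; K0; K0; K0; K0; K1; K0]);
  ([:: K0; K0; K1; K0; K0; K0; K0; K0], [:: K0; K0; K0; K0; K0; K0; K2; K0]);
  ([:: K0; K0; K1; K0; K0; K0; K0; K0], [:: K0; K0; K0; K0; K1; K0; K0; K0]);
  ([:: K0; K0; K3; K0; K0; K0; K3; K0], [:: K1; K1; K0; K0; K1; K0; K0; K1]);
  ([:: K0; K0; K3; K0; K0; K0; K3; K0], [:: K2; K2; K0; K0; K2; K0; K0; K2]);
  ([:: K0; K0; K2; K0; K0; K0; K3; K0], [:: K3; K1; K0; K0; K2; K0; K0; K3]);
  ([:: K0; K0; K2; K0; K0; K0; K3; K0], [:: K1; K2; K0; K0; K3; K0; K0; K1]);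
  ([:: K0; K0; K0; K0; K0; K0; K3; K0], [:: K0; K1; K0; K0; K0; K0; K0; K0]);
  ([:: K0; K0; K0; K0; K0; K0; K3; K0], [:: K0; K2; K0; K0; K0; K0; K0; K0])].
Definition cprog : seq (nat * nat + nat * nat) := [:: inl (0, 0); inl (1, 0); inl (3, 0); inl (4, 0); inl (5, 0); inl (5, 3); inl (5, 4); inl (6, 0); inl (7, 0); inl (8, 0); inr (0, 3); inr (0, 4); inr (0, 6); inr (0, 7); inr (0, 8)].
Definition run_op (ts : seq vec) (o : nat * nat + nat * nat) : vec :=
  match o with
  | inl (i, j) => nn (nth h0 cprog_pairs i) (nth vzero ts j)
  | inr (i, j) => mulc (nth vzero ts i) (nth vzero ts j)
  end.
Definition run_prog (y : vec) : seq vec := foldl (fun ts o => rcons ts (run_op ts o)) [:: y] cprog.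
(** Index sets of computed vectors whose sums are e and w e for each basis vector e. Both multiples
    appear because [z] may be semilinear. *)
Definition cmasks : seq (seq nat) := [:: [:: 3; 4; 5; 10; 13]; [:: 3; 8; 9; 10; 14]; [:: 10]; [:: 9; 10]; [:: 1]; [:: 2]; [:: 0]; [:: 12; 15]; [:: 3; 8; 9; 10]; [:: 4; 5; 8; 9]; [:: 0; 12]; [:: 11; 15]; [:: 1; 2; 6]; [:: 1; 7]; [:: 5; 8; 9; 10; 13]; [:: 5; 9; 14]].
Definition vE3 : vec := nth vzero basis 3.
(** Conditions that any such [z] preserves. Among the nonzero vectors of square zero only E_3 and
    its images under [epairs] satisfy them. *)
Definition cond_y (y : vec) : bool :=
  let n i := nn (nth h0 cprog_pairs i) y in
  [&& n 2 == vzero, n 0 != vzero,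
      vadd y (vadd (mulc y (n 3)) (mulc (n 5) y)) == vzero &
      vadd y (vadd (mulc y (n 4)) (mulc (n 8) y)) == vzero].

(** Words fixing the root element of [h0], the last one being the Frobenius map. Under them the
    other root elements commuting with it fall into sets of sizes 2, 20 and 40. *)
Definition fixers : seq (seq nat) := [:: [:: 0]; [:: 1; 1; 0; 1];
  [:: 0; 1; 0; 1; 0; 1; 1; 0; 1; 1; 0; 1; 0; 1; 1; 0; 1; 1; 0; 1; 0; 1; 1]; [:: 2]; [:: 3]].
Definition trans_words : seq (seq nat) := [:: [::]; [:: 1; 1; 0; 2; 0; 1; 0; 1; 1; 0; 2; 1]; [:: 2; 1; 0; 2; 1; 1; 2; 1; 0; 1; 1]; [:: 1; 0; 2; 1; 2; 1; 1; 2; 0; 1; 1];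
  [:: 1; 2; 1; 1; 2; 1; 0; 2; 0; 1; 1]; [:: 0; 1; 2; 1; 1; 2; 1; 0; 2; 0; 1; 1]; [:: 1; 2; 1; 0; 1; 2; 1; 2; 1; 0; 2; 1]; [:: 1; 1; 2; 0; 1; 0; 2; 1; 2; 1; 2; 1; 1];
  [:: 2; 1; 0; 1; 1; 2; 1; 2; 0; 1; 1]; [:: 1; 1; 2; 0; 1; 0; 1; 1; 0; 2; 1]; [:: 2; 1; 0; 2; 0; 1; 1; 2; 1; 2; 1; 1]; [:: 1; 0; 2; 0; 1; 1; 2; 0; 1; 2; 1; 1];
  [:: 1; 0; 2; 1; 2; 1; 0; 1; 2; 0; 1; 1]].
Definition sep_points : seq positive := [:: 2; 3; 4; 5; 6; 15]%positive.

(* Breadth-first orbit under the fixers of [h0], each element but the first with its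
   parent and the fixer leading to it. *)
Fixpoint orb (n : nat) (queue : seq (positive * nat)) (acc : seq (positive * nat * (positive * nat) * seq nat)) (seen : seq (positive * nat)) :=
  if n is n'.+1 then
    if queue is i :: queue' then
      let r := foldl (fun st w => let: (q, acc, seen) := st in let i' := klookup (pact w (xpp i)) in
         if i' \in seen then st else (rcons q i', rcons acc (i', i, w), i' :: seen)) (queue', acc, seen) fixers in
      orb n' r.1.1 r.1.2 r.2
    else acc
  else acc.
Definition orbit_of (i : positive * nat) := orb 100 [:: i] [::] [:: i].
Definition rep2 : positive * nat := (1%positive, 1).
Definition rep3 : positive * nat := Eval vm_compute in head rep2 [seq i <- clist | (i \notin nbl 0) && (i != (1%positive, 0))].
Definition rep1 : positive * nat := (1%positive, 6).
Definition orbits_table := Eval vm_compute in map orbit_of [:: rep1; rep2; rep3].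
Definition class1 : seq (positive * nat) := rep1 :: map (fun t => t.1.1) (nth [::] orbits_table 0).
Definition class2 : seq (positive * nat) := rep2 :: map (fun t => t.1.1) (nth [::] orbits_table 1).
Definition class3 : seq (positive * nat) := rep3 :: map (fun t => t.1.1) (nth [::] orbits_table 2).
Definition root0 : positive * nat := (1%positive, 0).

Fixpoint orb_ok (seen : seq (positive * nat)) (l : seq (positive * nat * (positive * nat) * seq nat)) : bool :=
  if l is (i', i, w) :: l' then
    [&& i \in seen, w \in fixers, rows (xpp i') == rows (pact w (xpp i)) & orb_ok (i' :: seen) l']
  else true.

Definition same_product (p q r : vec * vec) : bool := all (fun v => xf q (xf p v) == xf r v) basis.
Definition cprod_table := Eval vm_compute in
  [seq (i, head root0 [seq i' <- clist | same_product h0 (xpp i) (xpp i')]) | i <- clist & i != root0].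

Definition span2 (p : vec * vec) : seq vec :=
  [seq vadd (scale x p.1) (scale y p.2) | x <- [:: K0; K1; K2; K3], y <- [:: K0; K1; K2; K3]].
(* The pairs [1 + n_ab], [1 + n_ac] with [b c = a]: this relation, invariant under
   all ring automorphisms, separates the lines from the third kind of four-groups. *)
Definition good_pair (p q : vec * vec) : bool :=
  has (fun ab => has (fun c => [&& mulc ab.2 c == ab.1, special (ab.1, c) & rows (ab.1, c) == rows q]) (span2 q))
    [seq ab <- [seq (a, b) | a <- span2 p, b <- span2 p] | special ab && (rows ab == rows p)].
Definition good_four (i i' : positive * nat) : bool :=
  let l := [:: h0; xpp i; xpp i'] in has (fun p => has (good_pair p) l) l.
Definition prod_of (i : positive * nat) : positive * nat :=
  head root0 [seq t.2 | t <- cprod_table & t.1 == i].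

Definition mats : seq (seq vec) := [:: mat_A; mat_B; mat_q; map (xf h0) basis].
Lemma mats_check : all (fun M => [&& all V8 M, size M == 8 &
  all (fun x => all (fun y => app M (mulc x y) == mulc (app M x) (app M y)) basis) basis]) mats.
Proof. by vm_cast_no_check (erefl true). Qed.
Lemma linv_check : all (fun l => all (fun v => linv l (lact l v) == v) basis) [:: 0; 1; 2] &&
  all (fun v => xf h0 (xf h0 v) == v) basis.
Proof. by vm_cast_no_check (erefl true). Qed.
Lemma special_check : special h0 && (rows h0 != nseq 8 vzero).
Proof. by vm_cast_no_check (erefl true). Qed.
Lemma depth_check : all_sing (fun v => let n := depth_of v in (v == vzero) ||
  (if n is 0 then v == ta else has (fun l => depth_of (lact l v) < n) [:: 0; 1; 2])).
Proof. by vm_cast_no_check (erefl true). Qed.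
Lemma line_check : let ims := [seq rows (pact w h0) | w <- line_words] in
  allk (fun x => allk (fun y => allk (fun z => let r := rows (ta, [:: K0; x; y; K0; K0; K0; z; K0]) in
    (r == nseq 8 vzero) || (r \in ims)))) && all (all (fun l => l < 3)) line_words.
Proof. by vm_cast_no_check (erefl true). Qed.
Lemma xtree_check : all (fun j => if tw j is c :: w then let i := wapp w 1 in
    (tw i == w) && (get [::] xtab j == map (pmap2 (lact c)) (get [::] xtab i))
  else (j == 1%positive) && (get [::] xtab j == taus)) pts.
Proof. by vm_cast_no_check (erefl true). Qed.
Lemma xclosed_check : all (fun i => all (fun l => let p := pact [:: l] (xpp i) in let i' := klookup p in
  [&& known i', rows (xpp i') == rows p & (l < 2) ==> (i'.1 == gen (l == 1) i.1)]) [:: 0; 1; 2]) jks.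
Proof. by vm_cast_no_check (erefl true). Qed.
Lemma klookup_check : all (fun i => klookup (xpp i) == i) jks.
Proof. by vm_cast_no_check (erefl true). Qed.
Lemma clist_check : all (fun i => xcommute (xpp i) h0 == (i \in clist)) jks && all (fun i => i \in jks) clist.
Proof. by vm_cast_no_check (erefl true). Qed.
Lemma ecent_check : all (fun e => all (fun i => xcommute e (xpp i)) clist) epairs
  && all special epairs && same_product (nth h0 epairs 0) (nth h0 epairs 1) (nth h0 epairs 2).
Proof. by vm_cast_no_check (erefl true). Qed.
Lemma cconj_check : all (fun i => all (fun i' => let p := xpp i in let p' := pmap2 (xf (xpp i')) p in
  all (fun v => xf p' v == xf p v) basis || has (fun e => all (fun v => xf p' v == xf e (xf p v)) basis) epairs) clist) clist.
Proof. by vm_cast_no_check (erefl true). Qed.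
Lemma cprog_check : [&& all (fun p => special p && (let i := klookup p in (i \in clist) && (rows (xpp i) == rows p))) cprog_pairs,
  cond_y vE3, mulc vE3 vE3 == vzero &
  all_sing (fun y => (y == vzero) || ~~ cond_y y || (y == vE3) || has (fun e => y == xf e vE3) epairs)].
Proof. by vm_cast_no_check (erefl true). Qed.
Lemma cmasks_check : let ts := run_prog vE3 in
  [seq foldr (fun t => vadd (nth vzero ts t)) vzero m | m <- cmasks] ==
  flatten [seq [:: scale K1 e; scale K2 e] | e <- basis].
Proof. by vm_cast_no_check (erefl true). Qed.
Lemma fixers_check : all (fun w => rows (pact w h0) == rows h0) fixers &&
  [&& orb_ok [:: rep1] (nth [::] orbits_table 0), orb_ok [:: rep2] (nth [::] orbits_table 1) &
      orb_ok [:: rep3] (nth [::] orbits_table 2)].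
Proof. by vm_cast_no_check (erefl true). Qed.
Lemma classes_check : [&& perm_eq clist (root0 :: class1 ++ class2 ++ class3),
  perm_eq (nbl 0) (class1 ++ class2), uniq clist, size class1 == 2, size class2 == 20, size class3 == 40
  & all (fun i => i \in jks) (root0 :: class1 ++ class2 ++ class3)].
Proof. by vm_cast_no_check (erefl true). Qed.
Lemma cprod_check : all (fun i => (i == root0) || (let i' := prod_of i in
  [&& i' \in clist, i' != root0, i' != i & same_product h0 (xpp i) (xpp i')])) clist.
Proof. by vm_cast_no_check (erefl true). Qed.
Lemma separate_check : [&& all (fun i => all (fun i' => xcommute (xpp i) (xpp i')) clist) class1,
  ~~ all (fun i' => xcommute (xpp rep2) (xpp i')) clist, ~~ all (fun i' => xcommute (xpp rep3) (xpp i')) clist,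
  good_four rep2 (prod_of rep2) & ~~ good_four rep3 (prod_of rep3)].
Proof. by vm_cast_no_check (erefl true). Qed.
Definition k4s : seq k4 := [:: K0; K1; K2; K3].
Definition test_vecs : seq vec :=
  let l := [seq scale c e | c <- k4s, e <- basis] in [seq vadd u v | u <- l, v <- l].
Lemma test_vecs_V8 : all V8 test_vecs.
Proof. by vm_cast_no_check (erefl true). Qed.
(** The two vectors are independent and lie in the image of [nn p], so the plane they span depends
    only on the map. *)
Definition spanning (p : vec * vec) : bool :=
  [&& has (fun v => nn p v == p.1) test_vecs, has (fun v => nn p v == p.2) test_vecs &
   all (fun x => all (fun y => (vadd (scale x p.1) (scale y p.2) == vzero) ==> (x == K0) && (y == K0)) k4s) k4s].
Lemma span_check : all spanning [:: h0; xpp rep3; xpp (prod_of rep3)].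
Proof. by vm_cast_no_check (erefl true). Qed.
Lemma trans_check : all (fun k => let ims := [seq rows (pact (nth [::] trans_words k) (xpp i)) | i <- nbl 0] in
  [&& rows (pact (nth [::] trans_words k) h0) == rows (nth h0 taus k), special (nth h0 taus k) &
   all (fun i => rows (xpp i) \in ims) (nbl k)]) labs13.
Proof. by vm_cast_no_check (erefl true). Qed.
(** The frames [b :: tw j] and [tw (gen b j)] have the same end but may differ by a stabiliser
    element. A label in the second frame that agrees with label [k] in the first at six test points
    is the one that conjugation of root elements produces. *)
Lemma sep_check : all (fun j => all (fun b => let j' := gen b j in
   let us := [seq (u, wapp (winv (b :: tw j)) (wapp (tw j') u)) | u <- sep_points] in
   all (fun k => let k' := (klookup (pact [:: nat_of_bool b] (xp j k))).2 in
     all (fun l => (l == k') || has (fun u => label_dist l u.1 != label_dist k u.2) us) labs13) labs13) [:: false; true]) pts.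
Proof. by vm_cast_no_check (erefl true). Qed.

(** * The generators as automorphisms and the class of root elements *)

Lemma autoL F : linear_map F -> (forall x y, V8 x -> V8 y -> F (mulc x y) = mulc (F x) (F y)) -> auto_vec F.
Proof. by case=> F8 FD _ FM. Qed.

Lemma linear_id : linear_map id. Proof. by []. Qed.

Lemma mats_auto M : M \in mats -> linear_map (app M) /\ auto_vec (app M).
Proof.
move=> /(allP mats_check)/and3P[M8 /eqP sz check].
by split; [apply: linear_app | apply: autoL (linear_app M8 sz) (app_mulc M8 sz check)].
Qed.

Lemma frob_auto : auto_vec (map sqk).
Proof.
split=> [x|x y|x y]; first by rewrite /V8 size_map.
  by vdest x; vdest y; rewrite /= !sqk_add.
by vdest x; vdest y; rewrite /= !(sqk_add, sqk_mul).
Qed.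

Lemma lact_linear l : l < 3 -> linear_map (lact l).
Proof. by case: l => [|[|[|//]]] _; apply: (mats_auto _).1; rewrite !inE eqxx ?orbT. Qed.

Lemma lact_auto l : auto_vec (lact l).
Proof.
case: l => [|[|[|l]]]; last exact: frob_auto.
all: by apply: (mats_auto _).2; rewrite !inE eqxx ?orbT.
Qed.

Lemma lact_V8 l v : V8 v -> V8 (lact l v). Proof. by have [+ _ _] := lact_auto l; apply. Qed.

Lemma lactK l v : V8 v -> linv l (lact l v) = v.
Proof.
have [check _] := andP linv_check; have [l3|l3] := ltnP l 3; last first.
  move: l l3 => [|[|[|l]]] // _ _ /=.
  by rewrite -map_comp map_id_in // => x _; rewrite /= sqkK.
have l_lin := lact_linear l3.
have li_lin : linear_map (linv l).
  have lin1 := lact_linear (isT : 1 < 3).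
  by case: l l3 l_lin => [|[|l]] l3 l_lin //; apply: (linear_comp lin1 lin1).
apply: (linear_ext (linear_comp li_lin l_lin) linear_id) => e eb.
have lin : l \in [:: 0; 1; 2] by rewrite !inE; lia.
by apply/eqP; have /allP/(_ l lin)/allP/(_ e eb) := check.
Qed.

Definition gl (l : nat) : {perm octonion F4} := vperm (lact l).

Lemma letterK l x : V8 x -> V8 (lact l x) /\ linv l (lact l x) = x.
Proof. by move=> x8; rewrite lact_V8 ?lactK. Qed.

Lemma glE l v : V8 v -> gl l (octo v) = octo (lact l v).
Proof. exact: vpermE (@letterK l). Qed.

Lemma gl_G l : gl l \in G24_2.
Proof. exact: vperm_auto (@letterK l) (lact_auto l). Qed.

Fixpoint wgl (w : seq nat) : {perm octonion F4} := if w is l :: w' then (wgl w' * gl l)%g else 1%g.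

Lemma wgl_G w : wgl w \in G24_2.
Proof. by elim: w => [|l w IHw]; [apply: group1 | apply: groupM (gl_G l)]. Qed.

Lemma wact_V8 w v : V8 v -> V8 (wact w v).
Proof. by move=> v8; elim: w => //= l w IHw; apply: lact_V8. Qed.

Lemma wglE w v : V8 v -> wgl w (octo v) = octo (wact w v).
Proof. by move=> v8; elim: w => [|l w IHw] /=; rewrite ?perm1 // permM IHw glE ?wact_V8. Qed.

Lemma hat_wgl w v : V8 v -> hat (wgl w) v = wact w v.
Proof. by move=> v8; rewrite /hat wglE // octoK ?wact_V8. Qed.

Lemma wgl_cat v w : wgl (v ++ w) = (wgl w * wgl v)%g.
Proof. by elim: v => [|l v IHv] /=; rewrite ?mulg1 // IHv mulgA. Qed.

Lemma gl_inv l : l < 3 -> exists2 w, all (fun l => l < 3) w & wgl w = (gl l)^-1%g.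
Proof.
move=> l3; exists (if l is 1 then [:: 1; 1] else [:: l]).
  by case: l l3 => [|[|[|]]].
apply/esym/eqP; rewrite eq_invg_mul; apply/eqP/perm_octo => v v8; rewrite permM perm1 glE //.
have -> u : V8 u -> wgl (if l is 1 then [:: 1; 1] else [:: l]) (octo u) = octo (linv l u).
  by move=> u8; rewrite wglE //; case: l l3 => [|[|[|]]].
  by rewrite lactK.
exact: lact_V8.
Qed.

Lemma wgl_inv w : all (fun l => l < 3) w -> exists2 w', all (fun l => l < 3) w' & wgl w' = (wgl w)^-1%g.
Proof.
elim: w => [|l w IHw] /=; first by exists [::]; rewrite ?invg1.
case/andP=> /gl_inv[v v3 Dv] /IHw[w' w3 Dw]; exists (w' ++ v); first by rewrite all_cat w3.
by rewrite wgl_cat Dv Dw invMg.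
Qed.

Lemma represents_word w s p : represents s p -> represents (s ^ wgl w)%g (pact w p).
Proof.
move=> sp; have := represents_conj (wgl_G w) sp.
by case: p sp => a b [/and5P[a8 b8 _ _ _] _]; rewrite /pmap2 /= !hat_wgl.
Qed.

Lemma represents_rows s p p' : represents s p -> special p' -> rows p = rows p' -> represents s p'.
Proof.
move=> [p_sp sp] p'_sp Dr; split=> // v v8; rewrite sp //; congr (octo (vadd _ _)).
move: Dr; rewrite !rowsE // => /eq_in_map Dr.
exact: linear_ext (nn_linear p_sp) (nn_linear p'_sp) Dr v v8.
Qed.

Lemma xf_linear p : special p -> linear_map (xf p).
Proof.
move=> p_sp; have [n8 nD nZ] := nn_linear p_sp.
split=> [x x8|x y x8 y8|c x x8]; first exact: xf_V8.
  by rewrite /xf nD // (vaddACA x8 y8 (n8 _ x8) (n8 _ y8)).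
by rewrite /xf nZ // (scaleD _ x8 (n8 _ x8)).
Qed.

Lemma special_h0 : special h0. Proof. by have [] := andP special_check. Qed.

Lemma xf_h0_app v : V8 v -> xf h0 v = app (map (xf h0) basis) v.
Proof.
move=> v8; rewrite {1}(app_basis v8); apply: (app_linear (xf_linear special_h0) _ _).1 => //.
by rewrite (eqP v8).
Qed.

Definition s0 : {perm octonion F4} := vperm (xf h0).

Lemma xf_h0K x : V8 x -> V8 (xf h0 x) /\ xf h0 (xf h0 x) = x.
Proof.
have lin := xf_linear special_h0; have [h8 _ _] := lin.
split; first exact: h8.
apply: (linear_ext (linear_comp lin lin) linear_id) H => e eb.
by apply/eqP; have /andP[_ /allP/(_ e eb)] := linv_check.
Qed.

Lemma represents_s0 : represents s0 h0.
Proof. by split=> [|v v8]; [exact: special_h0 | exact: vpermE xf_h0K v8]. Qed.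

Lemma s0_G : s0 \in G24_2.
Proof.
apply: (vperm_auto xf_h0K); have lin := xf_linear special_h0; apply: autoL lin _ => x y x8 y8.
have M_in : map (xf h0) basis \in mats by rewrite !inE eqxx !orbT.
have [_ [_ _ appM]] := mats_auto M_in.
by rewrite (xf_h0_app x8) (xf_h0_app y8) (xf_h0_app (mulc_V8 x8 y8)) appM.
Qed.

Lemma represents_1 : represents 1%g (vzero, vzero).
Proof.
have z8 : V8 vzero by [].
split=> [|v v8]; first by [].
have f0 : form v vzero = K0 by rewrite (formC v8 z8) -(scale0 z8) (formZl _ z8 v8).
rewrite perm1 /xf /nn -[(vzero, vzero).1]/vzero -[(vzero, vzero).2]/vzero f0.
by rewrite (scale0 z8) (vadd0 z8) (vadd0 v8).
Qed.

Lemma rows_eq1 s p : represents s p -> (s == 1%g) = (rows p == nseq 8 vzero).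
Proof. by move=> sp; rewrite (rows_eq sp represents_1). Qed.

Lemma allkP P x : allk P -> P x.
Proof. by case/and4P; case: x. Qed.

Lemma sing6P v : V8 v -> mulc v v = vzero -> exists u0 u1 u2 v0 v1 v2, v = sing6 u0 u1 u2 v0 v1 v2.
Proof.
move=> v8 vv; have tr0 := trk_square v8 vv.
case/V8P: (v8) => [a [u0 [u1 [u2 [v0 [v1 [v2 [b Dv]]]]]]]]; rewrite {}Dv in vv tr0 *.
move: vv => [E0 _ _ _ _ _ _ _]; exists u0, u1, u2, v0, v1, v2; rewrite /sing6.
have Da : sqk (addk (mulk u0 v0) (addk (mulk u1 v1) (mulk u2 v2))) = a.
  by move: E0; move: (addk (mulk u0 v0) _) => S; case: a S {tr0} => [] [].
by rewrite Da; congr [:: _; _; _; _; _; _; _; _]; move: tr0; rewrite /trk /=; case: a b {E0 Da} => [] [].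
Qed.

Lemma all_singP P v : all_sing P -> V8 v -> mulc v v = vzero -> P v.
Proof.
move=> PP v8 vv; have [u0 [u1 [u2 [v0 [v1 [v2 ->]]]]]] := sing6P v8 vv.
exact: (allkP v2 (allkP v1 (allkP v0 (allkP u2 (allkP u1 (allkP u0 PP)))))).
Qed.

(** By [depth_check] some letter lowers the tabulated depth of a nonzero vector of square zero, and
    at depth 0 the vector is [ta]. *)
Lemma reach_ta a : V8 a -> mulc a a = vzero -> a != vzero -> exists2 w, all (fun l => l < 3) w & wact w a = ta.
Proof.
move: {2}_.+1 (ltnSn (depth_of a)) => n; elim: n a => // n IHn a a_lt a8 aa a0.
have := all_singP depth_check a8 aa; rewrite (negPf a0); cbv zeta.
case Dn: (depth_of a) => [|m]; first by move/eqP=> ->; exists [::].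
move=> has_l; have /hasP[l l_in l_lt] : has (fun l => depth_of (lact l a) < m.+1) [:: 0; 1; 2] := has_l.
have l3 : l < 3 by move: l_in; rewrite !inE; lia.
have [F8 FD FM] := lact_auto l.
have [|||w w3 Dw] := IHn (lact l a) _ (F8 a a8).
- by move: l_lt a_lt; rewrite Dn; lia.
- by rewrite -FM // aa (auto_zero (lact_auto l)).
- apply: contraNneq a0 => la0; rewrite -(lactK l a8) la0.
  by move: l l3 {l_in l_lt F8 FD FM la0} => [|[|[|//]]] _.
exists (w ++ [:: l]); first by rewrite all_cat w3 /= l3.
by rewrite /wact foldr_cat.
Qed.

Lemma line_vectors b : V8 b -> mulc ta b = vzero -> mulc b ta = vzero ->
  exists x y z, b = [:: K0; x; y; K0; K0; K0; z; K0].
Proof.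
have m0l x : mulk K0 x = K0 by []. have m0r x : mulk x K0 = K0 by case: x.
have m1l x : mulk K1 x = x by case: x. have m1r x : mulk x K1 = x by case: x.
have a0l x : addk K0 x = x by case: x. have a0r x : addk x K0 = x by case: x.
case/V8P=> b0 [b1 [b2 [b3 [b4 [b5 [b6 [b7 ->]]]]]]].
rewrite /mulc /ta; cbv zeta; rewrite !(m0l, m0r, m1l, m1r, a0l, a0r) => E1 E2.
by injection E1; injection E2; intros; subst; exists b1, b2, b6.
Qed.

Lemma line_rows x y z : let r := rows (ta, [:: K0; x; y; K0; K0; K0; z; K0]) in
  (r == nseq 8 vzero) || (r \in [seq rows (pact w h0) | w <- line_words]).
Proof.
pose P x y z := let r := rows (ta, [:: K0; x; y; K0; K0; K0; z; K0]) in
  (r == nseq 8 vzero) || (r \in [seq rows (pact w h0) | w <- line_words]).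
rewrite -/(P x y z); have [check _] := andP line_check.
have check' : allk (fun x => allk (fun y => allk (P x y))) := check.
exact: (allkP z (allkP y (allkP x check'))).
Qed.

Lemma line_words3 w : w \in line_words -> all (fun l => l < 3) w.
Proof. by have [_ /allP] := andP line_check; apply. Qed.

Lemma rootT_conj_line s a b : a != vzero -> represents s (a, b) -> s != 1%g ->
  exists2 w, all (fun l => l < 3) w & s = (s0 ^ wgl w)%g.
Proof.
move=> a0 sab s1; have [/and5P[/= a8 b8 /eqP aa bb _] _] := sab.
have [w w3 Dw] := reach_ta a8 aa a0.
have := represents_word w sab; rewrite /pact /pmap2 /= Dw; set b' := wact w b => sab'.
have [/and5P[/= _ b'8 _ _ /andP[/eqP ab /eqP ba]] _] := sab'.
have [x [y [z Db']]] := line_vectors b'8 ab ba.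
have := line_rows x y z; cbv zeta; rewrite -Db'; move: line_words3.
move: (line_words) => ws ws3 /orP[/eqP r0|/mapP[w' /ws3 w'3 Dr]].
  move: s1; rewrite -(inj_eq (conjg_inj (wgl w))) conj1g => /negP[].
  by rewrite (rows_eq1 sab') r0.
have Ds : (s ^ wgl w = s0 ^ wgl w')%g.
  by apply/eqP; rewrite (rows_eq sab' (represents_word w' represents_s0)) Dr.
have [v v3 Dv] := wgl_inv w3; exists (v ++ w'); first by rewrite all_cat v3.
by rewrite wgl_cat conjgM -Ds Dv conjgK.
Qed.

Lemma rootT_orbit s : s \in rootT -> exists2 w, all (fun l => l < 3) w & s = (s0 ^ wgl w)%g.
Proof.
case/rootTP=> /eqP s1 [[a b] sab]; have [a0|a0] := eqVneq a vzero; last exact: rootT_conj_line a0 sab s1.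
move: s1; rewrite (rows_eq1 sab) => /negP[]; have [/and5P[_ /= + _ _ _] _] := sab.
have f0 x : mulk x K0 = K0 by case: x.
by rewrite a0; vdest b; rewrite /= !f0.
Qed.

Lemma s0_neq1 : s0 != 1%g.
Proof. by rewrite (rows_eq1 represents_s0); have /andP[] := special_check. Qed.

Lemma conj_s0_T g : g \in G24_2 -> (s0 ^ g)%g \in rootT.
Proof.
move=> gG; apply: rootT_conj => //; apply/rootTP; split; first exact/eqP/s0_neq1.
by exists h0; apply: represents_s0.
Qed.

Lemma rootT_sub : rootT \subset G24_2.
Proof.
apply/subsetP=> s /rootT_orbit[w _ ->]; rewrite memJ_norm ?s0_G //.
exact: (subsetP (normG _)) (wgl_G w).
Qed.

Definition stau (k : nat) : {perm octonion F4} := (s0 ^ wgl (nth [::] trans_words k))%g.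
Definition xs (i : positive * nat) : {perm octonion F4} := (stau i.2 ^ wgl (lword (tw i.1)))%g.

Lemma labs13P k : (k \in labs13) = (k < 13). Proof. by rewrite mem_iota. Qed.

Lemma represents_stau k : k < 13 -> represents (stau k) (nth h0 taus k).
Proof.
rewrite -labs13P => /(allP trans_check)/and3P[/eqP Dr tau_sp _].
exact: represents_rows (represents_word _ represents_s0) tau_sp Dr.
Qed.

Lemma xtabE j : j \in pts -> get [::] xtab j = map (pact (lword (tw j))) taus.
Proof.
have idp : map (pact [::]) taus = taus by rewrite -[RHS]map_id; apply: eq_map => -[].
move Dw: (tw j) => w; elim: w j Dw => [|c w IHw] j Dw j_pts.
  by have := allP xtree_check j j_pts; rewrite Dw => /andP[_ /eqP->]; rewrite idp.
have := allP xtree_check j j_pts; rewrite Dw; cbv zeta => /andP[/eqP Di /eqP->].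
by rewrite IHw ?wapp_pts ?pts1 // -map_comp; apply: eq_map => -[].
Qed.

Lemma represents_xs i : known i -> represents (xs i) (xpp i).
Proof.
case: i => j k /andP[/= j_pts k13]; rewrite /xpp /xp /= xtabE // (nth_map h0); last by [].
exact: represents_word (represents_stau k13).
Qed.

Lemma mem_jks i : (i \in jks) = known i.
Proof.
case: i => j k; apply/allpairsP/andP=> [[[j' k'] /= [j'_pts k'_lab [-> ->]]]|[/= j_pts k13]].
  by rewrite -labs13P.
by exists (j, k); rewrite labs13P.
Qed.

Lemma xs_eq i p s : represents s p -> known i -> rows (xpp i) = rows p -> xs i = s.
Proof. by move=> sp ik Dr; apply/eqP; rewrite (rows_eq (represents_xs ik) sp) Dr. Qed.

Lemma xs_inj : {in known &, injective xs}.
Proof.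
move=> i i' ik i'k Dxs; have Dr : rows (xpp i) = rows (xpp i').
  by apply/eqP; rewrite -(rows_eq (represents_xs ik) (represents_xs i'k)) Dxs.
have lookupE t : known t -> klookup (xpp t) = t by rewrite -mem_jks => /(allP klookup_check)/eqP.
by rewrite -(lookupE i ik) -(lookupE i' i'k) /klookup /rkey Dr.
Qed.

(** Conjugation by a letter permutes the labelled root elements as in the table, and the letters 0
    and 1 act on the first coordinate like the generators of J_2 on HJ. *)
Lemma xs_step i l : known i -> l < 3 -> let i' := klookup (pact [:: l] (xpp i)) in
  [/\ known i', (xs i ^ gl l)%g = xs i' & l < 2 -> i'.1 = gen (l == 1) i.1].
Proof.
move=> ik l3 i'; have l_in : l \in [:: 0; 1; 2] by rewrite !inE; lia.
have /and3P[i'k /eqP Dr /implyP Dg] := allP (allP xclosed_check i (etrans (mem_jks i) ik)) l l_in.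
split=> [||/Dg/eqP] //; rewrite -[gl l]mul1g.
by apply/esym/(xs_eq (represents_word [:: l] (represents_xs ik))).
Qed.

Lemma known_root0 : known root0. Proof. by apply/andP; split; [apply: pts1 |]. Qed.

Lemma xs_root0 : xs root0 = s0.
Proof. by apply: (xs_eq represents_s0 known_root0); apply/eqP; vm_cast_no_check (erefl true). Qed.

(** The class is a single orbit under the three letters, and the labelled elements contain [s0] and
    are closed under them. *)
Lemma rootT_xs s : reflect (exists2 i, known i & s = xs i) (s \in rootT).
Proof.
apply: (iffP idP) => [/rootT_orbit[w w3 ->]|[i _ ->]]; last first.
  by rewrite /xs /stau -conjgM conj_s0_T // groupM ?wgl_G.
elim: w w3 => [|l w IHw] /=; first by exists root0; rewrite ?known_root0 // conjg1 xs_root0.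
case/andP=> l3 /IHw[i ik Ds]; have [i'k Ds' _] := xs_step ik l3.
by eexists; [exact: i'k | rewrite conjgM Ds Ds'].
Qed.

Lemma card_rootT : #|rootT| = 4095.
Proof.
have xs_uniq : uniq (map xs jks).
  rewrite map_inj_in_uniq; last by move=> i i'; rewrite !mem_jks; apply: xs_inj.
  apply: allpairs_uniq; [by vm_cast_no_check (erefl true) | by vm_cast_no_check (erefl true) |].
  by move=> [j k] [j' k'] _ _ [-> ->].
have -> : rootT = [set s in map xs jks].
  apply/setP=> s; rewrite [in RHS]inE; apply/rootT_xs/mapP=> [[i ik ->]|[i ik ->]]; exists i => //.
    by rewrite mem_jks.
  by rewrite -mem_jks.
have sz : size (map xs jks) = 4095 by rewrite size_map size_allpairs; vm_cast_no_check (erefl 4095).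
exact: etrans (card_set_seq xs_uniq) sz.
Qed.

(** * The central involutions of G_2(4):2 *)

Lemma xf_ext (F G : vec -> vec) : linear_map F -> linear_map G ->
  reflect (forall v, V8 v -> F v = G v) (all (fun v => F v == G v) basis).
Proof.
move=> Flin Glin; apply: (iffP allP) => [FG v v8|FG v vb].
  by apply: (linear_ext Flin Glin) v8 => e eb; apply/eqP/FG.
by rewrite FG ?eqxx ?basis_V8.
Qed.

Lemma xf_comp_linear p q : special p -> special q -> linear_map (fun v => xf p (xf q v)).
Proof. by move=> p_sp q_sp; apply: (linear_comp (xf_linear p_sp) (xf_linear q_sp)). Qed.

Lemma represents_mul s t p q v : represents s p -> represents t q -> V8 v ->
  (s * t)%g (octo v) = octo (xf q (xf p v)).
Proof. by move=> [p_sp sp] [q_sp tq] v8; rewrite permM sp // tq ?xf_V8. Qed.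

Lemma commute_rep s t p q : represents s p -> represents t q -> reflect (commute s t) (xcommute p q).
Proof.
move=> sp tq; have [p_sp _] := sp; have [q_sp _] := tq.
apply: (iffP (xf_ext (xf_comp_linear p_sp q_sp) (xf_comp_linear q_sp p_sp))) => [com|com v v8].
  by apply: perm_octo => v v8; rewrite (represents_mul sp tq) // (represents_mul tq sp) // com.
apply: octo_inj; rewrite ?xf_V8 //.
by rewrite -(represents_mul sp tq) // -(represents_mul tq sp) // com.
Qed.

Lemma same_productP s t u p q r : represents s p -> represents t q -> represents u r ->
  same_product p q r -> (s * t)%g = u.
Proof.
move=> sp tq ur; have [p_sp _] := sp; have [q_sp _] := tq; have [r_sp ru] := ur.
move/(xf_ext (xf_comp_linear q_sp p_sp) (xf_linear r_sp)) => E; apply: perm_octo => v v8.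
by rewrite (represents_mul sp tq) // E // ru.
Qed.

Lemma clist_known i : i \in clist -> known i.
Proof. by rewrite -mem_jks; have /andP[_ /allP] := clist_check; apply. Qed.

Lemma commute_s0 i : known i -> reflect (commute (xs i) s0) (i \in clist).
Proof.
rewrite -mem_jks => i_jks; have /andP[/allP/(_ i i_jks)/eqP <- _] := clist_check.
by apply: commute_rep; [apply: represents_xs; rewrite -mem_jks | apply: represents_s0].
Qed.

Lemma centT s : reflect (exists2 i, i \in clist & s = xs i) (s \in rootT :&: 'C[s0])%g.
Proof.
apply: (iffP setIP) => [[/rootT_xs[i ik ->] /cent1P com]|[i ic ->]].
  by exists i => //; apply: (introT (commute_s0 ik)); apply: commute_sym.
have ik := clist_known ic; split; first by apply/rootT_xs; exists i.
by apply/cent1P; apply: (elimT (commute_s0 ik)).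
Qed.

Definition ew : {perm octonion F4} := xs (1%positive, 6).
Definition ev : {perm octonion F4} := xs (1%positive, 12).
Definition eperms := [:: s0; ew; ev].

Lemma known6 : known (1%positive, 6). Proof. by apply/andP; split; [apply: pts1 |]. Qed.
Lemma known12 : known (1%positive, 12). Proof. by apply/andP; split; [apply: pts1 |]. Qed.

Lemma represents_e e : e \in epairs -> exists2 s, s \in eperms & represents s e.
Proof.
rewrite !inE => /or3P[]/eqP->.
- exists s0; first exact: mem_head.
  exact: represents_s0.
- exists ew; last exact: (represents_xs known6).
  by rewrite in_cons mem_head orbT.
exists ev; last exact: (represents_xs known12).
by rewrite !in_cons eqxx !orbT.
Qed.

Lemma s0ew : (s0 * ew)%g = ev.
Proof.
apply: (same_productP represents_s0 (represents_xs known6) (represents_xs known12)).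
by have /andP[] := ecent_check.
Qed.

Lemma order_rootT s : s \in rootT -> #[s]%g = 2.
Proof.
case/rootT_orbit=> w _ ->; rewrite orderJ; apply: nt_prime_order s0_neq1 => //.
apply: perm_octo => v v8; rewrite expgS expg1 (represents_mul represents_s0 represents_s0) // perm1.
by have [_ ->] := xf_h0K v8.
Qed.

Lemma e_cent e i : e \in [:: s0; ew] -> i \in clist -> commute e (xs i).
Proof.
move=> e_in ic; have /andP[/andP[/and3P[c0 c1 _] _] _] := ecent_check.
move: e_in; rewrite !inE => /orP[]/eqP->.
  exact/(commute_rep represents_s0 (represents_xs (clist_known ic)))/(allP c0).
exact/(commute_rep (represents_xs known6) (represents_xs (clist_known ic)))/(allP c1).
Qed.

Definition Egrp : {group {perm octonion F4}} := (<[s0]> <*> <[ew]>)%G.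

Lemma s0_clist : root0 \in clist.
Proof. by vm_cast_no_check (erefl true). Qed.
Lemma ew_clist : (1%positive, 6) \in clist.
Proof. by vm_cast_no_check (erefl true). Qed.

Lemma eperms_Egrp s : s \in eperms -> s \in Egrp.
Proof.
have s0E : s0 \in Egrp by rewrite mem_gen // inE cycle_id.
have ewE : ew \in Egrp by rewrite mem_gen // inE cycle_id orbT.
rewrite in_cons => /predU1P[-> //|]; rewrite in_cons => /predU1P[-> //|].
by rewrite mem_seq1 => /eqP->; rewrite -s0ew groupM.
Qed.

Lemma ew_T : ew \in rootT. Proof. by apply/rootT_xs; exists (1%positive, 6); rewrite ?known6. Qed.
Lemma s0_T : s0 \in rootT. Proof. by rewrite -[s0]conjg1 conj_s0_T ?group1. Qed.

Section Centralizer.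
Variable z : {perm octonion F4}.
Hypothesis zG : z \in G24_2.
Hypothesis z_com : forall i, i \in clist -> commute z (xs i).
Let Z := hat z.
Let Z_auto : auto_vec Z := hat_auto zG.

Lemma cent_nn p v : p \in cprog_pairs -> V8 v -> Z (nn p v) = nn p (Z v).
Proof.
move=> p_in v8; have /and4P[/allP/(_ p p_in)/andP[p_sp /andP[ic /eqP Dr]] _ _ _] := cprog_check.
set i := klookup p in ic Dr; have ik := clist_known ic.
have [_ si] := represents_rows (represents_xs ik) p_sp Dr.
have [Z8 ZD ZM] := Z_auto.
have: Z (xf p v) = xf p (Z v).
  apply: octo_inj; rewrite ?Z8 ?xf_V8 ?Z8 // octo_hat -!si ?Z8 // octo_hat.
  by rewrite -!permM z_com.
by rewrite /xf ZD ?nn_V8 // => /vadd_inj -> //; rewrite ?Z8 ?nn_V8.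
Qed.

Lemma nth_basis_V8 i : V8 (nth vzero basis i).
Proof. by do 8!(case: i => [//|i]); rewrite nth_default. Qed.

Lemma cprog_pairs_nth i : i < 9 -> nth h0 cprog_pairs i \in cprog_pairs.
Proof. by move=> i9; apply: mem_nth. Qed.

Lemma cprog_special p : p \in cprog_pairs -> special p.
Proof. by have /and4P[/allP + _ _ _] := cprog_check => /[apply] /andP[]. Qed.

Lemma cent_zero v : V8 v -> (Z v == vzero) = (v == vzero).
Proof.
move=> v8; apply/eqP/eqP=> [Zv0|->]; last exact: auto_zero Z_auto.
apply: octo_inj => //; apply: (@perm_inj _ z); rewrite -!octo_hat -/Z Zv0.
by rewrite (auto_zero Z_auto).
Qed.

Lemma cond_cent v : V8 v -> cond_y (Z v) = cond_y v.
Proof.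
move=> v8; have [Z8 ZD ZM] := Z_auto.
have n_in i : i < 9 -> nth h0 cprog_pairs i \in cprog_pairs := @cprog_pairs_nth i.
have n8 i u : i < 9 -> V8 (nn (nth h0 cprog_pairs i) u).
  by move=> i9; apply/nn_V8/cprog_special/n_in.
have nZ i : i < 9 -> nn (nth h0 cprog_pairs i) (Z v) = Z (nn (nth h0 cprog_pairs i) v).
  by move=> i9; rewrite cent_nn ?n_in.
rewrite /cond_y; cbv zeta; rewrite !nZ //.
have rel a b : V8 a -> V8 b ->
    (vadd (Z v) (vadd (mulc (Z v) (Z a)) (mulc (Z b) (Z v))) == vzero) = (vadd v (vadd (mulc v a) (mulc b v)) == vzero).
  move=> a8 b8; have va8 := mulc_V8 v8 a8; have bv8 := mulc_V8 b8 v8.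
  by rewrite -(ZM v a v8 a8) -(ZM b v b8 v8) -(ZD _ _ va8 bv8) -(ZD _ _ v8 (vadd_V8 va8 bv8)) cent_zero // !vadd_V8.
by rewrite !rel ?n8 // !cent_zero ?n8.
Qed.

Lemma cent_image : exists2 e, e \in Egrp & z (octo vE3) = e (octo vE3).
Proof.
have /and4P[_ c0 /eqP sq0 check] := cprog_check; have [Z8 ZD ZM] := Z_auto.
have e8 : V8 vE3 := nth_basis_V8 3.
have y8 := Z8 _ e8; have yy : mulc (Z vE3) (Z vE3) = vzero.
  by rewrite -(ZM _ _ e8 e8) sq0; exact: auto_zero Z_auto.
pose P y := (y == vzero) || ~~ cond_y y || (y == vE3) || has (fun e => y == xf e vE3) epairs.
have := @all_singP P _ check y8 yy; rewrite /P (cond_cent e8) c0 (cent_zero e8) !orbF.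
have -> : (vE3 == vzero) = false by [].
rewrite orFb => /orP[/eqP ZE|/hasP[e /represents_e[s s_in [e_sp se]] /eqP ZE]].
  exists 1%g; first exact: group1.
  by rewrite perm1 -[X in _ = octo X]ZE; apply/esym/octo_hat.
exists s; first exact: eperms_Egrp.
by rewrite (se _ e8) -ZE; apply/esym/octo_hat.
Qed.

(** The vectors fixed by [z] are closed under sums, products and the nine maps, so from E_3 they
    come to include e and w e for every basis vector e, and these generate everything. *)
Lemma cent_fix : z (octo vE3) = octo vE3 -> z = 1%g.
Proof.
move=> zE; have [Z8 ZD ZM] := Z_auto; have e8 : V8 vE3 := nth_basis_V8 3.
have ZE : Z vE3 = vE3 by rewrite /Z /hat zE octoK.
pose fixv v := V8 v && (Z v == v).
have fixv0 : fixv vzero by rewrite /fixv (auto_zero Z_auto) eqxx.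
have fixD u v : fixv u -> fixv v -> fixv (vadd u v).
  by move=> /andP[u8 /eqP uZ] /andP[v8 /eqP vZ]; rewrite /fixv vadd_V8 // ZD // uZ vZ eqxx.
have fixM u v : fixv u -> fixv v -> fixv (mulc u v).
  by move=> /andP[u8 /eqP uZ] /andP[v8 /eqP vZ]; rewrite /fixv mulc_V8 // ZM // uZ vZ eqxx.
have fixN i v : i < 9 -> fixv v -> fixv (nn (nth h0 cprog_pairs i) v).
  move=> i9 /andP[v8 /eqP vZ]; have p_in := cprog_pairs_nth i9.
  by rewrite /fixv nn_V8 ?cprog_special // cent_nn // vZ eqxx.
have fix_nth ts i : all fixv ts -> fixv (nth vzero ts i).
  by move=> /all_nthP ts_fix; have [/ts_fix->|?] := ltnP i (size ts); rewrite ?nth_default.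
have fix_prog : all fixv (run_prog vE3).
  rewrite /run_prog; have : all (fun o : nat * nat + nat * nat => if o is inl ij then ij.1 < 9 else true) cprog by [].
  have : all fixv [:: vE3] by rewrite /= /fixv e8 ZE eqxx.
  elim: cprog [:: vE3] => //= o os IHo ts ts_fix /andP[o_ok os_ok]; apply: IHo => //.
  rewrite all_rcons ts_fix andbT; case: o o_ok => [[i j] i9|[i j] _] /=.
    by apply: fixN => //; apply: fix_nth.
  by apply: fixM; apply: fix_nth.
have fix_masks : all fixv [seq foldr (fun t => vadd (nth vzero (run_prog vE3) t)) vzero m | m <- cmasks].
  move: (run_prog _) fix_prog => ts ts_fix.
  elim: cmasks => //= m ms ->; rewrite andbT; elim: m => //= t m IHm; apply: fixD => //.
  exact: fix_nth.
have fix12 e c : e \in basis -> c \in [:: K1; K2] -> fixv (scale c e).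
  move=> eb c_in; apply: (allP fix_masks).
  have := cmasks_check; cbv zeta; move: [seq _ | m <- cmasks] => ts /eqP->.
  by apply/flattenP; exists [:: scale K1 e; scale K2 e]; [apply: map_f | apply: (map_f (scale^~ e) c_in)].
have fixc e c : e \in basis -> fixv (scale c e).
  move=> eb; have e'8 := basis_V8 eb; case: c.
  - by rewrite scale0.
  - by rewrite fix12.
  - by rewrite fix12.
  by rewrite -[K3]/(addk K1 K2) scaleDl // fixD ?fix12.
apply: perm_octo => v v8; rewrite perm1 -octo_hat; congr octo; apply/eqP.
suffices /andP[] : fixv v by [].
rewrite (app_basis v8); have: {subset basis <= basis} by [].
elim: {-2}basis v {v8} => [|e es IHe] [|c v] //= sub.
apply: fixD; first by apply: fixc; rewrite sub ?mem_head.
by apply: IHe => x xs; apply: sub; rewrite inE xs orbT.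
Qed.
End Centralizer.

(** Some [e] in the four-group has the same effect on E_3 as [z], and then [cent_fix] applies to z
    e^-1. *)
Lemma cent_Egrp z : z \in G24_2 -> (forall i, i \in clist -> commute z (xs i)) -> z \in Egrp.
Proof.
move=> zG z_com; have [e eE ze] := cent_image zG z_com.
have EG : Egrp \subset G24_2.
  by rewrite join_subG !cycle_subG (subsetP rootT_sub _ s0_T) (subsetP rootT_sub _ ew_T).
have e_com i : i \in clist -> commute e (xs i).
  move=> ic; have: Egrp \subset 'C[xs i]%g.
    by rewrite join_subG !cycle_subG; apply/andP; split; apply/cent1P; apply: e_cent; rewrite ?mem_head // inE mem_head orbT.
  by move/subsetP/(_ e eE)/cent1P => com; apply: commute_sym.
have: (z * e^-1 = 1)%g.
  apply: cent_fix; first by rewrite groupM // groupV (subsetP EG).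
    by move=> i ic; apply/commute_sym/commuteM; [apply: commute_sym; apply: z_com | apply: commuteV; apply: commute_sym; apply: e_com].
  by rewrite permM ze permK.
by move/(canRL (mulgKV e)); rewrite mul1g => ->.
Qed.

Lemma Egrp_T z : z \in Egrp -> #[z]%g = 2 -> z \in rootT.
Proof.
have com : commute s0 ew by apply: e_cent ew_clist; rewrite inE eqxx.
have cE : (<[ew]> \subset 'C(<[s0]>))%g
  by rewrite cycle_subG; apply/centP=> _ /cycleP[k ->]; apply: commuteX; apply: commute_sym.
rewrite /= (cent_joinEr cE).
have sq s : s \in rootT -> (s ^+ 2 = 1)%g by move=> sT; rewrite -(order_rootT sT) expg_order.
case/imset2P=> _ _ /cycleP[m ->] /cycleP[n ->] -> oz.
have red s k : s \in rootT -> (s ^+ k = s ^+ odd k)%g.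
  by move=> sT; rewrite -{1}(odd_double_half k) expgD -mul2n expgM sq // expg1n mulg1.
rewrite (red _ m s0_T) (red _ n ew_T) in oz *; case: (odd m) (odd n) oz => [] [] /=; rewrite ?expg0 ?expg1 ?mulg1 ?mul1g.
- by move=> _; rewrite s0ew; apply/rootT_xs; exists (1%positive, 12); rewrite ?known12.
- by move=> _; apply: s0_T.
- by move=> _; apply: ew_T.
by rewrite order1.
Qed.

Lemma central_G24 : central_involutions G24_2 = rootT.
Proof.
apply: (@central_involutionsE _ G24_2 Egrp _ s0).
- exact: rootT_sub.
- by move=> x g xT gG; apply: rootT_conj.
- by move=> x /rootT_orbit[w _ ->]; exists (wgl w); first exact: wgl_G.
- by rewrite card_rootT.
- exact: order_rootT s0_T.
- have com : commute s0 ew by apply: e_cent ew_clist; rewrite inE eqxx.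
  have cE : (<[ew]> \subset 'C(<[s0]>))%g
  by rewrite cycle_subG; apply/centP=> _ /cycleP[k ->]; apply: commuteX; apply: commute_sym.
rewrite /= (cent_joinEr cE).
  by rewrite pgroupM /pgroup -!orderE !order_rootT ?s0_T ?ew_T.
- rewrite join_subG !cycle_subG; apply/andP.
  by split; apply/centP=> x /centT[i ic ->]; apply: e_cent => //; rewrite ?mem_head // in_cons mem_head orbT.
- rewrite join_subG !cycle_subG !mem_gen //; apply/centT; first by exists (1%positive, 6); rewrite ?ew_clist.
  by exists root0; rewrite ?xs_root0 // s0_clist.
- move=> _ _ /centT[i ic ->] /centT[i' i'c ->]; have ik := clist_known ic; have i'k := clist_known i'c.
  have rx := represents_xs ik; have rx' := represents_xs i'k; have [p_sp px] := rx; have [p'_sp px'] := rx'.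
  have i'G : xs i' \in G24_2 by apply: (subsetP rootT_sub); apply/rootT_xs; exists i'.
  have hatx v : V8 v -> hat (xs i') v = xf (xpp i') v by move=> v8; rewrite /hat px' // octoK ?xf_V8.
  have := represents_conj i'G rx; rewrite /pmap2 !hatx; try by have [/and5P[]] := rx.
  move=> [c_sp cx]; have /allP/(_ i ic)/allP/(_ i' i'c) := cconj_check; cbv zeta.
  rewrite mem_lcoset => /orP[|/hasP[e]].
    move/(xf_ext (xf_linear c_sp) (xf_linear p_sp)) => E.
    suffices -> : (xs i ^ xs i' = xs i)%g by rewrite mulVg group1.
    by apply: perm_octo => v v8; rewrite cx // E // px.
  case/represents_e=> s s_in rs; have [e_sp se] := rs.
  move/(xf_ext (xf_linear c_sp) (xf_comp_linear e_sp p_sp)) => E.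
  suffices -> : (xs i ^ xs i' = xs i * s)%g by rewrite mulKg eperms_Egrp.
  by apply: perm_octo => v v8; rewrite cx // E // (represents_mul rx rs).
move=> z zG /centP zC oz; apply: Egrp_T oz; apply: cent_Egrp => // i ic.
by apply: zC; apply/centT; exists i.
Qed.

(** * Four-groups and their normalizers *)

Section FourGroups.
Local Open Scope group_scope.
Variable gT : finGroupType.
Implicit Types a b s t : gT.

Lemma gen_four a b : #[a] = 2 -> #[b] = 2 -> commute a b -> <<[set a; b]>> = [set 1; a; b; a * b].
Proof.
move=> oa ob com; have [aa bb] : a * a = 1 /\ b * b = 1.
  by split; [rewrite -[RHS](expg_order a) oa | rewrite -[RHS](expg_order b) ob]; rewrite expgS expg1.
have fourG : group_set [set 1; a; b; a * b].
  apply/group_setP; split=> [|x y]; first by rewrite !inE eqxx.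
  have E1 : a * (a * b) = b by rewrite mulgA aa mul1g.
  have E2 : b * a = a * b by [].
  have E3 : b * (a * b) = a by rewrite mulgA E2 -mulgA bb mulg1.
  have E4 : a * b * a = b by rewrite -mulgA E2 mulgA aa mul1g.
  have E5 : a * b * b = a by rewrite -mulgA bb mulg1.
  have E6 : a * b * (a * b) = 1 by rewrite mulgA E4 bb.
  rewrite !inE -!orbA => /or4P[]/eqP-> /or4P[]/eqP->;
    by rewrite ?mul1g ?mulg1 ?aa ?bb ?E1 ?E2 ?E3 ?E4 ?E5 ?E6 eqxx ?orbT.
have sub : <<[set a; b]>> \subset Group fourG.
  by rewrite gen_subG; apply/subsetP=> x; rewrite !inE => /orP[]/eqP->; rewrite eqxx ?orbT.
apply/eqP; rewrite eqEsubset; apply/andP; split; first exact: sub.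
apply/subsetP=> x; rewrite !inE -!orbA => /or4P[]/eqP->; rewrite ?group1 // ?groupM //;
  by rewrite mem_gen // !inE eqxx ?orbT.
Qed.

Lemma card_four a b : #[a] = 2 -> #[b] = 2 -> commute a b -> a != b -> #|<<[set a; b]>>| = 4.
Proof.
move=> oa ob com ab; rewrite gen_four // -setUA -setUA cardsU1 !inE cardsU1 !inE cards2.
have neq1 x : #[x] = 2 -> x != 1 by move=> ox; apply: contra_eqN ox => /eqP->; rewrite order1.
have b_ab : b != a * b by rewrite eq_sym -{2}[b]mul1g (inj_eq (mulIg b)) neq1.
have a_ab : a != a * b by rewrite eq_sym -{2}[a]mulg1 (inj_eq (mulgI a)) neq1.
have ab1 : 1 != a * b.
  rewrite eq_sym -eq_invg_mul; apply: contraNneq ab => <-; rewrite eq_sym eq_invg_mul -[a * a](expgS a 1).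
  by rewrite -oa expg_order.
by rewrite b_ab !negb_or ab a_ab ab1 ![1 == _]eq_sym (negPf (neq1 _ a oa)) (negPf (neq1 _ b ob)).
Qed.

Lemma four_gen a b s t : #[a] = 2 -> #[b] = 2 -> commute a b -> a != b ->
  s \in <<[set a; b]>> -> t \in <<[set a; b]>> -> s != 1 -> t != 1 -> s != t -> <<[set s; t]>> = <<[set a; b]>>.
Proof.
move=> oa ob com ab sV tV s1 t1 st; apply/eqP.
have order2 x : x \in <<[set a; b]>> -> x != 1 -> #[x] = 2.
  have [aa bb] : a * a = 1 /\ b * b = 1.
    by split; [rewrite -[RHS](expg_order a) oa | rewrite -[RHS](expg_order b) ob]; rewrite expgS expg1.
  rewrite gen_four // !inE -!orbA => /or4P[]/eqP->; rewrite ?eqxx // => x1.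
  by apply: nt_prime_order => //; rewrite expgS expg1 -mulgA (mulgA b) -com -mulgA bb mulg1 aa.
have com_st : commute s t.
  have abV : abelian <<[set a; b]>>.
    rewrite abelian_gen; apply/centsP=> x xab y yab.
    by case/set2P: xab => ->; case/set2P: yab => ->; rewrite /commute ?com.
  exact: (centsP abV).
rewrite eqEcard gen_subG subUset !sub1set sV tV /= card_four // card_four //; exact: order2.
Qed.
End FourGroups.

Section IndexCount.
Local Open Scope group_scope.
Variables (gT : finGroupType) (G : {group gT}) (T : {set gT}) (s0 b : gT).
Hypothesis TG : T \subset G.
Hypothesis TJ : forall x g, x \in T -> g \in G -> x ^ g \in T.
Hypothesis T_trans : forall x, x \in T -> exists2 g, g \in G & x = s0 ^ g.
Hypothesis T2 : forall x, x \in T -> #[x] = 2.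
Hypothesis s0T : s0 \in T.
Hypothesis bT : b \in T.
Hypothesis s0bT : s0 * b \in T.
Hypothesis com : commute s0 b.
Hypothesis s0_neq_b : s0 != b.
Local Notation V := <<[set s0; b]>>.
Local Notation Omega := (V :^: G).

Definition span_mates (s : gT) : {set gT} := [set t in T | (t != s) && (<<[set s; t]>> \in Omega)].

Lemma four_J (s t g : gT) : <<[set s; t]>> :^ g = <<[set s ^ g; t ^ g]>>.
Proof. by rewrite -genJ conjUg !conjg_set1. Qed.

Lemma Omega_J (A : {set gT}) g : g \in G -> (A :^ g \in Omega) = (A \in Omega).
Proof.
move=> gG; apply/imsetP/imsetP=> [[h hG DA]|[h hG ->]].
  exists (h * g^-1); first by rewrite groupM ?groupV.
  by rewrite conjsgM -DA conjsgK.
by exists (h * g); rewrite ?groupM // conjsgM.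
Qed.

Lemma span_mates_J s g : s \in T -> g \in G -> #|span_mates (s ^ g)| = #|span_mates s|.
Proof.
move=> sT gG; rewrite -(cardJg (span_mates s) g); congr #|pred_of_set _|; apply/setP=> t.
rewrite -[t](conjgKV g) memJ_conjg !inE (inj_eq (conjg_inj g)) -four_J Omega_J //.
congr (_ && _); apply/idP/idP=> [/TJ/(_ (groupVr gG))|/TJ/(_ gG) //].
by rewrite conjgK.
Qed.

Lemma V_nontriv x : x \in V -> x != 1 -> x \in T.
Proof.
rewrite gen_four ?T2 // !inE -!orbA => /or4P[]/eqP-> //; by rewrite eqxx.
Qed.

(* Both sides count the pairs of elements of [T] generating a conjugate of [V]. *)
Lemma index_count : (6 * #|G : 'N_G(V)| = #|T| * #|span_mates s0|)%N.
Proof.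
rewrite -card_conjugates.
pose P := [pred p : gT * gT | [&& p.1 \in T, p.2 \in T, p.2 != p.1 & <<[set p.1; p.2]>> \in Omega]].
transitivity (\sum_(p | P p) 1)%N.
  rewrite (partition_big (fun p : gT * gT => <<[set p.1; p.2]>>) (mem Omega)) /=; last by move=> p /and4P[].
  rewrite (eq_bigr (fun=> 6)) ?sum_nat_const ?[(_ * 6)%N]mulnC // => A A_in.
  have [g gG DA] := imsetP A_in.
  have pairsP p : (P p && (<<[set p.1; p.2]>> == A)) = (p.1 \in A^#) && (p.2 \in A^# :\ p.1).
    have A_T x : x \in A^# -> x \in T.
      rewrite !inE DA -{1 2}[x](conjgKV g) memJ_conjg -[1](conj1g g) (inj_eq (conjg_inj g)).
      by move=> /andP[x1 xV]; rewrite -[x](conjgKV g) TJ // V_nontriv.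
    apply/andP/andP=> [[/and4P[sT tT ts _] /eqP <-]|[sA]].
      have neq1 x : x \in T -> x != 1 by move/T2; apply: contra_eqN => /eqP->; rewrite order1.
      by rewrite !in_setD1 !neq1 //= ts !mem_gen // !inE eqxx ?orbT.
    rewrite in_setD1 => /andP[ts tA]; have DA' : <<[set p.1; p.2]>> = A.
      move: sA tA; rewrite !in_setD1 DA !mem_conjg => /andP[s1 sV] /andP[t1 tV].
      rewrite -[p.1](conjgKV g) -[p.2](conjgKV g) -four_J; congr (_ :^ g).
      have J1 x : (x ^ g^-1 == 1) = (x == 1) by rewrite -{1}(conj1g g^-1) (inj_eq (conjg_inj _)).
      by apply: four_gen; rewrite ?T2 ?J1 // (inj_eq (conjg_inj _)) eq_sym.
    split; last exact/eqP.
    by rewrite /P /= DA' (A_T _ sA) (A_T _ tA) ts A_in.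
  rewrite (eq_bigl _ _ pairsP) sum1_card.
  have cA : #|A^#| = 3.
    have A4 : #|A| = 4 by rewrite DA cardJg card_four ?T2.
    have A1 : 1 \in A by rewrite DA -(conj1g g) memJ_conjg group1.
    by have := cardsD1 1 A; rewrite A1 A4 add1n => -[<-].
  rewrite -sum1_card -(pair_big_dep (fun s => s \in A^#) (fun s t => t \in A^# :\ s) (fun _ _ => 1%N)) /=.
  rewrite (eq_bigr (fun=> 2)) ?sum_nat_const ?cA // => s sA.
  by rewrite sum1_card; have := cardsD1 s A^#; rewrite sA cA add1n => -[].
rewrite -(pair_big_dep (fun s => s \in T) (fun s t => [&& t \in T, t != s & <<[set s; t]>> \in Omega]) (fun _ _ => 1%N)) /=.
rewrite (eq_bigr (fun=> #|span_mates s0|)) ?sum_nat_const // => s sT.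
have [g gG Ds] := T_trans sT; rewrite -(span_mates_J s0T gG) -Ds -sum1_card.
by apply: eq_bigl => t; rewrite inE.
Qed.
End IndexCount.

Lemma combination_elim x1 x2 y1 y2 a b : V8 a -> V8 b ->
  vadd (scale y1 (vadd (scale x1 b) (scale x2 a))) (scale x1 (vadd (scale y1 b) (scale y2 a))) =
  scale (addk (mulk y1 x2) (mulk x1 y2)) a.
Proof.
move=> a8 b8; have z8 : V8 vzero by [].
rewrite (scaleD _ (scale_V8 x1 b8) (scale_V8 x2 a8)) (scaleD _ (scale_V8 y1 b8) (scale_V8 y2 a8)).
rewrite !(scaleA _ _ a8) !(scaleA _ _ b8) (vaddACA (scale_V8 _ b8) (scale_V8 _ a8) (scale_V8 _ b8) (scale_V8 _ a8)).
rewrite (mulkC x1 y1) (vaddx (scale_V8 _ b8)) -(scaleDl _ _ a8).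
by rewrite (vaddC z8 (scale_V8 _ a8)) (vadd0 (scale_V8 _ a8)).
Qed.

Lemma mem_span2 p x y : vadd (scale x p.1) (scale y p.2) \in span2 p.
Proof. by apply/allpairsP; exists (x, y); case: x; case: y. Qed.

(** The image of n_ab lies in the span of a and b and contains the independent vectors [p.1] and
    [p.2]. Hence the determinant of their coordinates is nonzero, and a and b can be solved for. *)
Lemma in_span2 s p a b : represents s p -> spanning p -> represents s (a, b) -> a \in span2 p /\ b \in span2 p.
Proof.
move=> [p_sp sp] /and3P[/hasP[v1 v1b /eqP D1] /hasP[v2 v2b /eqP D2] indep] [ab_sp sab].
have [/and5P[/= a8 b8 _ _ _] /and5P[/= c8 d8 _ _ _]] := (ab_sp, p_sp).
have nnE v : V8 v -> nn p v = nn (a, b) v.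
  move=> v8; have := sp v v8; rewrite sab // => /octo_inj; rewrite !xf_V8 // => /(_ isT isT).
  by move/vadd_inj => -> //; apply: nn_V8.
have [v18 v28] := (allP test_vecs_V8 _ v1b, allP test_vecs_V8 _ v2b).
move: D1 D2; rewrite !nnE // /nn /=; set f1 := form v1 a; set f2 := form v1 b; set g1 := form v2 a; set g2 := form v2 b.
move=> D1 D2; pose det := addk (mulk g1 f2) (mulk f1 g2).
have Da : vadd (scale g1 p.1) (scale f1 p.2) = scale det a by rewrite -D1 -D2 combination_elim.
have Db : vadd (scale g2 p.1) (scale f2 p.2) = scale det b.
  rewrite -D1 -D2 (vaddC (scale_V8 f1 b8) (scale_V8 f2 a8)) (vaddC (scale_V8 g1 b8) (scale_V8 g2 a8)).
  by rewrite (combination_elim _ _ _ _ b8 a8) /det; congr (scale _ b); rewrite addkC (mulkC g2) (mulkC f2).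
have ind x y : vadd (scale x p.1) (scale y p.2) = vzero -> x = K0 /\ y = K0.
  move=> E; have in4 t : t \in k4s by case: t.
  by have /implyP/(_ (introT eqP E))/andP[/eqP-> /eqP->] := allP (allP indep x (in4 x)) y (in4 y).
have det0 : det != K0.
  apply/eqP=> d0; have [_ f10] := ind g1 f1 (etrans Da (etrans (congr1 (scale^~ a) d0) (scale0 a8))).
  have [_ f20] := ind g2 f2 (etrans Db (etrans (congr1 (scale^~ b) d0) (scale0 b8))).
  have z8 : V8 vzero by [].
  have c0 : p.1 = vzero by rewrite -D1 f10 f20 !scale0.
  have [] // := ind K1 K0; by rewrite c0 (scale0 d8).
(* Nonzero elements of the field satisfy x^3 = 1, so the square is the inverse. *)
have invE v : V8 v -> v = scale (sqk det) (scale det v).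
  by move=> v8; rewrite (scaleA _ _ v8) -[LHS](scale1 v8); congr (scale _ v); case: (det) det0.
have comb k x y : scale k (vadd (scale x p.1) (scale y p.2)) = vadd (scale (mulk k x) p.1) (scale (mulk k y) p.2).
  by rewrite (scaleD _ (scale_V8 _ c8) (scale_V8 _ d8)) !scaleA.
by rewrite (invE a a8) (invE b b8) -Da -Db !comb !mem_span2.
Qed.

Definition reaches (r i : positive * nat) : Prop :=
  exists g, [/\ g \in G24_2, (s0 ^ g = s0)%g & (xs r ^ g = xs i)%g].

Lemma orb_reaches r seen l : (forall i, i \in seen -> known i /\ reaches r i) -> all (fun t => known t.1.1) l ->
  orb_ok seen l -> forall t, t \in l -> reaches r t.1.1.
Proof.
elim: l seen => [|[[i' i] w] l IHl] seen seenP //= /andP[i'k lk] /and4P[i_seen wf /eqP Dr ok] t.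
have [ik [g [gG s0g rg]]] := seenP i i_seen.
have s0w : (s0 ^ wgl w = s0)%g.
  apply/eqP; rewrite (rows_eq (represents_word w represents_s0) represents_s0).
  by have /andP[/allP/(_ w wf)] := fixers_check.
have reach_i' : reaches r i'.
  exists (g * wgl w)%g; split; first exact: groupM gG (wgl_G w).
    by rewrite conjgM s0g.
  by rewrite conjgM rg; apply/esym/(xs_eq (represents_word w (represents_xs ik)) i'k Dr).
rewrite inE => /predU1P[-> //|]; apply: IHl ok t => // i0; rewrite inE => /predU1P[->|/seenP] //.
Qed.

Lemma reaches_refl r : reaches r r.
Proof. by exists 1%g; rewrite group1 !conjg1. Qed.

Lemma known_classes i : i \in root0 :: class1 ++ class2 ++ class3 -> known i.
Proof. by rewrite -mem_jks; have /and5P[_ _ _ _ /and3P[_ _ /allP]] := classes_check; apply. Qed.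

Lemma class_cons r l (cl := r :: map (fun t => t.1.1) l) :
  {subset cl <= root0 :: class1 ++ class2 ++ class3} -> orb_ok [:: r] l -> forall i, i \in cl -> reaches r i.
Proof.
move=> sub ok i; rewrite inE => /predU1P[->|/mapP[t t_in ->]]; first exact: reaches_refl.
have clk t' : t' \in cl -> known t' by move/sub/known_classes.
apply: orb_reaches ok t t_in.
  by move=> i0; rewrite mem_seq1 => /eqP->; split; [apply: clk; rewrite inE eqxx | apply: reaches_refl].
by apply/allP=> t' t'_in; apply: clk; rewrite inE (map_f (fun t => t.1.1) t'_in) orbT.
Qed.

Lemma class_sub1 : {subset class1 <= root0 :: class1 ++ class2 ++ class3}.
Proof. by move=> i i1; rewrite inE mem_cat i1 orbT. Qed.
Lemma class_sub2 : {subset class2 <= root0 :: class1 ++ class2 ++ class3}.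
Proof. by move=> i i2; rewrite inE !mem_cat i2 !orbT. Qed.
Lemma class_sub3 : {subset class3 <= root0 :: class1 ++ class2 ++ class3}.
Proof. by move=> i i3; rewrite inE !mem_cat i3 !orbT. Qed.

Lemma class1_reaches i : i \in class1 -> reaches rep1 i.
Proof. by apply: class_cons class_sub1 _ i; have /andP[_ /and3P[]] := fixers_check. Qed.
Lemma class2_reaches i : i \in class2 -> reaches rep2 i.
Proof. by apply: class_cons class_sub2 _ i; have /andP[_ /and3P[]] := fixers_check. Qed.
Lemma class3_reaches i : i \in class3 -> reaches rep3 i.
Proof. by apply: class_cons class_sub3 _ i; have /andP[_ /and3P[]] := fixers_check. Qed.

Lemma clist_cases i : i \in clist -> i != root0 -> [\/ i \in class1, i \in class2 | i \in class3].
Proof.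
have /and3P[/perm_mem-> _ _] := classes_check; rewrite inE => /predU1P[->|]; first by rewrite eqxx.
by rewrite !mem_cat => /or3P[] i_in _; [apply: Or31 | apply: Or32 | apply: Or33].
Qed.

Lemma class_clist i : i \in class1 ++ class2 ++ class3 -> i \in clist /\ i != root0.
Proof.
have /and3P[Dc _ /and3P[cu _ _]] := classes_check; move: cu; rewrite (perm_uniq Dc) (perm_mem Dc) => /andP[r0 _] i_in.
by split; [rewrite inE i_in orbT | apply: contraNneq r0 => <-].
Qed.

Definition four (i : positive * nat) : {set {perm octonion F4}} := <<[set s0; xs i]>>%g.

Lemma clist_T i : i \in clist -> xs i \in rootT.
Proof. by move=> ic; apply/rootT_xs; exists i => //; apply: clist_known. Qed.

Section Mate.
Variable i : positive * nat.
Hypothesis ic : i \in clist.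
Hypothesis i0 : i != root0.

Lemma mate_commute : commute s0 (xs i).
Proof. exact/commute_sym/(elimT (commute_s0 (clist_known ic))). Qed.

Lemma mate_neq : s0 != xs i.
Proof. by apply: contraNneq i0 => Ds; rewrite -(xs_inj known_root0 (clist_known ic)) // xs_root0. Qed.

Lemma mate_prod : prod_of i \in clist /\ (s0 * xs i)%g = xs (prod_of i).
Proof.
have := allP cprod_check i ic; rewrite (negPf i0) orFb; cbv zeta => /and4P[p_in _ _ prodP].
split=> //; exact: (same_productP represents_s0 (represents_xs (clist_known ic)) (represents_xs (clist_known p_in)) prodP).
Qed.

Lemma four_elements s : s \in four i -> s != 1%g -> s \in [:: s0; xs i; xs (prod_of i)].
Proof.
have [_ <-] := mate_prod.
rewrite /four gen_four ?order_rootT ?s0_T ?clist_T //; last exact: mate_commute.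
by rewrite !inE -!orbA => /or4P[]/eqP->; rewrite ?eqxx ?orbT.
Qed.

Lemma four_count : (6 * #|G24_2 : 'N_G24_2(four i)|%g = 4095 * #|span_mates G24_2 rootT s0 (xs i) s0|)%N.
Proof.
rewrite -card_rootT; apply: index_count.
- by move=> x g xT gG; apply: rootT_conj.
- by move=> x /rootT_orbit[w _ ->]; exists (wgl w); first exact: wgl_G.
- exact: order_rootT.
- exact: s0_T.
- exact: clist_T.
- by have [p_in ->] := mate_prod; apply: clist_T.
- exact: mate_commute.
exact: mate_neq.
Qed.
End Mate.

Lemma four_abelian i : i \in clist -> abelian (four i).
Proof.
move=> ic; rewrite /four abelian_gen; apply/centsP=> x xab y yab; have com := mate_commute ic.
by case/set2P: xab => ->; case/set2P: yab => ->; rewrite /commute ?com.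
Qed.

Lemma reaches_four r i : reaches r i -> exists2 g, g \in G24_2 & four i = (four r :^ g)%g.
Proof. by case=> g [gG s0g rg]; exists g; rewrite // /four four_J s0g rg. Qed.

(** The mates of [s0] are exactly the elements labelled by [cl]: elements fixing [s0] carry [xs r]
    to each of them, and the separation hypothesis rules out all others. Then [four_count]
    applies. *)
Lemma index_class r cl i : r \in clist -> r != root0 -> uniq cl -> {subset cl <= class1 ++ class2 ++ class3} ->
    (forall i, i \in cl -> reaches r i) ->
    (forall i g, i \in clist -> i != root0 -> i \notin cl -> g \in G24_2 -> four i <> (four r :^ g)%g) ->
  i \in cl -> (6 * #|G24_2 : 'N_G24_2(four i)|%g = 4095 * size cl)%N.
Proof.
move=> rc r0 clU cl_sub cl_reach cl_sep i_in.
have xs_uniq : uniq (map xs cl).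
  rewrite map_inj_in_uniq // => j j' /cl_sub/class_clist[jc _] /cl_sub/class_clist[j'c _].
  by apply: xs_inj; apply: clist_known.
have [g gG Di] := reaches_four (cl_reach i i_in).
have -> : #|G24_2 : 'N_G24_2(four i)|%g = #|G24_2 : 'N_G24_2(four r)|%g.
  by rewrite Di normJ -{1}(conjGid gG) -{2}(conjGid gG) -conjIg indexJg.
rewrite (four_count rc r0); congr (_ * _)%N; rewrite -(size_map xs) -(card_set_seq xs_uniq).
congr #|pred_of_set _|; apply/setP=> t; rewrite [in LHS]inE [in RHS]inE; apply/and3P/mapP=> [[tT ts]|[j j_in ->]].
  case/imsetP=> h hG Dt.
  have abV : abelian <<[set s0; t]>>%g by rewrite Dt abelianJ four_abelian.
  have com : commute t s0 by apply: (centsP abV); rewrite mem_gen // !inE eqxx ?orbT.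
  have [j jk Dj] := rootT_xs _ tT; rewrite {}Dj in ts Dt com *.
  have jc : j \in clist by apply/(commute_s0 jk).
  have j0 : j != root0 by apply: contraNneq ts => ->; rewrite xs_root0.
  exists j => //; apply: contraT => j_out.
  by case: (cl_sep j h jc j0 j_out hG).
have [jc j0] := class_clist (cl_sub j j_in); split; [exact: clist_T | by rewrite eq_sym mate_neq |].
by have [h hG Dj] := reaches_four (cl_reach j j_in); apply/imsetP; exists h.
Qed.

(** A conjugation invariant that separates the first class, whose four-groups commute with every
    root element commuting with [s0]. *)
Definition inv1 (A : {set {perm octonion F4}}) : nat := #|rootT :&: 'C(A)|%g.

Lemma inv1_J A g : g \in G24_2 -> inv1 (A :^ g)%g = inv1 A.
Proof.
move=> gG; rewrite /inv1 -[RHS](cardJg _ g); congr #|pred_of_set _|; rewrite conjIg -centJ; congr (_ :&: _).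
apply/setP=> t; rewrite mem_conjg; apply/idP/idP=> [/rootT_conj->//|/(rootT_conj gG)]; first by rewrite groupV.
by rewrite conjgKV.
Qed.

Lemma cent_four i : ('C(four i) = 'C[s0] :&: 'C[xs i])%g.
Proof. by rewrite /four cent_gen centU !cent_set1. Qed.

Lemma commute_clist i j : i \in clist -> j \in clist -> reflect (commute (xs i) (xs j)) (xcommute (xpp i) (xpp j)).
Proof. by move=> ic jc; apply: commute_rep; apply/represents_xs/clist_known. Qed.

Lemma inv1_full i : i \in clist -> (inv1 (four i) == #|rootT :&: 'C[s0]|%g) = all (fun j => xcommute (xpp i) (xpp j)) clist.
Proof.
move=> ic; have sub : (rootT :&: 'C(four i) \subset rootT :&: 'C[s0])%g.
  by rewrite cent_four setIA subsetIl.
have [_ Dsub] := subset_leqif_card sub; rewrite /inv1 Dsub.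
apply/subsetP/allP=> [sub' j jc|all_j s sC].
  apply/(commute_clist ic jc); have: xs j \in (rootT :&: 'C(four i))%g by apply: sub'; apply/centT; exists j.
  by rewrite cent_four => /setIP[_ /setIP[_ /cent1P]].
have [j jc Ds] := centT _ sC; case/setIP: (sC) => sT s_s0; rewrite inE sT cent_four inE s_s0 /= Ds.
apply/cent1P; have : commute (xs i) (xs j) by apply/(commute_clist ic jc)/all_j.
by [].
Qed.

Definition inv2 (A : {set {perm octonion F4}}) : Prop :=
  exists s t a b c, [/\ s \in A, t \in A, s != 1%g & t != 1%g] /\
    [/\ represents s (a, b), represents t (a, c) & mulc b c = a].

Lemma inv2_J A g : g \in G24_2 -> inv2 A -> inv2 (A :^ g)%g.
Proof.
move=> gG [s [t [a [b [c [[sA tA s1 t1] [sab tac bc]]]]]]].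
have neq1 x : (x != 1 -> x ^ g != 1)%g by rewrite -{2}(conj1g g) (inj_eq (conjg_inj g)).
have [F8 FD FM] := hat_auto gG; have [/and5P[/= a8 b8 _ _ _] _] := sab; have [/and5P[/= _ c8 _ _ _] _] := tac.
exists (s ^ g)%g, (t ^ g)%g, (hat g a), (hat g b), (hat g c); rewrite !memJ_conjg !neq1 //; split=> //.
split; [exact: represents_conj gG sab | exact: represents_conj gG tac | by rewrite -FM // bc].
Qed.

Lemma rep2_clist : rep2 \in clist /\ rep2 != root0.
Proof. by apply: class_clist; rewrite !mem_cat mem_head orbT. Qed.
Lemma rep3_clist : rep3 \in clist /\ rep3 != root0.
Proof. by apply: class_clist; rewrite !mem_cat mem_head !orbT. Qed.
Lemma rep1_clist : rep1 \in clist /\ rep1 != root0.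
Proof. by apply: class_clist; rewrite mem_cat mem_head. Qed.

Lemma triple_represents i p : i \in clist -> i != root0 -> p \in [:: h0; xpp i; xpp (prod_of i)] ->
  exists s, [/\ s \in four i, s != 1%g & represents s p].
Proof.
move=> ic i0; have [prc Dpr] := mate_prod ic i0; rewrite !inE => /or3P[]/eqP->.
- by exists s0; split; [rewrite mem_gen ?set21 | exact: s0_neq1 | exact: represents_s0].
- exists (xs i); split; [by rewrite mem_gen ?set22 | | exact: represents_xs (clist_known ic)].
  by apply: contra_eqN (order_rootT (clist_T ic)) => /eqP->; rewrite order1.
exists (xs (prod_of i)); split; last exact: represents_xs (clist_known prc).
  by rewrite -Dpr groupM ?mem_gen ?set21 ?set22.
by apply: contra_eqN (order_rootT (clist_T prc)) => /eqP->; rewrite order1.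
Qed.

Lemma inv2_rep2 : inv2 (four rep2).
Proof.
have [c2 n2] := rep2_clist; have /and5P[_ _ _ + _] := separate_check.
case/hasP=> p /(triple_represents c2 n2)[s [sA s1 sp]] /hasP[q /(triple_represents c2 n2)[t [tA t1 tq]]].
case/hasP=> [[a b]]; rewrite mem_filter => /andP[/andP[ab_sp /eqP rab] _] /hasP[c _ /and3P[/eqP bc ac_sp /eqP rac]].
exists s, t, a, b, c; split; split=> //; first exact: represents_rows sp ab_sp (esym rab).
exact: represents_rows tq ac_sp (esym rac).
Qed.

Lemma four_represents i s : i \in clist -> i != root0 -> s \in four i -> s != 1%g ->
  exists2 p, p \in [:: h0; xpp i; xpp (prod_of i)] & represents s p.
Proof.
move=> ic i0 sA s1; have [prc _] := mate_prod ic i0.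
have := four_elements ic i0 sA s1; rewrite !inE => /or3P[]/eqP->.
- by exists h0; [rewrite mem_head | exact: represents_s0].
- by exists (xpp i); [rewrite inE mem_head orbT | exact: represents_xs (clist_known ic)].
by exists (xpp (prod_of i)); [rewrite !in_cons eqxx !orbT | exact: represents_xs (clist_known prc)].
Qed.

Lemma inv2_rep3 : ~ inv2 (four rep3).
Proof.
have [c3 n3] := rep3_clist; have /and5P[_ _ _ _ /negP bad] := separate_check.
case=> s [t [a [b [c [[sA tA s1 t1] [sab tac bc]]]]]]; apply: bad.
have [p p_in sp] := four_represents c3 n3 sA s1; have [q q_in tq] := four_represents c3 n3 tA t1.
have [a_in b_in] := in_span2 sp (allP span_check p p_in) sab.
have [_ c_in] := in_span2 tq (allP span_check q q_in) tac.
have [ab_sp _] := sab; have [ac_sp _] := tac.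
apply/hasP; exists p => //; apply/hasP; exists q => //; apply/hasP; exists (a, b).
  rewrite mem_filter ab_sp -(rows_eq sab sp) eqxx andTb.
  by apply/allpairsP; exists (a, b).
by apply/hasP; exists c => //; rewrite /= bc eqxx ac_sp -(rows_eq tac tq) eqxx.
Qed.

Lemma inv1_reps : [/\ inv1 (four rep1) = #|rootT :&: 'C[s0]|%g, inv1 (four rep2) <> #|rootT :&: 'C[s0]|%g
  & inv1 (four rep3) <> #|rootT :&: 'C[s0]|%g].
Proof.
have [[c1 _] [c2 _] [c3 _]] := And3 rep1_clist rep2_clist rep3_clist.
have /and5P[all1 not2 not3 _ _] := separate_check.
split; [apply/eqP | apply/eqP | apply/eqP]; rewrite inv1_full //.
Qed.

Lemma classes_uniq : [/\ uniq class1, uniq class2 & uniq class3].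
Proof.
have /and3P[Dc _ /and3P[cu _ _]] := classes_check; move: cu.
by rewrite (perm_uniq Dc) cons_uniq !cat_uniq => /and5P[_ -> _ -> /andP[_ ->]].
Qed.

Definition tindex (s t : {perm octonion F4}) : nat := #|G24_2 : 'N_G24_2(<<[set s; t]>>)|%g.

Lemma index_div6 n k m : 6 * n = m -> m == 6 * k -> n = k.
Proof. by move=> <-; rewrite eqn_pmul2l // => /eqP. Qed.

Lemma index1 i : i \in class1 -> tindex s0 (xs i) = 1365.
Proof.
have [c1 n1] := rep1_clist; have [u1 _ _] := classes_uniq; have [D1 N2 N3] := inv1_reps.
move=> i_in; apply: (index_div6 (m := 4095 * 2)); last by vm_cast_no_check (erefl true).
have /and5P[_ _ _ /eqP <- _] := classes_check.
apply: (index_class c1 n1 u1) i_in => [j j1|j|j g jc j0 j_out gG Dj]; first by rewrite mem_cat j1.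
  exact: class1_reaches.
have := inv1_J (four rep1) gG; rewrite -Dj D1.
case: (clist_cases jc j0) => [j1|/class2_reaches/reaches_four[h hG ->]|/class3_reaches/reaches_four[h hG ->]].
- by rewrite j1 in j_out.
- by rewrite inv1_J.
by rewrite inv1_J.
Qed.

(** Here 13650 = 4095 * 20 / 6, just as 1365 = 4095 * 2 / 6 and 27300 = 4095 * 40 / 6 for the other
    two classes. *)
Lemma index2 i : i \in class2 -> tindex s0 (xs i) = 13650.
Proof.
have [c2 n2] := rep2_clist; have [_ u2 _] := classes_uniq; have [D1 N2 N3] := inv1_reps.
move=> i_in; apply: (index_div6 (m := 4095 * 20)); last by vm_cast_no_check (erefl true).
have /and5P[_ _ _ _ /andP[/eqP <- _]] := classes_check.
apply: (index_class c2 n2 u2) i_in => [j j2|j|j g jc j0 j_out gG Dj]; first by rewrite !mem_cat j2 orbT.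
  exact: class2_reaches.
case: (clist_cases jc j0) => [/class1_reaches/reaches_four[h hG Djh]|j2|/class3_reaches/reaches_four[h hG Djh]].
- by case: N2; rewrite -D1 -(inv1_J (four rep1) hG) -Djh Dj inv1_J.
- by rewrite j2 in j_out.
apply: inv2_rep3; have -> : four rep3 = (four rep2 :^ (g * h^-1))%g by rewrite conjsgM -Dj Djh conjsgK.
by apply: inv2_J inv2_rep2; rewrite groupM ?groupV.
Qed.

Lemma index3 i : i \in class3 -> tindex s0 (xs i) = 27300.
Proof.
have [c3 n3] := rep3_clist; have [_ _ u3] := classes_uniq; have [D1 N2 N3] := inv1_reps.
move=> i_in; apply: (index_div6 (m := 4095 * 40)); last by vm_cast_no_check (erefl true).
have /and5P[_ _ _ _ /and3P[_ /eqP <- _]] := classes_check.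
apply: (index_class c3 n3 u3) i_in => [j j3|j|j g jc j0 j_out gG Dj]; first by rewrite !mem_cat j3 !orbT.
  exact: class3_reaches.
case: (clist_cases jc j0) => [/class1_reaches/reaches_four[h hG Djh]|/class2_reaches/reaches_four[h hG Djh]|j3].
- by case: N3; rewrite -D1 -(inv1_J (four rep1) hG) -Djh Dj inv1_J.
- apply: inv2_rep3; have -> : four rep3 = (four rep2 :^ (h * g^-1))%g by rewrite conjsgM -Djh Dj conjsgK.
  by apply: inv2_J inv2_rep2; rewrite groupM ?groupV.
by rewrite j3 in j_out.
Qed.

Definition tcol (s t : {perm octonion F4}) : bool :=
  [&& s \in rootT, t \in rootT, s != t, (s * t == t * s)%g & tindex s t \in [:: 1365; 13650]].

Lemma tcol_conj s t g : g \in G24_2 -> tcol (s ^ g)%g (t ^ g)%g = tcol s t.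
Proof.
move=> gG; have TJ x : ((x ^ g)%g \in rootT) = (x \in rootT).
  apply/idP/idP=> [|/(rootT_conj gG)//].
  by move/(rootT_conj (groupVr gG)); rewrite conjgK.
rewrite /tcol !TJ (inj_eq (conjg_inj g)) -!conjMg (inj_eq (conjg_inj g)).
by rewrite /tindex -four_J normJ -{1}(conjGid gG) -{2}(conjGid gG) -conjIg indexJg.
Qed.

(** [nbl 0] consists of the classes of sizes 2 and 20; commuting elements of the third class are
    excluded by their index 27300. *)
Lemma tcol_s0 t : reflect (exists2 i, i \in nbl 0 & t = xs i) (tcol s0 t).
Proof.
have /and3P[_ Dn _] := classes_check; apply: (iffP and5P) => [[_ tT st /eqP com]|[i]].
  have [i ik Dt] := rootT_xs _ tT; rewrite {}Dt in st com *.
  have ic : i \in clist by apply/(commute_s0 ik)/commute_sym.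
  have i0 : i != root0 by apply: contraNneq st => ->; rewrite xs_root0.
  case: (clist_cases ic i0) => i_in; last by rewrite index3.
    by exists i; rewrite // (perm_mem Dn) mem_cat i_in.
  by exists i; rewrite // (perm_mem Dn) mem_cat i_in orbT.
rewrite (perm_mem Dn) mem_cat => i_in ->.
have [ic i0] : i \in clist /\ i != root0 by apply: class_clist; rewrite !mem_cat orbA i_in.
rewrite s0_T clist_T // (mate_neq ic i0); split=> //; first by rewrite (mate_commute ic) eqxx.
case/orP: i_in => i_in; first by rewrite index1 // mem_head.
by rewrite index2 // in_cons mem_seq1 eqxx orbT.
Qed.

(** * Matching points with root elements *)

Lemma tcol_T s t : tcol s t -> s \in rootT /\ t \in rootT.
Proof. by case/and5P. Qed.

Lemma tcol_nbl k p : k \in labs13 -> p \in nbl k -> known p /\ tcol (stau k) (xs p).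
Proof.
move=> k13 p_in; have pk : known p.
  by have /and4P[_ _ _ /allP/(_ p p_in)/andP[pp pl]] := allP nbl_check k k13; rewrite /known pp -labs13P.
have := allP trans_check k k13; cbv zeta => /and3P[_ _ /allP/(_ p p_in)/mapP[i i_in Dr]].
have [i_known _] : known i /\ True.
  by have /and4P[_ _ _ /allP/(_ i i_in)/andP[ip il]] := allP nbl_check 0 isT; rewrite /known ip -labs13P.
split=> //; rewrite /stau (xs_eq (represents_word _ (represents_xs i_known)) pk Dr).
by rewrite tcol_conj ?wgl_G //; apply/tcol_s0; exists i.
Qed.

Lemma tcol_prod s t : tcol s t -> tcol s (s * t)%g.
Proof.
move=> st; have [sT tT] := tcol_T st; have [w _ Ds] := rootT_orbit sT.
have wG := wgl_G w; set g := wgl w in Ds wG.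
have := st; rewrite Ds -{1}[t](conjgKV g) tcol_conj // => /tcol_s0[i i_in Dt].
have [ik] := tcol_nbl (isT : 0 \in labs13) i_in.
have Dt' : t = (xs i ^ g)%g by rewrite -Dt conjgKV.
rewrite Dt' -conjMg tcol_conj // => _.
have: tcol s0 (xs i) by apply/tcol_s0; exists i.
case/and5P=> _ iT s0i /eqP com ind.
have ic : i \in clist by apply/(commute_s0 ik)/commute_sym.
have i0 : i != root0 by apply: contraNneq s0i => ->; rewrite xs_root0.
have [prc Dp] := mate_prod ic i0.
have i1 : xs i != 1%g by apply: contra_eqN (order_rootT iT) => /eqP->; rewrite order1.
have s0p : s0 != (s0 * xs i)%g by rewrite -{1}[s0]mulg1 (inj_eq (mulgI s0)) eq_sym.
have p1 : (s0 * xs i != 1)%g.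
  by rewrite Dp; apply: contra_eqN (order_rootT (clist_T prc)) => /eqP->; rewrite order1.
have [s0V iV] : s0 \in <<[set s0; xs i]>>%g /\ xs i \in <<[set s0; xs i]>>%g.
  by rewrite !mem_gen ?set21 ?set22.
have Dfour := four_gen (order_rootT s0_T) (order_rootT iT) com s0i s0V (groupM s0V iV) s0_neq1 p1 s0p.
apply/and5P; split; [exact: s0_T | by rewrite Dp clist_T | exact: s0p | | by rewrite /tindex Dfour].
by rewrite -[X in _ == X]mulgA -com.
Qed.

Lemma tcol_sym s t : tcol s t -> tcol t s.
Proof.
by case/and5P=> sT tT st com ind; apply/and5P; split; rewrite // 1?eq_sym // /tindex finset.setUC.
Qed.

Lemma card_tcol s : s \in rootT -> #|[set t | tcol s t]| = 22.
Proof.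
case/rootT_orbit=> w _ ->; have gG := wgl_G w; set g := wgl w in gG *.
have -> : [set t | tcol (s0 ^ g)%g t] = ([set t | tcol s0 t] :^ g)%g.
  by apply/setP=> t; rewrite mem_conjg !inE -{1}[t](conjgKV g) tcol_conj.
have /and4P[_ nu /eqP sz _] := allP nbl_check 0 isT.
have nb_known i : i \in nbl 0 -> known i by move=> i_in; have [] := tcol_nbl (isT : 0 \in labs13) i_in.
have xu : uniq (map xs (nbl 0)).
  by rewrite map_inj_in_uniq // => i i' i_in i'_in; apply: xs_inj; apply: nb_known.
rewrite cardJg -sz -(size_map xs) -(card_set_seq xu); congr #|pred_of_set _|.
by apply/setP=> t; rewrite [LHS]inE [RHS]inE; apply/tcol_s0/mapP.
Qed.

Section Identification.
Variables (P : eqType) (d : P -> P -> nat) (third : P -> P -> P) (nb : P -> seq P).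
Hypothesis d_eq0 : forall x y, (d x y == 0) = (x == y).
Hypothesis dC : forall x y, d x y = d y x.
Hypothesis d_tri : forall x y z, d x z <= d x y + d y z.
Hypothesis d_le4 : forall x y, d x y <= 4.
Hypothesis d_geo : forall x y n, d x y = n.+1 -> exists2 z, d x z = 1 & d z y = n.
Hypothesis thirdP : forall a b, d a b = 1 -> forall x, pat (d x a) (d x b) (d x (third a b)).
Hypothesis mem_nb : forall x y, (y \in nb x) = (d x y == 1).
Hypothesis nb_uniq : forall x, uniq (nb x).
Hypothesis nb_size : forall x, size (nb x) = 22.

Definition embedding (e : positive -> P) : Prop :=
  (forall w u, u \in pts -> d (e (wapp w 1)) (e (wapp w u)) = lev u) /\
  (forall w i j, i \in pts -> j \in adjs i -> d (e (wapp w i)) (e (wapp w j)) = 1).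

Lemma embedding_gen e b : embedding e -> embedding (fun u => e (gen b u)).
Proof. by case=> e_lev e_adj; split=> [w u|w i j]; [apply: (e_lev (b :: w)) | apply: (e_adj (b :: w))]. Qed.

Lemma relabel_base e w w' k y : embedding e -> wapp w 1 = wapp w' 1 -> k \in labs13 -> lab d e w k y ->
  exists2 k', k' \in labs13 & lab d e w' k' y.
Proof.
move=> [e_lev e_adj] Dw k13 yk; have [k0|k_neq0] := eqVneq k 0.
  exists 0 => //; rewrite k0 in yk; rewrite (lab0_eq d_eq0 yk) Dw; exact: lab0.
have k12 : k \in labs12 by move: k13; rewrite !mem_iota; lia.
have yH := lab_notinH d_eq0 k12 yk.
have y1 : d y (e (wapp w' 1)) = 1 by rewrite -Dw; apply: lab_d1 k12 yk.
have [k' k'12 yk'] := lab_exists d_eq0 dC d_tri d_le4 thirdP e_lev e_adj yH y1.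
by exists k' => //; apply: labs12_13.
Qed.

Lemma sep_points_pts u : u \in sep_points -> u \in pts.
Proof. by have /allP/(_ u) : all (fun u => u \in pts) sep_points by vm_cast_no_check (erefl true). Qed.

(** Both sides meet here: the label of [y] after a change of frame equals the label of the
    conjugated root element, by [sep_check]. *)
Lemma relabel_step e b j k y : embedding e -> j \in pts -> k \in labs13 -> lab d e (b :: tw j) k y ->
  exists i, [/\ known i, lab d e (tw i.1) i.2 y & (xs (j, k) ^ gl b)%g = xs i].
Proof.
move=> emb j_pts k13 yk; have k_lt : k < 13 by rewrite -labs13P.
have jk : known (j, k) by rewrite /known j_pts k_lt.
have b3 : nat_of_bool b < 3 by case: (b).
have [ik Ds Dg] := xs_step jk b3; set i := klookup _ in ik Ds Dg; exists i; split=> //.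
have bE : (nat_of_bool b == 1) = b by case: (b).
have b2 : nat_of_bool b < 2 by case: (b).
have Di : i.1 = gen b j by rewrite (Dg b2) bE.
have gj_pts : gen b j \in pts := wapp_pts [:: b] j_pts.
have Dw : wapp (b :: tw j) 1 = wapp (tw (gen b j)) 1 by rewrite /= !tw1.
have [l l13 yl] := relabel_base emb Dw k13 yk; rewrite Di.
suffices -> : i.2 = l by [].
have b_in : b \in [:: false; true] by case: (b).
have := allP (allP (allP (allP sep_check j j_pts) b b_in) k k13) l l13; cbv zeta.
rewrite -/(xpp (j, k)) -/i => /orP[/eqP //|/hasP[_ /mapP[u u_in ->]]].
have u_pts := sep_points_pts u_in; have v_pts := wapp_pts (tw (gen b j)) u_pts.
rewrite [X in label_dist l X]/fst [X in label_dist k X]/snd -(yl u u_pts) -yk ?wapp_pts //.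
by rewrite wappK // eqxx.
Qed.

(** The head letter acts last, so it can be absorbed into the embedding; the induction hypothesis is
    applied to [e] composed with [gen b]. *)
Lemma relabel_word w e k y : embedding e -> k \in labs13 -> lab d e w k y ->
  exists i, [/\ known i, lab d e (tw i.1) i.2 y & (stau k ^ wgl (lword w))%g = xs i].
Proof.
elim: w e k => [|b w IHw] e k emb k13 yk.
  by exists (1%positive, k); rewrite /known pts1 -labs13P.
have [[j k'] [/andP[/= j_pts k'13] yk' Ds]] := IHw _ _ (embedding_gen b emb) k13 yk.
rewrite -labs13P in k'13; have [i [ik yi Di]] := relabel_step emb j_pts k'13 yk'.
by exists i; split=> //; rewrite /= conjgM Ds.
Qed.

Variable e : positive -> P.
Hypothesis e_emb : embedding e.
Let e_lev := e_emb.1.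
Let e_adj := e_emb.2.

Lemma label_exists y : exists i, known i /\ lab d e (tw i.1) i.2 y.
Proof.
have [w [k [k13 yk]]] := all_labelled d_eq0 dC d_tri d_le4 d_geo thirdP mem_nb nb_uniq nb_size e_lev e_adj y.
by have [i [ik yi _]] := relabel_word e_emb k13 yk; exists i.
Qed.

Definition label_of (y : P) : positive * nat := sval (cid (label_exists y)).
Definition toT (y : P) : {perm octonion F4} := xs (label_of y).

Lemma label_ofP y : known (label_of y) /\ lab d e (tw (label_of y).1) (label_of y).2 y.
Proof. exact: svalP (cid (label_exists y)). Qed.

Lemma label_of_eq i y : known i -> lab d e (tw i.1) i.2 y -> label_of y = i.
Proof.
case: i => j k /andP[/= j_pts k13] yk; have [] := label_ofP y.
case: (label_of y) => j' k' /andP[/= j'_pts k'13] yk'; rewrite -!labs13P in k13 k'13.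
exact: (labs_inj d_eq0 e_lev (w := [::]) j'_pts j_pts k'13 k13 yk' yk).
Qed.

(** The root element of [y] can be computed in any frame. This lets [toT_tcol] describe a neighbour
    in a frame that extends the frame of [y]. *)
Lemma toT_lab w k y : k \in labs13 -> lab d e w k y -> toT y = (stau k ^ wgl (lword w))%g.
Proof.
by move=> k13 /(relabel_word e_emb k13)[i [ik yi ->]]; rewrite /toT (label_of_eq ik yi).
Qed.

Lemma toT_T y : toT y \in rootT.
Proof. by apply/rootT_xs; exists (label_of y) => //; case: (label_ofP y). Qed.

Lemma toT_inj : injective toT.
Proof.
move=> y y' /xs_inj Dy; have [ik yk] := label_ofP y; have [ik' yk'] := label_ofP y'.
rewrite -(Dy ik ik') in yk'; have k13 : (label_of y).2 \in labs13 by rewrite labs13P; case/andP: ik.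
exact: (lab_uniq d_eq0 dC d_tri d_le4 d_geo thirdP mem_nb nb_uniq nb_size e_lev e_adj k13 yk yk').
Qed.

Lemma toT_onto s : s \in rootT -> exists y, toT y = s.
Proof.
case/rootT_xs=> [[j k] jk ->]; have /andP[/= j_pts k13] := jk; rewrite -labs13P in k13.
have [y yk] := occurs_lab d_eq0 dC d_tri d_le4 d_geo thirdP mem_nb nb_uniq nb_size e_lev e_adj (tw j) k13.
by exists y; rewrite /toT (label_of_eq jk yk).
Qed.

Lemma toT_tcol y y' : d y y' = 1 -> tcol (toT y) (toT y').
Proof.
move=> yy'; have [ik yk] := label_ofP y; move: ik yk; case: (label_of y) => j k /andP[/= j_pts k_lt] yk.
have k13 : k \in labs13 by rewrite labs13P.
have [p p_in y'p] := nb_labelled d_eq0 dC d_tri d_le4 d_geo thirdP mem_nb nb_uniq nb_size e_lev e_adj k13 yk yy'.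
have [/andP[_ p2] st] := tcol_nbl k13 p_in; rewrite -labs13P in p2.
rewrite (toT_lab k13 yk) (toT_lab p2 y'p) /lword map_cat wgl_cat conjgM tcol_conj ?wgl_G //.
Qed.

(** Neighbourhoods have 22 elements on both sides, so the injective map [toT] carries one onto the
    other. *)
Lemma tcol_toT y t : tcol (toT y) t -> exists2 y', d y y' = 1 & t = toT y'.
Proof.
have fu : uniq (map toT (nb y)) by rewrite (map_inj_uniq toT_inj) nb_uniq.
have sub : [set t in map toT (nb y)] \subset [set t | tcol (toT y) t].
  by apply/subsetP=> t'; rewrite inE => /mapP[y' + ->]; rewrite mem_nb inE => /eqP/toT_tcol.
have Dset : [set t in map toT (nb y)] = [set t | tcol (toT y) t].
  by apply/eqP; rewrite eqEcard sub card_tcol ?toT_T // (card_set_seq fu) size_map nb_size.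
move=> yt; have: t \in [set t | tcol (toT y) t] by rewrite inE.
by rewrite -Dset inE => /mapP[y']; rewrite mem_nb => /eqP yy' ->; exists y'.
Qed.

Lemma tcol_d y y' : tcol (toT y) (toT y') -> d y y' = 1.
Proof. by case/tcol_toT=> z yz /toT_inj->. Qed.

Lemma toT_third a b : d a b = 1 -> toT (third a b) = (toT a * toT b)%g.
Proof.
move=> ab; have st := toT_tcol ab; have s_st := tcol_prod st.
have t_st : tcol (toT b) (toT a * toT b)%g.
  by have /and5P[_ _ _ /eqP-> _] := st; apply/tcol_prod/tcol_sym.
have [z az Dz] := tcol_toT s_st; rewrite Dz in t_st *; congr toT; apply/esym.
exact: (third_uniq d_eq0 dC thirdP ab az (tcol_d t_st)).
Qed.
End Identification.

(** * Distances in a near octagon *)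

From mathcomp Require Import classical_sets functions cardinality.

Lemma set_enum (T : Type) (Q : T -> Prop) n : ([set x | Q x] #= `I_n)%classic%card ->
  exists s : seq {classic T}, [/\ uniq s, size s = n & forall x, Q x <-> x \in s].
Proof.
case/card_set_bijP=> f0 [f_sub f_inj f_surj]; pose f : {classic T} -> nat := f0.
have [s Ds sQ] : exists2 s : seq {classic T}, map f s = iota 0 n & forall x, x \in s -> Q x.
  have: {in iota 0 n, forall i, i < n} by move=> i; rewrite mem_iota.
  elim: (iota 0 n) => [|i r IHr] r_lt; first by exists [::].
  have [j jr|s <- sQ] := IHr _; first by apply: r_lt; rewrite inE jr orbT.
  have [x Qx <-] := f_surj i (r_lt i (mem_head i r)).
  by exists ((x : {classic T}) :: s) => // y; rewrite inE => /predU1P[->|/sQ].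
exists s; split; first by apply: (map_uniq (f := f)); rewrite Ds iota_uniq.
  by rewrite -(size_map f) Ds size_iota.
move=> x; split=> [Qx|/sQ //].
have: f x \in map f s by rewrite Ds mem_iota; apply: (f_sub x Qx).
by case/mapP=> y ys Dxy; have -> // : x = y; apply: f_inj; rewrite ?inE //; apply: (sQ y ys).
Qed.

Lemma uniq3 (T : eqType) (x y z : T) : uniq [:: x; y; z] = [&& x != y, x != z & y != z].
Proof. by rewrite /= !inE negb_or andbT -andbA. Qed.

Lemma mem3 (T : eqType) (t x y z : T) : (t \in [:: x; y; z]) = [|| t == x, t == y | t == z].
Proof. by rewrite !inE. Qed.

Lemma third_of (T : eqType) (a b : T) (s : seq T) : a != b -> a \in s -> b \in s -> uniq s -> size s = 3 ->
  exists2 c, uniq [:: a; b; c] & s =i [:: a; b; c].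
Proof.
move=> ab aL bL ptsU ptsN.
have /hasP[c cL] : has (fun c => (c != a) && (c != b)) s.
  apply: contraT; rewrite -all_predC => /allP sub; have : 3 <= size [:: a; b].
    rewrite -ptsN; apply: uniq_leq_size => // c /sub; rewrite !inE /=.
    by case: (c == a) => //=; rewrite negbK.
  by [].
case/andP=> ca cb; have abcU : uniq [:: a; b; c] by rewrite uniq3 ab eq_sym ca eq_sym cb.
exists c => // x; apply/esym.
have [] := uniq_min_size abcU (s2 := s) _ _ => //; last by rewrite ptsN.
by move=> y; rewrite mem3 => /or3P[]/eqP->.
Qed.

Section Distance.
Variable S : geometry.
Implicit Types x y z : points S.

Lemma collinear_sym x y : collinear x y -> collinear y x.
Proof. by move=> [xy [L [xL yL]]]; split=> [/esym //|]; exists L. Qed.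

Lemma walk_rcons n x y z : walk n x y -> collinear y z -> walk n.+1 x z.
Proof.
elim: n x => [|n IHn] x /=; first by move=> -> yz; exists z.
by case=> t [xt ty] yz; exists t; split=> //; apply: IHn.
Qed.

Lemma walk_sym n x y : walk n x y -> walk n y x.
Proof.
elim: n x => [//|n IHn] x /= [t [xt ty]].
exact: walk_rcons (IHn _ ty) (collinear_sym xt).
Qed.

Lemma walk_cat m n x y z : walk m x y -> walk n y z -> walk (m + n) x z.
Proof.
elim: m x => [|m IHm] x /=; first by move=> ->.
by case=> t [xt ty] yz; exists t; split=> //; apply: IHm.
Qed.

Lemma dist_exists x y : connected S -> exists n, dist x y n.
Proof.
move=> /(_ x y)[n xy]; have ex : exists m, `[< walk m x y >] by exists n; apply/asboolP.
exists (ex_minn ex); case: ex_minnP => m /asboolP xm m_min; split=> // k /asboolP.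
exact: m_min.
Qed.

Lemma dist_uniq x y m n : dist x y m -> dist x y n -> m = n.
Proof. by move=> [xm m_min] [xn n_min]; apply/eqP; rewrite eqn_leq m_min // n_min. Qed.
End Distance.

Section NearOctagonDistance.
Variable N : geometry.
Hypothesis hoct : near_octagon N.
Hypothesis hord : has_order N 2 10.
Local Notation P := {classic (points N)}.

Definition pdist (x y : P) : nat :=
  sval (cid (dist_exists x y (let: And4 _ h _ _ := hoct in h))).

Lemma pdistP x y : dist (S := N) x y (pdist x y).
Proof. exact: svalP (cid _). Qed.

Lemma pdist_walk n (x y : P) : walk (S := N) n x y -> pdist x y <= n.
Proof. by have [_] := pdistP x y; apply. Qed.

Lemma walk_pdist (x y : P) : walk (S := N) (pdist x y) x y.
Proof. by have [] := pdistP x y. Qed.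

Lemma pdist_eq (x y : P) n : dist (S := N) x y n -> pdist x y = n.
Proof. exact: dist_uniq (pdistP x y). Qed.

Lemma pdist_eq0 x y : (pdist x y == 0) = (x == y).
Proof.
apply/eqP/eqP=> [xy|->]; first by have := walk_pdist x y; rewrite xy.
by apply/eqP; rewrite -leqn0; apply: pdist_walk.
Qed.

Lemma pdistC x y : pdist x y = pdist y x.
Proof. by apply/eqP; rewrite eqn_leq !pdist_walk //; apply: walk_sym; apply: walk_pdist. Qed.

Lemma pdist_tri x y z : pdist x z <= pdist x y + pdist y z.
Proof. apply: pdist_walk; exact: walk_cat (walk_pdist x y) (walk_pdist y z). Qed.

Lemma pdist_le4 x y : pdist x y <= 4.
Proof. by have [_ _ [le4 _] _] := hoct; apply: le4 (pdistP x y). Qed.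

Lemma pdist1 (x y : P) : pdist x y = 1 <-> collinear (S := N) x y.
Proof.
split=> [xy|xy]; first by have := walk_pdist x y; rewrite xy => -[z [xz <-]].
apply/eqP; rewrite eqn_leq pdist_walk; last by exists y.
by rewrite lt0n pdist_eq0; apply/eqP; case: xy.
Qed.

Lemma pdist_geo x y n : pdist x y = n.+1 -> exists2 z, pdist x z = 1 & pdist z y = n.
Proof.
move=> xy; have := walk_pdist x y; rewrite xy => -[z [xz zy]].
have xz1 : pdist x z = 1 by apply/pdist1.
exists (z : P) => //; apply/eqP; rewrite eqn_leq pdist_walk //=.
by have := pdist_tri x z y; rewrite xy xz1.
Qed.

Lemma line_points_exist (L : lines N) :
  exists s : seq P, [/\ uniq s, size s = 3 & forall x, incident x L <-> x \in s].
Proof. by have [hL _] := hord; apply: set_enum. Qed.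

Definition lpts (L : lines N) : seq P := sval (cid (line_points_exist L)).

Lemma lptsP L : [/\ uniq (lpts L), size (lpts L) = 3 & forall x : P, incident x L <-> x \in lpts L].
Proof. exact: svalP (cid (line_points_exist L)). Qed.

Lemma pdist1_line (x y : P) : pdist x y = 1 <-> x != y /\ exists L, x \in lpts L /\ y \in lpts L.
Proof.
rewrite pdist1; split=> -[xy [L]]; have [_ _ LP] := lptsP L.
  by case=> /LP xL /LP yL; split; [apply: contra_notN xy => /eqP | exists L].
by case=> /LP xL /LP yL; split; [apply: (elimN eqP xy) | exists L].
Qed.

Lemma lines_at_exist (x : points N) :
  exists s : seq {classic (lines N)}, [/\ uniq s, size s = 11 & forall L, incident x L <-> L \in s].
Proof. by have [_ hx] := hord; apply: set_enum. Qed.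

Definition lines_at (x : points N) : seq {classic (lines N)} := sval (cid (lines_at_exist x)).

Lemma lines_atP x : [/\ uniq (lines_at x), size (lines_at x) = 11
  & forall L : {classic (lines N)}, incident x L <-> L \in lines_at x].
Proof. exact: svalP (cid (lines_at_exist x)). Qed.

Definition nbp (x : P) : seq P := flatten [seq rem x (lpts L) | L : {classic (lines N)} <- lines_at x].

Lemma mem_nbp x y : (y \in nbp x) = (pdist x y == 1).
Proof.
have [_ _ linesP] := lines_atP x.
rewrite /nbp; apply/flatten_mapP/eqP=> [[L /linesP xL]|].
  have [ptsU _ ptsP] := lptsP L; rewrite mem_rem_uniq // inE => /andP[yx /ptsP yL].
  by apply/pdist1_line; rewrite eq_sym; split=> //; exists L; split; apply/ptsP.
case/pdist1_line=> xy [L [xL yL]]; have [ptsU _ ptsP] := lptsP L.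
exists (L : {classic (lines N)}); first exact/linesP/ptsP.
by rewrite mem_rem_uniq // !inE eq_sym xy.
Qed.

Lemma line_uniq (x y : P) L M : x != y -> x \in lpts L -> y \in lpts L ->
  x \in lpts M -> y \in lpts M -> L = M.
Proof.
have [pls _ _ _] := hoct; have [_ _ LP] := lptsP L; have [_ _ MP] := lptsP M.
by move=> /eqP xy /LP xL /LP yL /MP xM /MP yM; apply: (pls x y).
Qed.

Lemma nbp_uniq x : uniq (nbp x).
Proof.
have [linesU _ linesP] := lines_atP x; rewrite /nbp.
have: {subset lines_at x <= lines_at x} by [].
elim: {1 2 4}(lines_at x) linesU => //= L s IHs /andP[Ls sU] sub.
have [ptsU _ ptsP] := lptsP L.
rewrite cat_uniq rem_uniq // IHs // ?andbT; last by move=> M Ms; apply: sub; rewrite inE Ms orbT.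
have xL : x \in lpts L by apply/ptsP/linesP/sub/mem_head.
apply: contra Ls => /hasP[y /flatten_mapP[M Ms]].
have [ptsMU _ ptsMP] := lptsP M; have xM : x \in lpts M.
  by apply/ptsMP/linesP/sub; rewrite inE Ms orbT.
rewrite !mem_rem_uniq // !inE => /andP[yx yM] /andP[_ yL].
by rewrite (line_uniq _ xL yL xM yM) // eq_sym.
Qed.

Lemma nbp_size x : size (nbp x) = 22.
Proof.
have [_ linesN linesP] := lines_atP x; rewrite size_flatten /shape -map_comp.
have: {in lines_at x, forall L : {classic (lines N)}, size (rem x (lpts L)) = 2}.
  move=> L /linesP xL; have [ptsU ptsN ptsP] := lptsP L.
  by rewrite size_rem ?ptsN //; apply/ptsP.
move=> sz2; rewrite -[22]/(11 * 2)%N -linesN; elim: (lines_at x) sz2 => //= L s IHs sz2.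
by rewrite IHs ?sz2 ?mem_head // => M Ms; apply: sz2; rewrite inE Ms orbT.
Qed.

(** The condition stands under the existential, so that a third point can be chosen for all pairs at
    once. *)
Lemma third_exists (a b : P) : exists c : P, pdist a b = 1 ->
  exists L : lines N, [/\ uniq [:: a; b; c] & lpts L =i [:: a; b; c]].
Proof.
have [ab|] := eqVneq (pdist a b) 1; last by move=> nab; exists a => ab; rewrite ab in nab.
have [a_neq_b [L [aL bL]]] := (pdist1_line a b).1 ab.
have [ptsU ptsN ptsP] := lptsP L.
have [c abcU DL] := third_of a_neq_b aL bL ptsU ptsN.
by exists c => _; exists L.
Qed.

Definition thirdp (a b : P) : P := sval (cid (third_exists a b)).

Lemma thirdp_line a b : pdist a b = 1 ->
  exists L : lines N, [/\ uniq [:: a; b; thirdp a b] & lpts L =i [:: a; b; thirdp a b]].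
Proof. exact: svalP (cid (third_exists a b)). Qed.

Lemma on_line_dist x y L : x \in lpts L -> y \in lpts L -> pdist x y <= 1.
Proof.
move=> xL yL; have [->|xy] := eqVneq x y; first by have /eqP-> : pdist y y == 0 by rewrite pdist_eq0.
by have -> : pdist x y = 1 by apply/pdist1_line; split=> //; exists L.
Qed.

(** If the nearest point is at distance n, the two others are at distance at most n + 1, being
    collinear with it, and more than n by its uniqueness. *)
Lemma line_pattern L (a b c : P) x : uniq [:: a; b; c] -> lpts L =i [:: a; b; c] ->
  pat (pdist x a) (pdist x b) (pdist x c).
Proof.
move=> abcU DL; have [_ _ ptsP] := lptsP L.
have [_ _ _ /(_ x L)[p [[pL [n [/pdist_eq xp p_min]]] p_uniq]]] := hoct.
have far q : q \in lpts L -> q != p -> pdist x q = n.+1.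
  move=> qL qp; apply/eqP; rewrite eqn_leq; apply/andP; split.
    have := on_line_dist (y := q) ((ptsP p).1 pL) qL; have := pdist_tri x p q; lia.
  rewrite ltn_neqAle (p_min _ _ ((ptsP q).2 qL) (pdistP x q)) andbT.
  apply: contra_neqN qp => /eqP nq; apply/esym/p_uniq; split; first exact/ptsP.
  by exists (pdist x q); split=> [|z m zL]; [apply: pdistP | rewrite -nq; apply: p_min].
have [aL bL cL] : [/\ a \in lpts L, b \in lpts L & c \in lpts L].
  by rewrite !DL !mem3 !eqxx !orbT.
move: abcU; rewrite uniq3 => /and3P[ab ac bc].
have: p \in lpts L by apply/ptsP.
rewrite DL mem3 /pat => /or3P[]/eqP Dp.
- by rewrite -Dp xp !far ?eqxx // Dp eq_sym.
- by rewrite -Dp xp !far ?eqxx ?orbT // Dp // eq_sym.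
- by rewrite -Dp xp !far ?eqxx ?orbT // Dp.
Qed.

Lemma thirdp_pat a b : pdist a b = 1 -> forall x, pat (pdist x a) (pdist x b) (pdist x (thirdp a b)).
Proof. by move=> /thirdp_line[L [abcU DL]] x; apply: line_pattern DL. Qed.

End NearOctagonDistance.

Section Embedding.
Variable N : geometry.
Hypothesis hoct : near_octagon N.
Hypothesis hHJ : exists (A : points N -> Prop) (B : lines N -> Prop),
  isomorphic HJ (subgeometry A B) /\ isometrically_embedded A B.
Local Notation P := {classic (points N)}.

Lemma iso_collinear (S T : geometry) f (g : lines S -> lines T) : bijective f -> bijective g ->
    (forall x L, incident x L <-> incident (f x) (g L)) ->
  forall x y, collinear x y <-> collinear (f x) (f y).
Proof.
move=> f_bij [g' gK g'K] fg x y; split=> -[xy [L [xL yL]]].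
  split=> [/(bij_inj f_bij)//|]; exists (g L); by split; apply/fg.
split=> [Dxy|]; first by case: xy; rewrite Dxy.
by exists (g' L); split; apply/fg; rewrite g'K.
Qed.

Lemma iso_walk (S T : geometry) f (g : lines S -> lines T) : bijective f -> bijective g ->
    (forall x L, incident x L <-> incident (f x) (g L)) ->
  forall n x y, walk n x y <-> walk n (f x) (f y).
Proof.
move=> f_bij g_bij fg; have col := iso_collinear f_bij g_bij fg.
elim=> [|n IHn] x y; first by split=> [->|/(bij_inj f_bij)].
split=> [[z [xz zy]]|[z' [xz zy]]]; first by exists (f z); split; [apply/col | apply/IHn].
have [f' _ f'K] := f_bij; exists (f' z').
by split; [apply/col | apply/IHn]; rewrite f'K.
Qed.

(** An isomorphism preserves walks, so distances of HJ become distances of the subgeometry, and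
    isometry makes them distances of N. *)
Lemma hj_embedding : exists e : positive -> P,
  (forall w u, u \in pts -> pdist hoct (e (wapp w 1)) (e (wapp w u)) = lev u) /\
  (forall w i j, i \in pts -> j \in adjs i -> pdist hoct (e (wapp w i)) (e (wapp w j)) = 1).
Proof.
have [A [B [[f [g [f_bij g_bij fg]]] isom]]] := hHJ.
have isoP u v n : dist u v n -> pdist hoct (sval (f u)) (sval (f v)) = n.
  case=> uv n_min; apply/pdist_eq/isom; split=> [|m].
    by apply/(iso_walk f_bij g_bij fg).
  by move/(iso_walk f_bij g_bij fg)/n_min.
exists (fun u => sval (f (hjp u))); split=> [w u u_pts|w i j i_pts ij].
  by rewrite pdistC; apply/isoP/hj_dist.
have j_pts := adjs_pts i_pts ij; apply: isoP.
have col : collinear (hjp (wapp w i)) (hjp (wapp w j)).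
  by rewrite hj_collinear ?wapp_pts // adjs_word.
split=> [|[|m] //]; first by exists (hjp (wapp w j)).
by move=> Dij; case: col.
Qed.
End Embedding.

(** * The isomorphism *)

Lemma inj_onto_bijective (S T : Type) (f : S -> T) : injective f -> (forall t, exists s, f s = t) -> bijective f.
Proof.
move=> f_inj f_onto; pose g t := sval (cid (f_onto t)).
have gK t : f (g t) = t := svalP (cid (f_onto t)).
by exists g => // s; apply: f_inj.
Qed.

Section Isomorphism.
Variable N : geometry.
Hypothesis hoct : near_octagon N.
Hypothesis hord : has_order N 2 10.
Local Notation P := {classic (points N)}.
Local Notation d := (pdist hoct).
Local Notation third := (thirdp hoct hord).
Variable f : P -> {perm octonion F4}.
Hypothesis f_T : forall y, f y \in rootT.
Hypothesis f_inj : injective f.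
Hypothesis f_onto : forall s, s \in rootT -> exists y, f y = s.
Hypothesis f_tcol : forall y y', d y y' = 1 -> tcol (f y) (f y').
Hypothesis f_tcol_d : forall y y', tcol (f y) (f y') -> d y y' = 1.
Hypothesis f_third : forall a b, d a b = 1 -> f (third a b) = (f a * f b)%g.

Local Notation Gpred := (fun A : {set {perm octonion F4}} => #|G24_2 : 'N_G24_2(<<A>>)|%g \in [:: 1365; 13650]).

Lemma f_central y : f y \in central_involutions G24_2.
Proof. by rewrite central_G24; apply: f_T. Qed.

Definition point_map (y : points N) : points G24_near_octagon := exist _ (f y) (f_central y).

Definition line_image (L : lines N) : {set {perm octonion F4}} := [set s in map f (lpts hord L)].

Lemma line_triple (a b : P) L : a != b -> a \in lpts hord L -> b \in lpts hord L -> 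
  lpts hord L =i [:: a; b; third a b] /\ d a b = 1.
Proof.
move=> ab aL bL; have dab : d a b = 1 by apply/(pdist1_line hoct hord); split=> //; exists L.
have [M [_ DM]] := thirdp_line hord dab; split=> // x; rewrite -DM.
by rewrite (line_uniq (hord := hord) hoct ab aL bL (M := M)) ?DM ?mem3 ?eqxx ?orbT.
Qed.

Lemma line_imageE (a b : P) L : a != b -> a \in lpts hord L -> b \in lpts hord L -> 
  line_image L = [set f a; f b; (f a * f b)%g] /\ tcol (f a) (f b).
Proof.
move=> ab aL bL; have [DL dab] := line_triple ab aL bL; split; last exact: f_tcol.
apply/setP=> s; rewrite [LHS]inE !finset.in_setU !finset.in_set1 -(f_third dab) (eq_mem_map f DL).
by rewrite -[map f _]/[:: f a; f b; f (third a b)] mem3 orbA.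
Qed.

Lemma two_points L : exists a b : P, [/\ a != b, a \in lpts hord L & b \in lpts hord L].
Proof.
have [] := lptsP hord L; case: (lpts hord L) => [|a [|b s]] // abU _ _; exists a, b.
move: abU; rewrite cons_uniq in_cons negb_or => /andP[/andP[ab _] _].
by split; rewrite ?mem_head // in_cons mem_head orbT.
Qed.

Lemma line_image_in L : line_image L \in involution_lines G24_2 Gpred.
Proof.
have [a [b [ab aL bL]]] := two_points L; have [-> /and5P[aT bT fab com ind]] := line_imageE ab aL bL.
apply/imset2P; exists (f a) (f b); rewrite ?central_G24 // inE bT fab com; exact: ind.
Qed.

Definition line_map (L : lines N) : lines G24_near_octagon := exist _ (line_image L) (line_image_in L).

Lemma mem_line_image (x : P) L : (f x \in line_image L) = (x \in lpts hord L).
Proof. by rewrite inE (mem_map f_inj). Qed.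

(** A target line {s, t, s t} comes from two collinear points, and [f_third] sends the third point
    of their line to s t, so lines correspond as sets of points. *)
Lemma near_octagon_iso : isomorphic N G24_near_octagon.
Proof.
exists point_map, line_map; split.
- apply: inj_onto_bijective => [x y /(congr1 sval)/f_inj //|[s s_in]].
  have [|y Dy] := f_onto (s := s); first by rewrite -central_G24.
  by exists y; apply: val_inj.
- apply: inj_onto_bijective => [L M /(congr1 sval) /= DLM|[l l_in]].
    have [a [b [ab aL bL]]] := two_points L.
    by apply: (line_uniq (hord := hord) hoct ab aL bL); rewrite -mem_line_image -DLM mem_line_image.
  have /imset2P[x y] := l_in; rewrite central_G24 => xT; rewrite inE => /and4P[yT xy com ind] Dl.
  have [a Da] := f_onto xT; have [b Db] := f_onto yT.
  have dab : d a b = 1 by apply: f_tcol_d; rewrite Da Db; apply/and5P; split.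
  have ab : a != b by apply: contraNneq xy => Dab; rewrite -Da -Db Dab.
  have [L [_ DL]] := thirdp_line hord dab; exists L; apply: val_inj => /=.
  have [aL bL] : a \in lpts hord L /\ b \in lpts hord L by rewrite !DL !mem3 !eqxx orbT.
  by have [-> _] := line_imageE ab aL bL; rewrite Da Db Dl.
move=> x L; have [_ _ LP] := lptsP hord L; rewrite /= -/(line_image L) mem_line_image.
exact: LP.
Qed.
End Isomorphism.

Theorem theorem1p3 (N : geometry) (hoct : near_octagon N)
    (hord : has_order N 2 10)
    (hHJ : exists (A : points N -> Prop) (B : lines N -> Prop),
       isomorphic HJ (subgeometry A B) /\ isometrically_embedded A B) :
  isomorphic N G24_near_octagon.
Proof.
have [e e_emb] := hj_embedding hoct hHJ.
have H0 := pdist_eq0 hoct; have H1 := pdistC hoct; have H2 := pdist_tri hoct; have H3 := pdist_le4 hoct.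
have H4 := @pdist_geo _ hoct; have H5 := @thirdp_pat _ hoct hord; have H6 := mem_nbp hoct hord.
have H7 := nbp_uniq hoct hord; have H8 := nbp_size hord.
apply: (near_octagon_iso (f := toT H0 H1 H2 H3 H4 H5 H6 H7 H8 e_emb)).
- exact: toT_T.
- exact: toT_inj.
- exact: toT_onto.
- exact: toT_tcol.
- exact: tcol_d.
exact: toT_third.
Qed.
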